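(* Let $R$ be a real closed field, $A=R[x_1,\dots,x_n]$ and $\alpha,\beta\in\mathrm{Sper}\,A$. Assume that at least one of $\alpha$, $\beta$ is monomial. Then the conclusion of the Connectedness conjecture holds for the pair $\alpha,\beta$: for every finite collection $g_1,\dots,g_s\in A\setminus\langle\alpha,\beta\rangle$ there exists a connected set $C\subset\mathrm{Sper}\,A$ with $\alpha,\beta\in C$ and $C\cap\{g_i=0\}=\emptyset$ for all $i\in\{1,\dots,s\}$. Hence also the conclusion of the abstract Pierce–Birkhoff conjecture holds for $\alpha,\beta$: for every piecewise polynomial function $f:R^n\to R$, every local polynomial representative $f_\alpha$ of $f$ at $\alpha$ and every local polynomial representative $f_\beta$ of $f$ at $\beta$, one has $f_\alpha-f_\beta\in\langle\alpha,\beta\rangle$.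
   Context: $\mathrm{Sper}\,A$ is the set of pairs $\alpha=(\mathfrak p_\alpha,\le_\alpha)$ with $\mathfrak p_\alpha$ a prime ideal of $A$ and $\le_\alpha$ a total ordering of $A[\alpha]:=A/\mathfrak p_\alpha$; $f(\alpha)$ is the image of $f\in A$ in $A[\alpha]$. The spectral topology has basic open sets $\{\alpha: f_1(\alpha)>0,\dots,f_k(\alpha)>0\}$; ''connected'' refers to it. $\{g=0\}=\{\delta: g(\delta)=0\}$. The separating ideal $\langle\alpha,\beta\rangle$ is the ideal of $A$ generated by all $f\in A$ with $f(\alpha)\ge0$ and $f(\beta)\le0$. The valuation $\nu_\alpha$: let $A(\alpha)=\mathrm{Frac}(A[\alpha])$ with the induced ordering; $R_\alpha=\{x\in A(\alpha): |x|\le_\alpha z\text{ for some }z\in A[\alpha]\}$ is a valuation ring, $\nu_\alpha$ the corresponding valuation and $\Gamma_\alpha$ its value group. Monomial points: for an ordered abelian group $\Gamma$, $R[[t^{\Gamma}]]$ is the set of formal sums $\sum_\gamma a_\gamma t^\gamma$ ($a_\gamma\in R$) with well-ordered support $\{\gamma:a_\gamma\ne0\}$, and $v(\sum a_\gamma t^\gamma)=\min\{\gamma: a_\gamma\neq0\}$. A choice of signs, i.e. a group homomorphism $\gamma\mapsto \mathrm{sgn}(t^\gamma)\in\{\pm1\}$ on $\Gamma$, defines a total ordering on $R[[t^\Gamma]]$ in which the sign of a non-zero $f=\sum a_\gamma t^\gamma$ is $\mathrm{sgn}(a_{v(f)})\,\mathrm{sgn}(t^{v(f)})$. An $R$-homomorphism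 $A\to R[[t^\Gamma]]$ together with such sign data (a semi-curvette) determines a point of $\mathrm{Sper}\,A$: its support is the kernel and its ordering is induced from $R[[t^\Gamma]]$. The point $\alpha$ is monomial if it is given by a semi-curvette $x_j\mapsto c_jt^{a_j}$ ($1\le j\le n$) where $c_j\in R$ and $a_1,\dots,a_n$ are strictly positive, $\mathbb Q$-linearly independent elements of $\Gamma_\alpha$ (with $\Gamma=\Gamma_\alpha$). A function $f:R^n\to R$ is piecewise polynomial if $R^n$ is covered by finitely many closed semi-algebraic sets $P_i$ such that for each $i$ there is $f_i\in A$ with $f|_{P_i}=f_i|_{P_i}$. Let $\tilde P_i\subset\mathrm{Sper}\,A$ be the constructible set defined by the same polynomial sign conditions as $P_i$; the $\tilde P_i$ cover $\mathrm{Sper}\,A$. A local polynomial representative $f_\alpha$ of $f$ at $\alpha$ is any $f_i$ with $\alpha\in\tilde P_i$. *)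

(* Defs.v *)
From HB Require Import structures.
From mathcomp Require Import all_boot all_order all_algebra generic_quotient.
From mathcomp Require Import ring_quotient fraction.
(* The next two lines must stay in this order: with the converse order the
   notations of mpoly cannot be loaded. *)
From mathcomp Require Import mpoly.
From mathcomp Require Import boolp classical_sets functions cardinality fsbigop.
From mathcomp Require Import topology normedtype.

Set Implicit Arguments.
Unset Strict Implicit.
Unset Printing Implicit Defensive.

Import Order.TTheory GRing.Theory Num.Theory.
Import numFieldNormedType.Exports.

Local Open Scope classical_set_scope.
Local Open Scope ring_scope.
Local Open Scope quotient_scope.

(** * The real spectrum *)

Definition ring_total_order (D : comNzRingType) (le : rel D) : Prop :=
  [/\ total le, antisymmetric le, transitive le,
      forall z x y, le x y -> le (x + z) (y + z) &
      forall x y, le 0 x -> le 0 y -> le 0 (x * y)].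

(* Classically every subset is decidable, so [prime_idealr A] ranges over all
   the prime ideals of A. *)
Record sper (A : comNzRingType) := Sper {
  sper_supp : prime_idealr A;
  sper_le : rel {ideal_quot sper_supp};
  sper_leP : ring_total_order sper_le }.

(* A[alpha], with its ordering as the canonical order *)
Definition residue (A : comNzRingType) (alpha : sper A) : Type :=
  {ideal_quot (sper_supp alpha)}.

Definition sper_ev (A : comNzRingType) (alpha : sper A) (f : A) :
  residue alpha := \pi_{ideal_quot (sper_supp alpha)} f.

Section Residue.
Variables (A : comNzRingType) (alpha : sper A).
Local Notation D := (residue alpha).

HB.instance Definition _ := GRing.ComNzRing.on D.

Let unit_pred : {pred D} := fun x => `[< exists y, y * x = 1 >].
Let inv_fun (x : D) : D :=
  if pselect (exists y, y * x = 1) is left e then sval (cid e) else x.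

Let residue_mulVx : {in unit_pred, left_inverse 1 inv_fun *%R}.
Proof.
move=> x /asboolP ux; rewrite /inv_fun; case: pselect => // e.
by case: cid.
Qed.

Let residue_unitP x y : y * x = 1 -> unit_pred x.
Proof. by move=> yx; apply/asboolP; exists y. Qed.

Let residue_inv_out : {in [predC unit_pred], inv_fun =1 id}.
Proof.
by move=> x /asboolPn ux; rewrite /inv_fun; case: pselect.
Qed.

HB.instance Definition _ := GRing.ComNzRing_hasMulInverse.Build D
  residue_mulVx residue_unitP residue_inv_out.

HB.instance Definition _ := GRing.ComUnitRing_isIntegral.Build D
  (@Quotient.rquot_IdomainAxiom A (sper_supp alpha)).

Let le : rel D := @sper_le A alpha.
Let lt : rel D := fun x y => (y != x) && le x y.
Let norm (x : D) : D := if le 0 x then x else - x.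

Let tot : total le. Proof. by case: (sper_leP alpha). Qed.
Let asym : antisymmetric le. Proof. by case: (sper_leP alpha). Qed.
Let tr : transitive le. Proof. by case: (sper_leP alpha). Qed.
Let leD (z x y : D) : le x y -> le (x + z) (y + z).
Proof. by case: (sper_leP alpha) => _ _ _ + _; exact. Qed.
Let leM (x y : D) : le 0 x -> le 0 y -> le 0 (x * y).
Proof. by case: (sper_leP alpha) => _ _ _ _; exact. Qed.

Let le0_add (x y : D) : le 0 x -> le 0 y -> le 0 (x + y).
Proof. by move=> x0 y0; apply: tr y0 _; have := leD y x0; rewrite add0r. Qed.
Let le0_anti (x : D) : le 0 x -> le x 0 -> x = 0.
Proof. by move=> x0 x0'; apply: asym; rewrite x0 x0'. Qed.
Let sub_ge0 (x y : D) : le 0 (y - x) = le x y.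
Proof.
apply/idP/idP => [/(leD x)|/(leD (- x))]; first by rewrite add0r subrK.
by rewrite subrr.
Qed.
Let le0_total (x : D) : le 0 x || le x 0. Proof. exact: tot. Qed.
Let ge0_norm (x : D) : le 0 x -> norm x = x.
Proof. by rewrite /norm => ->. Qed.
Let normN (x : D) : norm (- x) = norm x.
Proof.
rewrite /norm; have leN : le 0 (- x) = le x 0 by rewrite -[RHS]sub_ge0 sub0r.
rewrite leN; case: ifP => x0; case: ifP => x0' //; last first.
- by have := le0_total x; rewrite x0 x0'.
- by rewrite opprK.
- by rewrite (le0_anti x0' x0) oppr0.
Qed.

HB.instance Definition _ := Num.IntegralDomain_isLeReal.Build D
  le0_add leM le0_anti sub_ge0 le0_total normN ge0_norm (fun _ _ => erefl).

End Residue.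

Lemma residue_leE (A : comNzRingType) (alpha : sper A) (x y : residue alpha) :
  (x <= y) = sper_le (x : {ideal_quot (sper_supp alpha)}) y.
Proof. by []. Qed.

Section SpectralTopology.
Variable A : comNzRingType.

HB.instance Definition _ := gen_eqMixin (sper A).
HB.instance Definition _ := gen_choiceMixin (sper A).

Definition basic_open (s : seq A) : set (sper A) :=
  [set alpha | forall f, f \in s -> 0 < sper_ev alpha f].

Definition basic_index : Type := seq A.
HB.instance Definition _ := Choice.on basic_index.
HB.instance Definition _ := isPointed.Build basic_index [::].

Let base_cover :
  \bigcup_(s in [set: basic_index]) basic_open s = [set: sper A].
Proof. by apply/seteqP; split => // alpha _; exists [::]. Qed.

Let base_join (s t : basic_index) alpha : [set: basic_index] s ->
  [set: basic_index] t -> basic_open s alpha -> basic_open t alpha ->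
  exists u : basic_index, [/\ [set: basic_index] u, basic_open u alpha &
    basic_open u `<=` basic_open s `&` basic_open t].
Proof.
move=> _ _ sa ta; exists (s ++ t); split => //.
  by move=> f; rewrite mem_cat => /orP[/sa|/ta].
by move=> b stb; split=> f fs; apply: stb; rewrite mem_cat fs ?orbT.
Qed.

HB.instance Definition _ := isBaseTopological.Build (sper A)
  base_cover base_join.

End SpectralTopology.

Section SeparatingIdeal.
Variable A : comNzRingType.

Definition sper_zeros (g : A) : set (sper A) :=
  [set delta | sper_ev delta g = 0].

Definition generated_ideal (S : set A) : set A :=
  [set h | exists (k : nat) (u f : 'I_k -> A),
     (forall i, S (f i)) /\ h = \sum_(i < k) u i * f i].

Definition separating_ideal (alpha beta : sper A) : set A :=
  generated_ideal
    [set f | 0 <= sper_ev alpha f /\ sper_ev beta f <= 0].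

End SeparatingIdeal.

(** * Ordered fields of fractions and the valuation of an ordered domain *)

Section FractionOrder.
Variable D : realDomainType.
Local Notation K := {fraction D}.
Local Notation "x %:F" := (@FracField.tofrac D x).

Lemma fracP (x : K) : exists a b : D, b != 0 /\ x = a%:F / b%:F.
Proof.
elim/quotW: x => x; exists \n_x, \d_x; split; first exact: denom_ratioP.
have dF : (\d_x)%:F != 0 by rewrite tofrac_eq0 denom_ratioP.
apply: (mulIf dF); rewrite divfK //.
rewrite /FracField.tofrac; unlock.
rewrite [LHS](_ : _ = \pi_K (FracField.mulf x (Ratio \d_x 1))); last first.
  by rewrite FracField.pi_mul.
apply/eqmodP; rewrite /= FracField.equivfE /FracField.mulf.
by rewrite !numden_Ratio ?mulf_neq0 ?denom_ratioP ?oner_eq0 // !mulr1 mulrC.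
Qed.

(* a / b >= 0 iff a b >= 0 *)
Definition frac_ge0 (x : K) : bool := 0 <= \n_(repr x) * \d_(repr x).

Lemma frac_ge0E (a b : D) : b != 0 -> frac_ge0 (a%:F / b%:F) = (0 <= a * b).
Proof.
move=> b0; rewrite /frac_ge0; set x := (a%:F / b%:F).
set r := repr x; have d0 : \d_r != 0 by exact: denom_ratioP.
have : \n_r * b = a * \d_r.
  apply/eqP; rewrite -tofrac_eq !tofracM.
  have bF : b%:F != 0 by rewrite tofrac_eq0.
  have dF : (\d_r)%:F != 0 by rewrite tofrac_eq0.
  have -> : a%:F = x * b%:F by rewrite /x divfK.
  have -> : (\n_r)%:F = x * (\d_r)%:F.
    rewrite -[x]reprK -/r /FracField.tofrac; unlock.
    rewrite [RHS](_ : _ = \pi_K (FracField.mulf r (Ratio \d_r 1))); last first.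
      by rewrite FracField.pi_mul.
    apply/eqmodP; rewrite /= FracField.equivfE /FracField.mulf.
    by rewrite !numden_Ratio ?mulf_neq0 ?oner_eq0 // !mulr1 mul1r mulrC.
  by rewrite mulrAC.
move=> e; have d2 : 0 < \d_r ^+ 2 by rewrite exprn_even_gt0.
have b2 : 0 < b ^+ 2 by rewrite exprn_even_gt0.
rewrite -(pmulr_lge0 _ b2) -[RHS](pmulr_lge0 _ d2).
by rewrite !expr2 mulrACA e mulrACA (mulrC \d_r b) mulrACA.
Qed.

Let le (x y : K) : bool := frac_ge0 (y - x).
Let lt (x y : K) : bool := (y != x) && le x y.
Let norm (x : K) : K := if le 0 x then x else - x.

Let le0E (a b : D) : b != 0 -> le 0 (a%:F / b%:F) = (0 <= a * b).
Proof. by move=> b0; rewrite /le subr0 frac_ge0E. Qed.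

Let leN0 (x : K) : le x 0 = le 0 (- x). Proof. by rewrite /le sub0r subr0. Qed.

Let leN0E (a b : D) : b != 0 -> le (a%:F / b%:F) 0 = (a * b <= 0).
Proof.
by move=> b0; rewrite leN0 -mulNr -tofracN le0E // mulNr oppr_ge0.
Qed.

Let le0_add (x y : K) : le 0 x -> le 0 y -> le 0 (x + y).
Proof.
have [a [b [b0 ->]]] := fracP x; have [c [d [d0 ->]]] := fracP y.
rewrite !le0E // => ab cd; rewrite addf_div ?tofrac_eq0 //.
rewrite -!tofracM -tofracD le0E ?mulf_neq0 // mulrDl.
by rewrite (mulrACA a) (mulrC b d) (mulrACA c) addr_ge0 // mulr_ge0 //
  -expr2 sqr_ge0.
Qed.

Let le0_mul (x y : K) : le 0 x -> le 0 y -> le 0 (x * y).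
Proof.
have [a [b [b0 ->]]] := fracP x; have [c [d [d0 ->]]] := fracP y.
rewrite !le0E // => ab cd.
by rewrite mulf_div -!tofracM le0E ?mulf_neq0 // mulrACA mulr_ge0.
Qed.

Let le0_anti (x : K) : le 0 x -> le x 0 -> x = 0.
Proof.
have [a [b [b0 ->]]] := fracP x; rewrite le0E // leN0E // => p n.
have /eqP : a * b == 0 by rewrite eq_le p n.
by move/eqP; rewrite mulf_eq0 (negPf b0) orbF => /eqP ->; rewrite tofrac0 mul0r.
Qed.

Let sub_ge0 (x y : K) : le 0 (y - x) = le x y.
Proof. by rewrite /le subr0. Qed.

Let le0_total (x : K) : le 0 x || le x 0.
Proof.
by have [a [b [b0 ->]]] := fracP x; rewrite le0E // leN0E // le_total.
Qed.

Let ge0_norm (x : K) : le 0 x -> norm x = x.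
Proof. by rewrite /norm => ->. Qed.

Let normN (x : K) : norm (- x) = norm x.
Proof.
rewrite /norm -leN0; case: ifP => x0; case: ifP => x0' //; last first.
- by have := le0_total x; rewrite x0 x0'.
- by rewrite opprK.
- by rewrite (le0_anti x0' x0) oppr0.
Qed.

HB.instance Definition _ := Num.IntegralDomain_isLeReal.Build K
  le0_add le0_mul le0_anti sub_ge0 le0_total normN ge0_norm
  (fun _ _ => erefl).

Lemma tofrac_le : {mono @FracField.tofrac D : x y / x <= y}.
Proof.
move=> x y; change (le x%:F y%:F = (x <= y)).
by rewrite -sub_ge0 -tofracB -[(y - x)%:F]divr1 le0E ?oner_eq0 // mulr1 subr_ge0.
Qed.

End FractionOrder.

HB.mixin Record isOrdGroup G & Num.POrderedZmodule G := {
  oag_le_total : forall x y : G, (x <= y) || (y <= x);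
  oag_leD2r : forall z x y : G, x <= y -> x + z <= y + z }.

(* totally ordered abelian groups, written additively *)
#[short(type="oagType")]
HB.structure Definition OrdGroup :=
  { G of Num.POrderedZmodule G & isOrdGroup G }.

Section Valuation.
Variable D : realDomainType.
Local Notation K := {fraction D}.
Local Notation "x %:F" := (@FracField.tofrac D x).

Definition valuation_ring : set K := [set x | exists z : D, `|x| <= z%:F].
Local Notation O := valuation_ring.

Lemma valuation_ring1 : O 1.
Proof. by exists 1; rewrite normr1 tofrac1. Qed.

Lemma valuation_ringM x y : O x -> O y -> O (x * y).
Proof.
move=> [a xa] [b yb]; exists (a * b).
by rewrite normrM tofracM ler_pM.
Qed.

Lemma valuation_ringD x y : O x -> O y -> O (x + y).
Proof.
move=> [a xa] [b yb]; exists (a + b).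
by rewrite tofracD (le_trans (ler_normD _ _)) // lerD.
Qed.

Lemma valuation_ring_total x : O x \/ O x^-1.
Proof.
have [x1|x1] := leP `|x| 1; [left|right]; exists 1; rewrite tofrac1 //.
by rewrite normfV invf_le1 ?(lt_trans ltr01 x1) // ltW.
Qed.

Definition nonzero : Type := {x : K | x != 0}.
HB.instance Definition _ := Choice.on nonzero.

Lemma nonzeroP (x : nonzero) : val x != 0. Proof. exact: (valP x). Qed.

Definition nz1 : nonzero := exist _ 1 (oner_neq0 _).
Definition nzM (x y : nonzero) : nonzero :=
  exist _ (val x * val y) (mulf_neq0 (nonzeroP x) (nonzeroP y)).
Definition nzV (x : nonzero) : nonzero :=
  exist _ (val x)^-1 (etrans (congr1 negb (invr_eq0 _)) (nonzeroP x)).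

(* nu(x) <= nu(y) iff y / x lies in the valuation ring *)
Definition val_le (x y : nonzero) : bool := `[< O (val y / val x) >].
Definition val_equiv (x y : nonzero) : bool := val_le x y && val_le y x.

Lemma val_le_refl : reflexive val_le.
Proof.
move=> x; apply/asboolP; rewrite divff ?nonzeroP //; exact: valuation_ring1.
Qed.

Lemma val_le_trans : transitive val_le.
Proof.
move=> y x z /asboolP xy /asboolP yz; apply/asboolP.
have -> : val z / val x = (val z / val y) * (val y / val x).
  by rewrite mulrA divfK ?nonzeroP.
exact: valuation_ringM.
Qed.

Lemma val_le_total : total val_le.
Proof.
move=> x y; have := valuation_ring_total (val y / val x).
by rewrite invf_div => -[h|h]; apply/orP; [left|right]; apply/asboolP.
Qed.

Lemma val_leM x y x' y' : val_le x y -> val_le x' y' ->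
  val_le (nzM x x') (nzM y y').
Proof.
move=> /asboolP xy /asboolP xy'; apply/asboolP => /=.
by rewrite -mulf_div; exact: valuation_ringM.
Qed.

Lemma val_leV x y : val_le x y -> val_le (nzV y) (nzV x).
Proof. by move=> /asboolP xy; apply/asboolP; rewrite /= invrK mulrC. Qed.

Lemma val_equiv_refl : reflexive val_equiv.
Proof. by move=> x; rewrite /val_equiv val_le_refl. Qed.
Lemma val_equiv_sym x y : val_equiv x y = val_equiv y x.
Proof. by rewrite /val_equiv andbC. Qed.
Lemma val_equiv_trans : transitive val_equiv.
Proof.
move=> y x z /andP[xy yx] /andP[yz zy].
by rewrite /val_equiv (val_le_trans xy yz) (val_le_trans zy yx).
Qed.

Canonical val_equiv_equiv :=
  EquivRel val_equiv val_equiv_refl val_equiv_sym val_equiv_trans.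

(* K^* / O^* *)
Definition value_group : Type := {eq_quot val_equiv}.
Local Notation G := value_group.

HB.instance Definition _ : EqQuotient _ val_equiv G := EqQuotient.on G.
HB.instance Definition _ := Choice.on G.

Definition vg_zero : G := \pi_G nz1.
Definition vg_add (a b : G) : G := \pi_G (nzM (repr a) (repr b)).
Definition vg_opp (a : G) : G := \pi_G (nzV (repr a)).
Definition vg_le (a b : G) : bool := val_le (repr a) (repr b).

Lemma vg_eqP (x y : nonzero) : reflect (\pi_G x = \pi_G y) (val_equiv x y).
Proof. exact: eqquotP. Qed.

Lemma vg_reprP (x : nonzero) : val_equiv (repr (\pi_G x)) x.
Proof. by apply/vg_eqP; rewrite reprK. Qed.

Lemma vg_addE x y : vg_add (\pi_G x) (\pi_G y) = \pi_G (nzM x y).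
Proof.
have /andP[a b] := vg_reprP x; have /andP[c d] := vg_reprP y.
by apply/vg_eqP; rewrite /val_equiv !val_leM.
Qed.

Lemma vg_oppE x : vg_opp (\pi_G x) = \pi_G (nzV x).
Proof.
have /andP[a b] := vg_reprP x.
by apply/vg_eqP; rewrite /val_equiv !val_leV.
Qed.

Lemma vg_leE x y : vg_le (\pi_G x) (\pi_G y) = val_le x y.
Proof.
have /andP[a b] := vg_reprP x; have /andP[c d] := vg_reprP y.
apply/idP/idP => h; first exact: val_le_trans (val_le_trans b h) c.
exact: val_le_trans (val_le_trans a h) d.
Qed.

Let nz_eq (x y : nonzero) : val x = val y -> \pi_G x = \pi_G y :> G.
Proof. by move=> /val_inj ->. Qed.

Let vg_addA : associative vg_add.
Proof.
elim/quotW=> x; elim/quotW=> y; elim/quotW=> z.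
rewrite (vg_addE y) (vg_addE x y) !vg_addE; apply: nz_eq.
by rewrite /= mulrA.
Qed.
Let vg_addC : commutative vg_add.
Proof.
elim/quotW=> x; elim/quotW=> y.
by rewrite !vg_addE; apply: nz_eq; rewrite /= mulrC.
Qed.
Let vg_add0 : left_id vg_zero vg_add.
Proof.
by elim/quotW=> x; rewrite vg_addE; apply: nz_eq; rewrite /= mul1r.
Qed.
Let vg_addN : left_inverse vg_zero vg_opp vg_add.
Proof.
elim/quotW=> x; rewrite vg_oppE vg_addE; apply: nz_eq.
by rewrite /= mulVf ?nonzeroP.
Qed.

HB.instance Definition _ :=
  GRing.isZmodule.Build G vg_addA vg_addC vg_add0 vg_addN.

Let vg_lt (a b : G) : bool := (b != a) && vg_le a b.
Let vg_le_refl : reflexive vg_le. Proof. by move=> a; exact: val_le_refl. Qed.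
Let vg_le_anti : antisymmetric vg_le.
Proof.
elim/quotW=> x; elim/quotW=> y; rewrite !vg_leE => xy.
exact/vg_eqP.
Qed.
Let vg_le_trans : transitive vg_le.
Proof. by move=> b a c; exact: val_le_trans. Qed.
Let vg_le_total : total vg_le.
Proof. by move=> a b; exact: val_le_total. Qed.

HB.instance Definition _ := Order.isPOrder.Build ring_display G
  (fun _ _ => erefl : vg_lt _ _ = _) vg_le_refl vg_le_anti vg_le_trans.

Let vg_leD2r (z x y : G) : x <= y -> x + z <= y + z.
Proof.
elim/quotW: z => z; elim/quotW: x => x; elim/quotW: y => y.
change (vg_le (\pi_G x) (\pi_G y) ->
  vg_le (vg_add (\pi_G x) (\pi_G z)) (vg_add (\pi_G y) (\pi_G z))).
by rewrite !vg_addE !vg_leE => h; apply: val_leM => //; exact: val_le_refl.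
Qed.

HB.instance Definition _ := isOrdGroup.Build G vg_le_total vg_leD2r.

End Valuation.
(** * Generalized power series *)

Section WellOrdered.
Variable G : oagType.
Implicit Types (S T B : set G) (x y z : G).

Definition well_ordered S : Prop :=
  forall B, B `<=` S -> B !=set0 ->
    exists2 m, B m & forall b, B b -> m <= b.

Lemma oag_ltNge x y : (x < y) = ~~ (y <= x).
Proof.
have [xy|xy] := boolP (x < y).
  by apply/esym; apply/negP => yx; have := lt_le_trans xy yx; rewrite ltxx.
have := oag_le_total x y; have [//|/= nyx] := boolP (y <= x).
by rewrite orbF le_eqVlt (negPf xy) orbF => /eqP e; rewrite e lexx in nyx.
Qed.

Lemma oag_leD x y x' y' : x <= y -> x' <= y' -> x + x' <= y + y'.
Proof.
move=> xy xy'; apply: le_trans (oag_leD2r x' _ _ xy) _.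
by rewrite ![y + _]addrC; exact: oag_leD2r.
Qed.

Lemma well_ordered_sub S T : S `<=` T -> well_ordered T -> well_ordered S.
Proof. by move=> ST wT B BS; apply: wT => x /BS/ST. Qed.

Lemma well_ordered_set1 x : well_ordered [set x].
Proof.
move=> B Bx [y By]; exists y => // b Bb.
by rewrite (Bx y By) (Bx b Bb).
Qed.

Lemma well_orderedU S T :
  well_ordered S -> well_ordered T -> well_ordered (S `|` T).
Proof.
move=> wS wT B BST [x Bx].
have [[y [By Sy]]|nS] := pselect (B `&` S !=set0); last first.
  apply: wT; last by exists x.
  by move=> z Bz; have [Sz|//] := BST z Bz; case: nS; exists z.
have [[z [Bz Tz]]|nT] := pselect (B `&` T !=set0); last first.
  apply: wS; last by exists x.
  by move=> z Bz; have [//|Tz] := BST z Bz; case: nT; exists z.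
have [m [Bm Sm] mP] := wS (B `&` S) (@subIsetr _ _ _) (ex_intro _ y (conj By Sy)).
have [n [Bn Tn] nP] := wT (B `&` T) (@subIsetr _ _ _) (ex_intro _ z (conj Bz Tz)).
have /orP[mn|nm] := oag_le_total m n; [exists m => //|exists n => //] => b Bb.
  have [Sb|Tb] := BST b Bb; first exact: mP.
  by apply: le_trans mn _; exact: nP.
have [Sb|Tb] := BST b Bb; last exact: nP.
by apply: le_trans nm _; exact: mP.
Qed.

Definition sumset S T : set G :=
  [set x | exists a b, [/\ S a, T b & x = a + b]].

Lemma well_ordered_sumset S T :
  well_ordered S -> well_ordered T -> well_ordered (sumset S T).
Proof.
move=> wS wT B BST [x0 Bx0]; apply: contrapT => nomin.
pose P a b := [/\ S a, T b & B (a + b)].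
pose Q a b := P a b /\ forall a' b', P a' b' -> a' + b' <= a + b -> a <= a'.
have getQ (L : set G) : (exists a b, P a b /\ L (a + b)) ->
    (forall u v, L u -> v <= u -> L v) -> exists a b, Q a b /\ L (a + b).
  move=> [a0 [b0 [Pab0 Lab0]]] Ldown.
  have [||a [Sa [b [Pab Lab]]] aP] :=
      wS [set a | S a /\ exists b, P a b /\ L (a + b)].
  - by move=> ? [].
  - by exists a0; split; [case: Pab0|exists b0].
  exists a, b; split=> //; split=> // a' b' Pab' le'.
  apply: aP; split; first by case: Pab'.
  by exists b'; split=> //; exact: Ldown Lab le'.
have [||t [s Qst] tP] := wT [set t | exists s, Q s t].
- by move=> t [s [[]]].
- have [a [b [Sa Tb e]]] := BST _ Bx0.
  have ex : exists a b, P a b /\ [set: G] (a + b).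
    by exists a, b; rewrite /P -e.
  have [a' [b' [Qab _]]] := getQ _ ex (fun _ _ _ _ => I).
  by exists b', a'.
have ex : exists u v, P u v /\ u + v < s + t.
  apply: contra_notP nomin => nex; exists (s + t); first by case: Qst => -[].
  move=> b Bb; have [//|nle] := boolP (s + t <= b).
  case: nex; have [u [v [Su Tv e]]] := BST _ Bb.
  by exists u, v; rewrite /P -e /= oag_ltNge.
have down u v : u < s + t -> v <= u -> v < s + t.
  by move=> uL vu; exact: le_lt_trans vu uL.
have [s' [t' [Q' lt']]] := getQ [set x | x < s + t] ex down.
have ss' : s <= s' by apply: (Qst.2 _ _ Q'.1); exact: ltW.
have tt' : t <= t' by apply: tP; exists s'.
by have := lt_le_trans lt' (oag_leD ss' tt'); rewrite ltxx.
Qed.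

Lemma finite_well_ordered S :
  well_ordered S -> well_ordered [set - x | x in S] -> finite_set S.
Proof.
move=> wS wN; apply: contrapT => infS.
have N x y : - y <= - x -> x <= y.
  move=> /(oag_leD2r (x + y)).
  by rewrite addrCA addNr addr0 addKr.
have getmax B : B `<=` S -> B !=set0 -> exists2 m, B m & forall b, B b -> b <= m.
  move=> BS [x Bx]; have [||_ [m Bm <-] mP] := wN [set - x | x in B].
  - by move=> _ [y By <-]; exists y => //; exact: BS.
  - by exists (- x), x.
  by exists m => // b Bb; apply: N; apply: mP; exists b.
have [||e [Se infe] eP] := wS [set e | S e /\ infinite_set [set x | S x /\ x <= e]].
- by move=> ? [].
- have [//||m Sm mP] := getmax S.
    apply/set0P; apply: contra_notN infS => /eqP ->; exact: finite_set0.
  exists m; split=> //; rewrite [X in infinite_set X](_ : _ = S) //.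
  by apply/seteqP; split=> [x []|x Sx] //; split=> //; exact: mP.
apply: infe; rewrite [X in finite_set X](_ : _ =
    [set x | S x /\ x < e] `|` [set e]); last first.
  apply/seteqP; split=> x /=.
    by rewrite le_eqVlt => -[Sx /orP[/eqP|]]; [right|left].
  by move=> [[Sx /ltW]|->].
rewrite finite_setU; split; last exact: finite_set1.
have [->|/set0P ne] := eqVneq [set x | S x /\ x < e] set0.
  exact: finite_set0.
have [|m [Sm me] mP] := getmax _ _ ne; first by move=> ? [].
apply: contrapT => infm.
have : e <= m.
  apply: eP; split=> //; apply: contra_not infm; apply: sub_finite_set.
  by move=> x [Sx xe]; split=> //; exact: mP.
by move=> /(lt_le_trans me); rewrite ltxx.
Qed.

Lemma finite_convolution S T (x : G) :
  well_ordered S -> well_ordered T -> finite_set [set a | S a /\ T (x - a)].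
Proof.
move=> wS wT; apply: finite_well_ordered.
  by apply: well_ordered_sub wS => a [].
move=> B BN [b Bb].
have [||m [c Bc <-] mP] := wT [set x + c | c in B].
- by move=> _ [c /BN[a [_ Ta] <-] <-].
- by exists (x + b), b.
exists c => // d Bd.
have := mP (x + d) (ex_intro2 _ _ d Bd erefl) => /(oag_leD2r (- x)).
by rewrite ![x + _]addrC !addrK.
Qed.

End WellOrdered.

Section HahnSeries.
Variables (R : comNzRingType) (G : oagType).

(* R[[t^G]] *)
Record hahn := Hahn {
  hcoef :> G -> R;
  hahn_wo : well_ordered [set x | hcoef x != 0] }.

HB.instance Definition _ := gen_eqMixin hahn.
HB.instance Definition _ := gen_choiceMixin hahn.

Implicit Types (f g h : hahn) (x y : G) (r : seq G).

Definition hsupp f : set G := [set x | f x != 0].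

Lemma hsuppP f : well_ordered (hsupp f). Proof. exact: hahn_wo. Qed.
Arguments hsuppP f : clear implicits.

Lemma hahnP f g : f =1 g -> f = g.
Proof.
case: f g => f fP [g gP] /= /funext fg; case: _ / fg in gP *.
by congr Hahn; exact: Prop_irrelevance.
Qed.

Definition hmono_fun (c : R) x : G -> R := fun y => if y == x then c else 0.

Lemma hmono_wo c x : well_ordered [set y | hmono_fun c x y != 0].
Proof.
apply: well_ordered_sub (well_ordered_set1 (x := x)) => y /=.
by rewrite /hmono_fun; have [->|_] := eqVneq y x; rewrite ?eqxx.
Qed.

(* c t^x *)
Definition hmono c x : hahn := Hahn (@hmono_wo c x).

Lemma hadd_wo f g : well_ordered [set x | f x + g x != 0].
Proof.
apply: (well_ordered_sub _ (well_orderedU (hsuppP f) (hsuppP g))) => x /=.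
have [f0|] := eqVneq (f x) 0; last by left.
by rewrite f0 add0r; right.
Qed.

Lemma hopp_wo f : well_ordered [set x | - f x != 0].
Proof. by apply: (well_ordered_sub _ (hsuppP f)) => x /=; rewrite oppr_eq0. Qed.

Lemma hscale_wo (c : R) f : well_ordered [set x | c * f x != 0].
Proof.
apply: (well_ordered_sub _ (hsuppP f)) => x /=.
by apply: contra_neq => ->; rewrite mulr0.
Qed.

(* The sum is over a finite set, by [finite_convolution]. *)
Definition hmul_fun f g : G -> R :=
  fun x => \sum_(a \in [set: G]) f a * g (x - a).

Lemma hmul_wo f g : well_ordered [set x | hmul_fun f g x != 0].
Proof.
apply: (well_ordered_sub _ (well_ordered_sumset (hsuppP f) (hsuppP g))) => x /=.
apply: contra_neqP => nx; apply: fsbig1 => a _.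
have [->|fa] := eqVneq (f a) 0; first by rewrite mul0r.
have [->|ga] := eqVneq (g (x - a)) 0; first by rewrite mulr0.
by case: nx; exists a, (x - a); split=> //; rewrite addrC subrK.
Qed.

Definition hzero : hahn := hmono 0 0.
Definition hone : hahn := hmono 1 0.
Definition hadd f g : hahn := Hahn (@hadd_wo f g).
Definition hopp f : hahn := Hahn (@hopp_wo f).
Definition hscale c f : hahn := Hahn (@hscale_wo c f).
Definition hmul f g : hahn := Hahn (@hmul_wo f g).

Let hzeroE x : hzero x = 0.
Proof. by rewrite /= /hmono_fun; case: eqP. Qed.

Let haddA : associative hadd.
Proof. by move=> f g h; apply: hahnP => x /=; rewrite addrA. Qed.
Let haddC : commutative hadd.
Proof. by move=> f g; apply: hahnP => x /=; rewrite addrC. Qed.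
Let hadd0 : left_id hzero hadd.
Proof. by move=> f; apply: hahnP => x; rewrite -[RHS]add0r -(hzeroE x). Qed.
Let haddN : left_inverse hzero hopp hadd.
Proof. by move=> f; apply: hahnP => x; rewrite hzeroE /= addNr. Qed.

HB.instance Definition _ :=
  GRing.isZmodule.Build hahn haddA haddC hadd0 haddN.

Lemma finite_seq (S : set G) : finite_set S ->
  exists r, uniq r /\ forall a, a \in r <-> S a.
Proof.
move=> /finite_seqP[r ->]; exists (undup r); split; first exact: undup_uniq.
by move=> a; rewrite mem_undup.
Qed.

Lemma hmul_funE f g x r : uniq r ->
    (forall a, f a != 0 -> g (x - a) != 0 -> a \in r) ->
  hmul_fun f g x = \sum_(a <- r) f a * g (x - a).
Proof.
move=> ur rP; rewrite /hmul_fun (fsbigE r) //.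
  by apply: eq_bigl => a; rewrite in_setT.
move=> a _ ar.
have [->|fa] := eqVneq (f a) 0; first by rewrite mul0r.
have [->|ga] := eqVneq (g (x - a)) 0; first by rewrite mulr0.
by rewrite rP in ar.
Qed.

Let hmulC : commutative hmul.
Proof.
move=> f g; apply: hahnP => x /=.
have [r [ur rP]] :=
  finite_seq (finite_convolution x (hsuppP f) (hsuppP g)).
rewrite (hmul_funE ur); last by move=> a fa ga; apply/rP.
rewrite (@hmul_funE _ _ _ [seq x - a | a <- r]).
- by rewrite big_map; apply: eq_bigr => a _; rewrite subKr mulrC.
- by rewrite map_inj_uniq // => a b /addrI/oppr_inj.
- move=> a ga fa; apply/mapP; exists (x - a); last by rewrite subKr.
  by apply/rP; rewrite /hsupp /= subKr.
Qed.

Let hmulDl : left_distributive hmul hadd.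
Proof.
move=> f g h; apply: hahnP => x /=.
have [r [ur rP]] := finite_seq (finite_convolution x
  (well_orderedU (hsuppP f) (hsuppP g)) (hsuppP h)).
rewrite !(@hmul_funE _ _ _ r) //.
- by rewrite -big_split; apply: eq_bigr => a _; rewrite mulrDl.
- by move=> a ga ha; apply/rP; split=> //; right.
- by move=> a fa ha; apply/rP; split=> //; left.
- move=> a /= fga ha; apply/rP; split=> //=.
  have [f0|] := eqVneq (f a) 0; last by left.
  by right; move: fga; rewrite f0 add0r.
Qed.

Let hmul1 : left_id hone hmul.
Proof.
move=> f; apply: hahnP => x /=; rewrite (@hmul_funE _ _ _ [:: 0]) //.
  by rewrite big_seq1 /= /hmono_fun eqxx mul1r subr0.
by move=> a; rewrite /= /hmono_fun inE; have [|_] := eqVneq a 0; rewrite ?eqxx.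
Qed.

Let hmulA : associative hmul.
Proof.
move=> f g h; apply: hahnP => x.
have [r [ur rP]] := finite_seq (finite_convolution x (hsuppP f)
  (well_ordered_sumset (hsuppP g) (hsuppP h))).
have [s [us sP]] := finite_seq (finite_convolution x
  (well_ordered_sumset (hsuppP f) (hsuppP g)) (hsuppP h)).
transitivity (\sum_(a <- r) \sum_(c <- s) f a * g (c - a) * h (x - c)).
  rewrite [LHS](@hmul_funE _ _ _ r) //; last first.
    move=> a fa gha; apply/rP; split=> //; apply: contrapT => nsum.
    move/eqP: gha; apply; apply: fsbig1 => b _.
    have [->|gb] := eqVneq (g b) 0; first by rewrite mul0r.
    have [->|hb] := eqVneq (h (x - a - b)) 0; first by rewrite mulr0.
    by case: nsum; exists b, (x - a - b); split=> //; rewrite addrCA subrr addr0.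
  apply: eq_big_seq => a /rP[fa _].
  rewrite [X in _ * X = _](@hmul_funE _ _ _ [seq c - a | c <- s]).
  - rewrite big_map mulr_sumr; apply: eq_bigr => c _.
    by rewrite mulrA opprB addrA subrK.
  - by rewrite map_inj_uniq // => b c /addIr.
  - move=> b gb hb; apply/mapP; exists (a + b); last by rewrite addrC addKr.
    by apply/sP; split; [exists a, b|rewrite /hsupp /= opprD addrA].
rewrite [RHS](@hmul_funE _ _ _ s) //; last first.
  move=> c fgc hc; apply/sP; split=> //; apply: contrapT => nsum.
  move/eqP: fgc; apply; apply: fsbig1 => a _.
  have [->|fa] := eqVneq (f a) 0; first by rewrite mul0r.
  have [->|ga] := eqVneq (g (c - a)) 0; first by rewrite mulr0.
  by case: nsum; exists a, (c - a); split=> //; rewrite addrC subrK.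
rewrite exchange_big; apply: eq_big_seq => c /sP[_ hc].
rewrite [X in _ = X * _](@hmul_funE _ _ _ r) ?mulr_suml //.
move=> a fa ga; apply/rP; split=> //; exists (c - a), (x - c); split=> //.
by rewrite [RHS]addrC addrA subrK.
Qed.

Let hone_neq0 : hone != 0.
Proof.
apply/eqP => /(congr1 (fun f : hahn => f 0)) /eqP.
by rewrite hzeroE /= /hmono_fun eqxx oner_eq0.
Qed.

HB.instance Definition _ := GRing.Zmodule_isComNzRing.Build hahn
  hmulA hmulC hmul1 hmulDl hone_neq0.

Let hscaleA c d f : hscale c (hscale d f) = hscale (c * d) f.
Proof. by apply: hahnP => x /=; rewrite mulrA. Qed.
Let hscale1 : left_id 1 hscale.
Proof. by move=> f; apply: hahnP => x /=; rewrite mul1r. Qed.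
Let hscaleDr : right_distributive hscale +%R.
Proof. by move=> c f g; apply: hahnP => x /=; rewrite mulrDr. Qed.
Let hscaleDl f : {morph hscale^~ f : c d / c + d}.
Proof. by move=> c d; apply: hahnP => x /=; rewrite mulrDl. Qed.

HB.instance Definition _ := GRing.Zmodule_isLmodule.Build R hahn
  hscaleA hscale1 hscaleDr hscaleDl.

Let hscaleAl (c : R) f g : c *: (f * g) = (c *: f) * g.
Proof.
apply: hahnP => x.
have [r [ur rP]] :=
  finite_seq (finite_convolution x (hsuppP f) (hsuppP g)).
rewrite [LHS]/= [RHS](@hmul_funE _ _ _ r) //; last first.
  move=> a cfa ga; apply/rP; split=> //=.
  by apply: contra_neq cfa => /= ->; rewrite mulr0.
rewrite (@hmul_funE _ _ _ r) //; last by move=> a fa ga; apply/rP.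
by rewrite mulr_sumr; apply: eq_bigr => a _; rewrite mulrA.
Qed.

HB.instance Definition _ := GRing.Lmodule_isLalgebra.Build R hahn hscaleAl.

(* v(f), for f != 0 *)
Definition hval f : G := xget 0 [set x | f x != 0 /\ forall y, f y != 0 -> x <= y].

Lemma hvalP f : f != 0 ->
  f (hval f) != 0 /\ forall y, f y != 0 -> hval f <= y.
Proof.
move=> f0; rewrite /hval.
have [|m fm mP] := @hahn_wo f _ (@subset_refl _ _).
  apply: contrapT => nx; move/eqP: f0; apply; apply: hahnP => x.
  rewrite hzeroE; apply: contrapT => /eqP fx; apply: nx.
  by exists x.
by case: xgetP => [y -> //|/(_ m)[]].
Qed.

End HahnSeries.

Section HahnOrder.
Variables (R : realDomainType) (G : oagType).

(* gamma |-> sgn(t^gamma) *)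
Definition sign_choice (s : G -> int) : Prop :=
  (forall x, s x = 1 \/ s x = -1) /\ {morph s : x y / x + y >-> x * y}.

(* This is 0 for f = 0. *)
Definition hsgn (s : G -> int) (f : hahn R G) : int :=
  sgz (f (hval f)) * s (hval f).

Definition hle (s : G -> int) (f g : hahn R G) : bool := 0 <= hsgn s (g - f).

Definition semi_curvette_point (A : comAlgType R) (s : G -> int)
    (phi : {lrmorphism A -> hahn R G}) (alpha : sper A) : Prop :=
  (forall f, (f \in sper_supp alpha) = (phi f == 0)) /\
  (forall f g, (sper_ev alpha f <= sper_ev alpha g) = hle s (phi f) (phi g)).

End HahnOrder.

(** * Monomial points *)

(* An ordered group is torsion-free, so clearing denominators turns
   Q-linear independence in G (x) Q into this condition. *)
Definition Q_independent (G : zmodType) (n : nat) (a : 'I_n -> G) : Prop :=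
  forall m : 'I_n -> int, \sum_(j < n) a j *~ m j = 0 -> forall j, m j = 0.

Definition monomial_point (R : rcfType) (n : nat)
    (alpha : sper {mpoly R[n]}) : Prop :=
  let Gamma := value_group (residue alpha) in
  exists (s : Gamma -> int) (phi : {lrmorphism {mpoly R[n]} -> hahn R Gamma})
         (c : 'I_n -> R) (a : 'I_n -> Gamma),
    [/\ sign_choice s,
        forall j, 0 < a j,
        Q_independent a,
        forall j, phi 'X_j = hmono (c j) (a j) &
        semi_curvette_point s phi alpha].

(** * Piecewise polynomial functions *)

Section PiecewisePolynomial.
Variables (R : rcfType) (n : nat).
Local Notation A := {mpoly R[n]}.

Inductive sign_condition : Type :=
| SGt0 of A
| SEq0 of A
| SNot of sign_condition
| SAnd of sign_condition & sign_condition
| SOr of sign_condition & sign_condition.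

Fixpoint sc_set (P : sign_condition) : set 'rV[R]_n :=
  match P with
  | SGt0 g => [set x | 0 < g.@[x 0]]
  | SEq0 g => [set x | g.@[x 0] = 0]
  | SNot P => ~` sc_set P
  | SAnd P Q => sc_set P `&` sc_set Q
  | SOr P Q => sc_set P `|` sc_set Q
  end.

(* The constructible set with the same sign conditions; by the Tarski transfer
   principle it depends on [sc_set P] only. *)
Fixpoint sc_sper (P : sign_condition) : set (sper A) :=
  match P with
  | SGt0 g => [set alpha | 0 < sper_ev alpha g]
  | SEq0 g => [set alpha | sper_ev alpha g = 0]
  | SNot P => ~` sc_sper P
  | SAnd P Q => sc_sper P `&` sc_sper Q
  | SOr P Q => sc_sper P `|` sc_sper Q
  end.

Definition pw_presentation (f : 'rV[R]_n -> R) (k : nat)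
    (P : 'I_k -> sign_condition) (p : 'I_k -> A) : Prop :=
  [/\ forall i, closed (sc_set (P i)),
      \bigcup_i sc_set (P i) = [set: 'rV[R]_n] &
      forall i x, sc_set (P i) x -> f x = (p i).@[x 0]].

Definition piecewise_polynomial (f : 'rV[R]_n -> R) : Prop :=
  exists (k : nat) (P : 'I_k -> sign_condition) (p : 'I_k -> A),
    pw_presentation f P p.

(* Representatives at two points may come from two presentations of f: the
   union of two presentations is again one. *)
Definition local_representative (f : 'rV[R]_n -> R) (alpha : sper A)
    (q : A) : Prop :=
  exists (k : nat) (P : 'I_k -> sign_condition) (p : 'I_k -> A),
    pw_presentation f P p /\ exists i, sc_sper (P i) alpha /\ q = p i.

End PiecewisePolynomial.

(* Main.v *)
(* Put every g outside <alpha, beta> in normal form at the monomial point alpha: by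
   Q-independence one monomial m0 of g dominates all the others at alpha. As
   <alpha, beta> is a valuation ideal, these finitely many dominations also hold at
   beta, and the set C of the points where they hold (and where the variables with
   the same strict sign at alpha and beta keep this sign) avoids {g = 0}. The values
   of the monomials at alpha satisfy finitely many strict linear inequalities in an
   ordered group, hence there are integer weights w that satisfy them too. The flow
   x_j |-> l^(w_j) x_j, l -> 0, preserves the R-points of C, and every segment
   between two of them is carried into C by the flow for l small. So any two
   R-points of C are joined by polynomial paths in C. Along such a path sign
   conditions are finite unions of points and intervals, so no closed splitting by
   sign conditions exists.

   This passes from R^n to Sper A by the compactness of C and the Artin-Lang theorem:
   sign conditions satisfied at a point of Sper A are satisfied at a point of R^n.
   For the latter, the ordered field A(beta) embeds into a real closed field, and the
   quantifier elimination of the library commutes with the embedding of R in it. *)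

From HB Require Import structures.
Require Import Defs.
From mathcomp Require Import all_boot all_order all_algebra generic_quotient.
From mathcomp Require Import ring_quotient fraction.
From mathcomp Require Import mpoly lra zify.
From mathcomp Require Import polyrcf qe_rcf_th qe_rcf.
From mathcomp Require Import boolp classical_sets topology normedtype.

Set Implicit Arguments.
Unset Strict Implicit.
Unset Printing Implicit Defensive.

Import Order.TTheory GRing.Theory Num.Theory.
Import numFieldNormedType.Exports.

Local Open Scope classical_set_scope.
Local Open Scope ring_scope.

(** * Prime cones and points of the real spectrum *)

(** In its order topology a real closed field is connected only if it is the field of real numbers,
    and its closed intervals are compact only then. Hence connectedness in R^n is phrased with
    polynomial paths and sign conditions, for which the intermediate value property of polynomials
    suffices, and the parameter l of the flow comes from explicit bounds instead of a compactness
    argument on the segment. Domination at a monomial point is insensitive to nonzero constants of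
    R, as they have value 0 there. The inequalities that define C can therefore carry the number N
    of terms of g: N |g_m x^m| < |g_m0 x^m0| for all other m leaves no room for cancellation. The
    same freedom yields a factor 2, which carries the inequalities over to beta. A variable with c_j
    = 0 lies in the support of alpha and has no value in the group; it counts as infinite when the
    weights are sought. A real closed extension is not built by transfinite adjunction: each finite
    system of root adjunctions is solved in its own ordered field, and an ultrafilter glues these
    fields. *)

Section PrimeCone.
Local Open Scope quotient_scope.
Variable B : comNzRingType.
Implicit Types (P : set B) (x y f : B).

Record prime_cone P : Prop := PrimeCone {
  coneD : forall x y, P x -> P y -> P (x + y);
  coneM : forall x y, P x -> P y -> P (x * y);
  cone_total : forall x, P x \/ P (- x);
  coneN1 : ~ P (- 1);
  cone_prime : forall x y, P (x * y) -> P (- (x * y)) ->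
    (P x /\ P (- x)) \/ (P y /\ P (- y)) }.

Section ConePoint.
Variables (P : set B) (hP : prime_cone P).

Let supp : {pred B} := fun x => `[< P x /\ P (- x) >].
Let suppP x : reflect (P x /\ P (- x)) (x \in supp).
Proof. exact: asboolP. Qed.

Let P0 : P 0.
Proof. by have [//|] := cone_total hP 0; rewrite oppr0. Qed.
Let supp_ideal : idealr_closed supp.
Proof.
split; first by apply/suppP; rewrite oppr0.
  by apply/suppP => -[_ /(coneN1 hP)].
move=> a u v /suppP[u0 u1] /suppP[v0 v1]; apply/suppP.
have [aP|aP] := cone_total hP a.
  by split; rewrite ?opprD -?mulrN; apply: (coneD hP) => //; exact: (coneM hP).
split; rewrite ?opprD; apply: (coneD hP) => //.
  by rewrite -mulrNN; exact: (coneM hP).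
by rewrite -mulNr; exact: (coneM hP).
Qed.

Let supp_prime : prime_idealr_closed supp.
Proof.
by move=> u v /suppP[uv uvN]; have [h|h] := cone_prime hP uv uvN; apply/orP;
  [left|right]; apply/suppP.
Qed.

HB.instance Definition _ := isIdealr.Build B supp supp_ideal.
HB.instance Definition _ := isPrimeIdealrClosed.Build B supp supp_prime.

Let I : prime_idealr B := supp.
Local Notation Q := {ideal_quot I}.
Let qle (x y : Q) : bool := `[< P (repr y - repr x) >].

Let qleE x y : qle (\pi_Q x) (\pi_Q y) = `[< P (y - x) >].
Proof.
have e z : P (repr (\pi_Q z) - z) /\ P (z - repr (\pi_Q z)).
  have : (repr (\pi_Q z) == z %[mod Q])%qT by rewrite reprK.
  by rewrite -Quotient.idealrBE => /suppP; rewrite opprB.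
have [x1 x2] := e x; have [y1 y2] := e y.
apply: asbool_equiv_eq; split=> h.
  have := coneD hP (coneD hP h x1) y2.
  by rewrite subrKA addrC subrKA.
have := coneD hP (coneD hP h x2) y1.
by rewrite subrKA addrC subrKA.
Qed.

(** The support is the intersection of [P] and [- P], and x <= y means that y - x lies in [P].
    Representatives do not matter because adding an element of the support does not leave [P]. *)
Lemma prime_cone_sper : exists alpha : sper B,
  forall f, (0 <= sper_ev alpha f) = `[< P f >].
Proof.
have ord : ring_total_order qle.
  split.
  - elim/quotW=> x; elim/quotW=> y; rewrite !qleE.
    by have [h|h] := cone_total hP (y - x); apply/orP; [left|right];
      apply/asboolP; rewrite ?opprB // in h *.
  - elim/quotW=> x; elim/quotW=> y; rewrite !qleE => /andP[/asboolP h /asboolP h'].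
    apply/eqP; rewrite -Quotient.idealrBE; apply/suppP.
    by rewrite opprB.
  - elim/quotW=> y; elim/quotW=> x; elim/quotW=> z; rewrite !qleE.
    move=> /asboolP h /asboolP h'; apply/asboolP.
    by have := coneD hP h' h; rewrite subrKA.
  - elim/quotW=> z; elim/quotW=> x; elim/quotW=> y; rewrite -!rmorphD !qleE.
    by rewrite opprD addrACA subrr addr0.
  - elim/quotW=> x; elim/quotW=> y.
    rewrite -rmorphM -(rmorph0 \pi_Q) !qleE !subr0 => /asboolP h /asboolP h'.
    by apply/asboolP; exact: (coneM hP).
exists (Sper ord) => f; rewrite residue_leE /sper_ev /=.
by have := qleE 0 f; rewrite subr0 rmorph0 => <-.
Qed.
End ConePoint.
End PrimeCone.

Section SperEv.
Local Open Scope quotient_scope.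
Variables (A : comNzRingType) (alpha : sper A).

Lemma sper_ev_zmod_morphism : zmod_morphism (@sper_ev A alpha).
Proof. exact: (raddfB \pi_{ideal_quot (sper_supp alpha)}). Qed.

Lemma sper_ev_monoid_morphism : monoid_morphism (@sper_ev A alpha).
Proof.
split; first exact: (rmorph1 \pi_{ideal_quot (sper_supp alpha)}).
exact: (rmorphM \pi_{ideal_quot (sper_supp alpha)}).
Qed.

HB.instance Definition _ := GRing.isZmodMorphism.Build A (residue alpha)
  (@sper_ev A alpha) sper_ev_zmod_morphism.
HB.instance Definition _ := GRing.isMonoidMorphism.Build A (residue alpha)
  (@sper_ev A alpha) sper_ev_monoid_morphism.

Lemma sper_ev_surj (x : residue alpha) : exists f, x = sper_ev alpha f.
Proof. by elim/quotW: x => f; exists f. Qed.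

Lemma sper_field : exists (F : realFieldType) (pi : {rmorphism A -> F}),
  (forall f, (0 <= pi f) = (0 <= sper_ev alpha f)) /\
  forall x : F, exists a b, pi b != 0 /\ x = pi a / pi b.
Proof.
exists {fraction (residue alpha)}.
exists (@FracField.tofrac (residue alpha) \o sper_ev alpha).
split=> [f|x].
  by rewrite /= -(rmorph0 (@FracField.tofrac (residue alpha))) tofrac_le.
have [a [b [b0 ->]]] := fracP x.
have [f fE] := sper_ev_surj a; have [g gE] := sper_ev_surj b.
by exists f, g; rewrite /= -fE -gE tofrac_eq0.
Qed.

End SperEv.

Lemma prime_cone_field (B : comNzRingType) (P : set B) : prime_cone P ->
  exists (F : realFieldType) (pi : {rmorphism B -> F}),
  (forall f, (0 <= pi f) = `[< P f >]) /\
  forall x : F, exists a b, pi b != 0 /\ x = pi a / pi b.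
Proof.
move=> /prime_cone_sper[alpha aP]; have [F [pi [h1 h2]]] := sper_field alpha.
by exists F, pi; split=> // f; rewrite h1 aP.
Qed.

(** * Proper preorderings and their extension to prime cones *)

Section Preorder.
Variable B : comNzRingType.
Implicit Types (T : set B) (x y : B).

Record preorder_cone T : Prop := PreorderCone {
  preD : forall x y, T x -> T y -> T (x + y);
  preM : forall x y, T x -> T y -> T (x * y);
  preX2 : forall x, T (x ^+ 2);
  preN1 : ~ T (- 1) }.

Lemma pre0 T : preorder_cone T -> T 0.
Proof. by move=> hT; have := preX2 hT 0; rewrite expr0n. Qed.

Lemma pre1 T : preorder_cone T -> T 1.
Proof. by move=> hT; have := preX2 hT 1; rewrite expr1n. Qed.

(** Otherwise T + aT would be a proper preordering strictly larger than [T]. *)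
Lemma preorder_cone_max T a : preorder_cone T ->
  (forall S, T `<=` S -> preorder_cone S -> S `<=` T) ->
  ~ T a -> exists s t, [/\ T s, T t & - 1 = s + a * t].
Proof.
move=> hT maxT nTa; apply: contrapT => nst.
pose S := [set x | exists s t, [/\ T s, T t & x = s + a * t]].
have TS : T `<=` S.
  by move=> x Tx; exists x, 0; split=> //; [exact: pre0|rewrite mulr0 addr0].
apply: nTa; apply: (maxT S TS); last first.
  by exists 0, 1; split; [exact: pre0|exact: pre1|rewrite mulr1 add0r].
split=> //.
- move=> _ _ [s [t [Ts Tt ->]]] [s' [t' [Ts' Tt' ->]]].
  exists (s + s'), (t + t'); split; [exact: (preD hT)|exact: (preD hT)|].
  by rewrite mulrDr addrACA.
- move=> _ _ [s [t [Ts Tt ->]]] [s' [t' [Ts' Tt' ->]]].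
  exists (s * s' + a ^+ 2 * (t * t')), (s * t' + s' * t); split.
  + apply: (preD hT); first exact: (preM hT).
    by apply: (preM hT); [exact: (preX2 hT)|exact: (preM hT)].
  + by apply: (preD hT); exact: (preM hT).
  + rewrite mulrDl !mulrDr -!addrA; congr (_ + _); rewrite addrA addrC.
    rewrite mulrACA -expr2; congr (_ + _).
    by rewrite (mulrCA s) (mulrC _ s') (mulrCA s').
- by move=> x; apply: TS; exact: (preX2 hT).
Qed.

Let subN1 (s y : B) : - 1 = s + y -> y = - (1 + s).
Proof. by move=> e; rewrite opprD e addrAC subrr add0r. Qed.

Let expandN1 (s u w : B) : w = - ((1 + s) * (1 + u)) -> - 1 = s + (u + (s * u + w)).
Proof.
move=> ->; rewrite mulrDl mul1r mulrDr mulr1 -addrA.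
have -> : 1 + (u + (s + s * u)) = s + (u + s * u) + 1 by rewrite addrC (addrCA u).
by rewrite (addrA u) (addrA s) opprD addNKr.
Qed.

(** Both totality and primality come from multiplying two relations -1 = s + x t and -1 = u + y v.
    They give (x t)(y v) = (1 + s)(1 + u), so that -1 = s + u + s u - x y t v. This lies in [T] as
    soon as - x y t v does: for y = - x it is x^2 t v, and for x y in the support it is again in the
    support. *)
Lemma maximal_prime_cone T : preorder_cone T ->
  (forall S, T `<=` S -> preorder_cone S -> S `<=` T) -> prime_cone T.
Proof.
move=> hT maxT; have key := preorder_cone_max hT maxT.
have tot x : T x \/ T (- x).
  apply: contrapT => /not_orP[/key[s [t [Ts Tt e1]]] /key[u [v [Tu Tv e2]]]].
  apply: (preN1 hT).
  have -> : - 1 = s + (u + (s * u + x ^+ 2 * (t * v))).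
    apply: expandN1; have -> : x ^+ 2 * (t * v) = - ((x * t) * (- x * v)).
      by rewrite mulNr mulrN opprK expr2 mulrACA.
    by rewrite (subN1 e1) (subN1 e2) mulrNN.
  do ?apply: (preD hT) => //; apply: (preM hT) => //; first exact: (preX2 hT).
  exact: (preM hT).
have idl x y : T x -> T (- x) -> T (x * y) /\ T (- (x * y)).
  move=> Tx Tnx; have [Ty|Ty] := tot y.
    by split; rewrite -?mulNr; exact: (preM hT).
  by split; [rewrite -mulrNN|rewrite -mulrN]; exact: (preM hT).
split=> //; [exact: (preD hT)|exact: (preM hT)|exact: (preN1 hT)|].
move=> x y Txy Tnxy; apply: contrapT => /not_orP[nx ny].
have sgn z : ~ (T z /\ T (- z)) -> exists z', (z' = z \/ z' = - z) /\ ~ T z'.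
  move=> /not_andP[h|h]; [exists z|exists (- z)]; split=> //; by [left|right].
have [x' [ex /key[s [t [Ts Tt e1]]]]] := sgn _ nx.
have [y' [ey /key[u [v [Tu Tv e2]]]]] := sgn _ ny.
have [Txy' Tnxy'] : T (x' * y') /\ T (- (x' * y')).
  by case: ex => ->; case: ey => ->; rewrite ?mulrNN ?mulrN ?mulNr ?opprK.
have [h _] := idl _ (- (t * v)) Txy' Tnxy'.
apply: (preN1 hT).
have -> : - 1 = s + (u + (s * u + x' * y' * (- (t * v)))).
  apply: expandN1; have -> : x' * y' * (- (t * v)) = - ((x' * t) * (y' * v)).
    by rewrite mulrN mulrACA.
  by rewrite (subN1 e1) (subN1 e2) mulrNN.
do ?apply: (preD hT) => //; exact: (preM hT).
Qed.

Lemma preorder_cone_extend T : preorder_cone T ->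
  exists P, prime_cone P /\ T `<=` P.
Proof.
move=> hT.
have [F FP totF|M [hM maxM]] :=
    @Zorn_bigcup B [set S | preorder_cone S /\ T `<=` S \/ S = set0].
  have [[S0 [FS0 [x0 Sx0]]]|noS] := pselect (exists S, F S /\ S !=set0); last first.
    right; apply/seteqP; split=> // x [S FS Sx].
    by apply: noS; exists S; split=> //; exists x.
  have good S x : F S -> S x -> preorder_cone S /\ T `<=` S.
    by move=> /FP[//|->].
  have two x y : (\bigcup_(X in F) X) x -> (\bigcup_(X in F) X) y ->
      exists S, [/\ F S, S x & S y].
    move=> [S FS Sx] [S' FS' Sy].
    by have [h|h] := totF _ _ FS FS'; [exists S'|exists S]; split=> //; exact: h.
  have [hS0 TS0] := good _ _ FS0 Sx0.
  left; split; last by move=> x Tx; exists S0 => //; exact: TS0.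
  split.
  - move=> x y /two /[apply] -[S [FS Sx Sy]]; exists S => //.
    by apply: (preD (good _ _ FS Sx).1).
  - move=> x y /two /[apply] -[S [FS Sx Sy]]; exists S => //.
    by apply: (preM (good _ _ FS Sx).1).
  - by move=> x; exists S0 => //; exact: (preX2 hS0).
  - by move=> [S FS SN1]; exact: (preN1 (good _ _ FS SN1).1).
have M0 : M != set0.
  apply/eqP => M0; apply: (maxM T); last by left; split.
  rewrite M0; split; last by move=> /(_ 0 (pre0 hT)).
  exact: sub0set.
have {hM}[[hM TM]|/eqP] := hM; last by rewrite (negPf M0).
exists M; split=> //; apply: maximal_prime_cone => // S MS hS.
apply: contrapT => nSM; apply: (maxM S) => //; left; split=> //.
exact: subset_trans MS.
Qed.

End Preorder.

(** * Real closure of an ordered field *)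

Section OrderedExtension.

Definition order_morphism (K L : realFieldType) (i : K -> L) : Prop :=
  forall c, 0 <= c -> 0 <= i c.

Lemma order_morphism_gt0 (K L : realFieldType) (i : {rmorphism K -> L}) c :
  order_morphism i -> (0 < i c) = (0 < c).
Proof.
move=> hi; apply/idP/idP => [ic|c0]; last first.
  by rewrite lt_neqAle eq_sym fmorph_eq0 gt_eqF // hi // ltW.
rewrite ltNge; apply/negP => c0; have := hi (- c).
by rewrite rmorphN !oppr_ge0 => /(_ c0) /(lt_le_trans ic); rewrite ltxx.
Qed.

Lemma order_morphism_comp (K L M : realFieldType) (i : K -> L) (j : L -> M) :
  order_morphism i -> order_morphism j -> order_morphism (j \o i).
Proof. by move=> hi hj c c0; apply/hj/hi. Qed.

Section SumsOfSquares.
Variable K : realFieldType.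
Implicit Types f g s t : {poly K}.

(** The weights c >= 0 need not be squares in [K]. With them every nonnegative constant is a member,
    so an ordering in which these sums are nonnegative extends that of [K]. *)
Inductive sos : {poly K} -> Prop :=
| Sos0 : sos 0
| SosS c g s : 0 <= c -> sos s -> sos (c *: g ^+ 2 + s).

Lemma sosD s t : sos s -> sos t -> sos (s + t).
Proof.
move=> hs ht; elim: hs => [|c g {}s c0 _ IH]; first by rewrite add0r.
by rewrite -addrA; exact: SosS.
Qed.

Lemma sosM s t : sos s -> sos t -> sos (s * t).
Proof.
move=> hs ht; elim: hs => [|c g {}s c0 _ IH]; first by rewrite mul0r; exact: Sos0.
rewrite mulrDl; apply: sosD IH.
elim: ht => [|d h {}t d0 _ IH]; first by rewrite mulr0; exact: Sos0.
rewrite mulrDr -scalerAl -scalerAr scalerA -exprMn.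
by apply: SosS => //; exact: mulr_ge0.
Qed.

Lemma sosX2 g : sos (g ^+ 2).
Proof. by have := SosS g ler01 Sos0; rewrite scale1r addr0. Qed.

Lemma sosC c : 0 <= c -> sos c%:P.
Proof.
by move=> /(SosS 1) /(_ Sos0); rewrite expr1n addr0 alg_polyC.
Qed.

Lemma sos_horner (L : realFieldType) (i : {rmorphism K -> L}) s x :
  order_morphism i -> sos s -> 0 <= (map_poly i s).[x].
Proof.
move=> hi; elim=> [|c g {}s c0 _ IH]; first by rewrite rmorph0 horner0.
rewrite rmorphD /= hornerD addr_ge0 // map_polyZ hornerZ rmorphXn horner_exp.
by rewrite mulr_ge0 ?hi ?sqr_ge0.
Qed.

(** Each square g^2 is replaced by r^2 with r the remainder of g modulo f, since g^2 - r^2 = (g -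
    r)(g + r). The new sum has degree at most 2 deg f - 2. *)
Lemma sos_mod f s : (1 < size f)%N -> sos s -> exists t h,
  [/\ sos t, s = t + f * h & (size t <= (2 * (size f).-1).-1)%N].
Proof.
move=> f1; have f0 : f != 0 by rewrite -size_poly_gt0 ltnW.
elim=> [|c g {}s c0 _ [t [h [st -> szt]]]].
  by exists 0, 0; rewrite mulr0 addr0 size_poly0; split=> //; exact: Sos0.
pose r := g %% f; exists (c *: r ^+ 2 + t), (c *: ((g %/ f) * (g + r)) + h).
split; first exact: SosS.
  rewrite mulrDr [RHS]addrACA; congr (_ + _).
  rewrite -scalerAr -scalerDr; congr (_ *: _).
  rewrite mulrA (mulrC f) -[_ * f](addrK r) -divp_eq.
  by rewrite -subr_sqr addrC subrK.
apply: leq_trans (size_polyD _ _) _; rewrite geq_max szt andbT.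
apply: leq_trans (size_scale_leq _ _) _.
have szr : (size r < size f)%N by rewrite ltn_modp.
move: f1 szr (size_poly_exp_leq r 2).
by move: (size (r ^+ 2)) (size r) (size f) => u v w; lia.
Qed.

End SumsOfSquares.

(* If -1 = s + f h with s a sum of squares, reduced modulo f, then h has smaller
   degree than f, and it changes sign wherever f does. *)
Lemma adjoin_root n (K : realFieldType) (f : {poly K}) a b :
  (size f <= n)%N -> f.[a] * f.[b] < 0 ->
  exists (L : realFieldType) (i : {rmorphism K -> L}) (c : L),
    order_morphism i /\ root (map_poly i f) c.
Proof.
elim: n K f a b => [|n IHn] K f a b.
  by rewrite leqn0 size_poly_eq0 => /eqP ->; rewrite !horner0 mulr0 ltxx.
move=> szf fab.
have f0 : f != 0 by apply: contraTneq fab => ->; rewrite !horner0 mulr0 ltxx.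
have sz2 : (1 < size f)%N.
  rewrite ltnNge; apply/negP => /size1_polyC e; move: fab; rewrite e !hornerC.
  by rewrite -expr2 ltNge sqr_ge0.
pose T := [set g : {poly K} | exists s h, sos s /\ g = s + f * h].
have TN1 : ~ T (- 1).
  move=> [s [h [ss e]]]; have [t [q [st et szt]]] := sos_mod sz2 ss.
  have {et} e' : f * - (q + h) = 1 + t.
    have e2 : - 1 = t + (f * q + f * h) by rewrite e et addrA.
    have -> : 1 + t = - (f * q + f * h).
      by apply: oppr_inj; rewrite opprK opprD e2 addrAC subrr add0r.
    by rewrite mulrN mulrDr.
  pose h' := - (q + h); rewrite -/h' in e'.
  have pos (L : realFieldType) (i : {rmorphism K -> L}) x : order_morphism i ->
      0 < (map_poly i (f * h')).[x].
    move=> hi; rewrite e' rmorphD rmorph1 hornerD hornerC.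
    by rewrite ltr_wpDr // sos_horner.
  have posK x : 0 < f.[x] * h'.[x].
    by have := @pos K idfun x (fun c => id); rewrite map_poly_id // hornerM.
  have h'0 : h' != 0.
    by apply: contraTneq (posK a) => ->; rewrite horner0 mulr0 ltxx.
  have szh : (size h' <= n)%N.
    have := congr1 (fun p : {poly K} => size p) e'; rewrite size_mul //.
    have := size_polyD 1 t; rewrite size_poly1; move: szt szf sz2.
    have := h'0; rewrite -size_poly_gt0.
    by move: (size h') (size f) (size (1 + t)) (size t) => u v w z; lia.
  have hab : h'.[a] * h'.[b] < 0.
    have := mulr_gt0 (posK a) (posK b); rewrite mulrACA.
    by rewrite nmulr_rgt0.
  (* As f h' = 1 + t has degree at most 2 deg f - 2, induction applies to h'. At the root of h' that
     it provides in an ordered extension, the product f h' vanishes although 1 + t is positive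
     there. *)
  have [L [i [c [hi /rootP ci]]]] := IHn K h' a b szh hab.
  by have := pos L i c hi; rewrite rmorphM hornerM ci mulr0 ltxx.
have [|P [hP TP]] := @preorder_cone_extend _ T.
  split=> //.
  - move=> _ _ [s [h [ss ->]]] [s' [h' [ss' ->]]].
    exists (s + s'), (h + h'); split; first exact: sosD.
    by rewrite mulrDr addrACA.
  - move=> _ _ [s [h [ss ->]]] [s' [h' [ss' ->]]].
    exists (s * s'), (s * h' + h * (s' + f * h')); split; first exact: sosM.
    rewrite mulrDl (mulrDr s) (mulrDr f (s * h')) -addrA; congr (_ + (_ + _)).
      by rewrite mulrCA.
    by rewrite mulrA.
  - by move=> g; exists (g ^+ 2), 0; rewrite mulr0 addr0; split=> //; exact: sosX2.
have [L [pi [piP _]]] := prime_cone_field hP.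
pose i := pi \o polyC : {rmorphism K -> L}.
exists L, i, (pi 'X); split.
  move=> c c0; rewrite /i /= piP; apply/asboolP/TP.
  by exists c%:P, 0; rewrite mulr0 addr0; split=> //; exact: sosC.
have -> : map_poly i f = map_poly pi (map_poly polyC f) by rewrite -map_poly_comp.
apply/rootP; rewrite horner_map.
have -> : (map_poly polyC f).['X] = f by rewrite -[RHS]comp_polyXr.
(* Both f and -f lie in [T], hence in [P], so the class of 'X is a root of f. *)
apply/eqP; rewrite eq_le -oppr_ge0 -rmorphN !piP.
by apply/andP; split; apply/asboolP/TP; [exists 0, (-1)|exists 0, 1];
  rewrite ?mulrN mulr1 add0r; split=> //; exact: Sos0.
Qed.
End OrderedExtension.

Section ProductRing.
Variables (I : Type) (i0 : I) (F : I -> comNzRingType).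

(** The argument of type [I] carries an index into the type; at that index 1 and 0 differ. *)
Definition prodring of I := forall i, F i.
Local Notation D := (prodring i0).

HB.instance Definition _ := gen_eqMixin D.
HB.instance Definition _ := gen_choiceMixin D.

Let zero : D := fun=> 0.
Let one : D := fun=> 1.
Let opp (f : D) : D := fun i => - f i.
Let add (f g : D) : D := fun i => f i + g i.
Let mul (f g : D) : D := fun i => f i * g i.

Let addA : associative add.
Proof. by move=> f g h; apply: functional_extensionality_dep => i; exact: addrA. Qed.
Let addC : commutative add.
Proof. by move=> f g; apply: functional_extensionality_dep => i; exact: addrC. Qed.
Let add0 : left_id zero add.
Proof. by move=> f; apply: functional_extensionality_dep => i; exact: add0r. Qed.
Let addN : left_inverse zero opp add.
Proof. by move=> f; apply: functional_extensionality_dep => i; exact: addNr. Qed.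

HB.instance Definition _ := GRing.isZmodule.Build D addA addC add0 addN.

Let mulA : associative mul.
Proof. by move=> f g h; apply: functional_extensionality_dep => i; exact: mulrA. Qed.
Let mulC : commutative mul.
Proof. by move=> f g; apply: functional_extensionality_dep => i; exact: mulrC. Qed.
Let mul1 : left_id one mul.
Proof. by move=> f; apply: functional_extensionality_dep => i; exact: mul1r. Qed.
Let mulDl : left_distributive mul add.
Proof. by move=> f g h; apply: functional_extensionality_dep => i; exact: mulrDl. Qed.
Let one_neq0 : one != zero.
Proof. by apply/eqP => /(congr1 (fun f : D => f i0))/eqP; rewrite oner_eq0. Qed.

HB.instance Definition _ := GRing.Zmodule_isComNzRing.Build D
  mulA mulC mul1 mulDl one_neq0.

End ProductRing.

(** * Formal terms that name elements of a real closed extension *)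

Section Terms.
Variable K : Type.

(* [TRoot d c a b] names a root of the polynomial of coefficients c 0, .., c d.-1,
   provided that it changes sign between a and b. *)
Inductive rterm :=
| TConst of K
| TAdd of rterm & rterm
| TMul of rterm & rterm
| TOpp of rterm
| TInv of rterm
| TRoot (d : nat) (c : nat -> rterm) (a b : rterm).

HB.instance Definition _ := gen_eqMixin rterm.
HB.instance Definition _ := gen_choiceMixin rterm.

Fixpoint rterm_rank (t : rterm) : nat :=
  match t with
  | TConst _ => 0
  | TAdd u v | TMul u v => (rterm_rank u + rterm_rank v).+1
  | TOpp u | TInv u => (rterm_rank u).+1
  | TRoot d c a b =>
      (\max_(k < d) rterm_rank (c k) + rterm_rank a + rterm_rank b).+1
  end.

Definition rterm_ok (F : realFieldType) (i : K -> F) (r : rterm -> F) t : Prop :=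
  match t with
  | TConst c => r t = i c
  | TAdd u v => r t = r u + r v
  | TMul u v => r t = r u * r v
  | TOpp u => r t = - r u
  | TInv u => r t = (r u)^-1
  | TRoot d c a b =>
      let p := \poly_(k < d) r (c k) in p.[r a] * p.[r b] < 0 -> root p (r t)
  end.

(** The condition at t reads the valuation only at t and at its immediate subterms, all of smaller
    rank. *)
Lemma rterm_ok_eq (F : realFieldType) (i : K -> F) r r' t :
  r t = r' t -> (forall u, (rterm_rank u < rterm_rank t)%N -> r u = r' u) ->
  rterm_ok i r t -> rterm_ok i r' t.
Proof.
case: t => [c|u v|u v|u|u|d c a b] /= <- e //;
  rewrite -?[r' u]e -?[r' v]e ?ltnS ?leq_addr ?leq_addl //.
have ce : \poly_(k < d) r (c k) = \poly_(k < d) r' (c k).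
  apply/polyP => k; rewrite !coef_poly; case: ltnP => // kd.
  rewrite e // ltnS -addnA; apply: leq_trans (leq_addr _ _).
  exact: (leq_bigmax (Ordinal kd)).
by rewrite ce (e a) ?(e b) // ltnS ?leq_addl // -addnA (addnC (rterm_rank a)) addnA leq_addl.
Qed.

Lemma rterm_ok_map (F L : realFieldType) (i : K -> F) (r : rterm -> F)
    (j : {rmorphism F -> L}) t : order_morphism j ->
  rterm_ok i r t -> rterm_ok (j \o i) (j \o r) t.
Proof.
move=> hj; case: t => [c|u v|u v|u|u|d c a b] /= => [->|->|->|->|->|h] //.
- by rewrite rmorphD.
- by rewrite rmorphM.
- by rewrite rmorphN.
- by rewrite fmorphV.
have -> : \poly_(k < d) j (r (c k)) = map_poly j (\poly_(k < d) r (c k)).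
  apply/polyP => k; rewrite coef_map !coef_poly; case: ifP => _ //; by rewrite raddf0.
rewrite !horner_map -rmorphM -oppr_gt0 -rmorphN order_morphism_gt0 // oppr_gt0.
by move=> /h /rootP h'; apply/rootP; rewrite horner_map h' rmorph0.
Qed.

End Terms.

Lemma dependent_choice (I : Type) (T : I -> Type) (Q : forall i, T i -> Prop) :
  (forall i, exists x, Q i x) -> exists f : forall i, T i, forall i, Q i (f i).
Proof.
by move=> h; exists (fun i => sval (cid (h i))) => i; exact: (svalP (cid (h i))).
Qed.

(** The hypothesis does not locate the root. If it falls outside [a, b], its linear factor has
    constant sign on [a, b]; dividing by it preserves the sign change and lowers the degree. *)
Lemma sign_root_ivt (L : realFieldType) :
  (forall (p : {poly L}) a b, p.[a] * p.[b] < 0 -> exists x, root p x) ->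
  Num.real_closed_axiom L.
Proof.
move=> signroot p a b ab /andP[pa pb].
have : p.[a] * p.[b] <= 0 by rewrite mulr_le0_ge0.
elim: {p pa pb}(size p) {-2}p (leqnn (size p)) => [|n IH] p.
  rewrite leqn0 size_poly_eq0 => /eqP -> _.
  by exists a; rewrite ?lexx //; apply: root0.
move=> szp; have [pa|pa] := eqVneq p.[a] 0; first by exists a; rewrite ?lexx //; exact/rootP.
have [pb|pb] := eqVneq p.[b] 0; first by exists b; rewrite ?lexx ?andbT //; exact/rootP.
rewrite le_eqVlt mulf_eq0 (negPf pa) (negPf pb) /= => pab.
have [x px] := signroot p a b pab.
have [xab|xab] := boolP (a <= x <= b); first by exists x.
have /factor_theorem[q qE] := px.
have q0 : q != 0 by apply: contraNneq pa => q0; rewrite qE q0 mul0r horner0.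
have szq : (size q <= n)%N.
  by move: szp; rewrite qE size_Mmonic ?monicXsubC // size_XsubC addn2 ltnS.
have qab : q.[a] * q.[b] <= 0.
  have : 0 < (a - x) * (b - x).
    move: xab; rewrite negb_and -!ltNge => /orP[h|h].
      by apply: mulr_gt0; rewrite subr_gt0 // (lt_le_trans h).
    by rewrite nmulr_rgt0 subr_lt0 // (le_lt_trans ab).
  move=> h; move: pab; rewrite qE !hornerM !hornerXsubC mulrACA => /ltW.
  by rewrite pmulr_lle0.
have [y yab qy] := IH q szq qab.
by exists y => //; rewrite qE rootM qy.
Qed.

Lemma seq_argmax (T : eqType) (f : T -> nat) x (s : seq T) :
  exists2 t, t \in x :: s & forall u, u \in x :: s -> (f u <= f t)%N.
Proof.
elim: s x => [x|y s IHs x].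
  by exists x => [|u]; rewrite mem_seq1 // => /eqP ->.
have [t ts tP] := IHs y.
have [h|h] := leqP (f x) (f t).
  by exists t => [|u]; rewrite in_cons ?ts ?orbT // => /predU1P[->|/tP].
exists x; first exact: mem_head.
by move=> u /predU1P[->//|/tP /leq_trans]; apply; exact: ltnW.
Qed.

Section RealClosure.
Variable K : realFieldType.
Local Notation Tm := (rterm K).

(** A term t of greatest rank in the list is treated last: none of the others has t as a subterm, so
    their conditions survive when t receives its value, possibly in a larger field. Subterms absent
    from the list may have any value. *)
Lemma rterm_eval (s : seq Tm) :
  exists (F : realFieldType) (i : {rmorphism K -> F}) (r : Tm -> F),
    order_morphism i /\ forall t, t \in s -> rterm_ok i r t.
Proof.
elim: {s}(size s) {-2}s (leqnn (size s)) => [|n IH] s.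
  by rewrite leqn0 size_eq0 => /eqP ->; exists K, idfun, (fun=> 0); split.
case: s => [_|t0 s0]; first by exists K, idfun, (fun=> 0); split.
set s := t0 :: s0 => szs.
have [t ts tmax] : exists2 t, t \in s & forall u, u \in s ->
    (rterm_rank u <= rterm_rank t)%N.
  exact: seq_argmax.
have szf : (size [seq u <- s | u != t] <= n)%N.
  rewrite size_filter (_ : count _ s = count (predC (pred1 t)) s) //.
  have := count_predC (pred1 t) s.
  have : (0 < count (pred1 t) s)%N by rewrite -has_count; apply/hasP; exists t => /=.
  move: szs; move: (count (pred1 t) s) (count (predC _) s) (size s) => u v w.
  by lia.
have [F [i [r [hi okr]]]] := IH _ szf.
pose upd (L : realFieldType) (j : F -> L) v u := if u == t then v else j (r u).
suff [L [j [v [hj okt]]]] : exists (L : realFieldType) (j : {rmorphism F -> L}) v,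
    order_morphism j /\ rterm_ok (j \o i) (upd L j v) t.
  exists L, (j \o i), (upd L j v); split; first exact: order_morphism_comp.
  move=> u us; have [->//|ut] := eqVneq u t.
  have : rterm_ok (j \o i) (j \o r) u.
    by apply: rterm_ok_map => //; apply: okr; rewrite mem_filter /= ut.
  apply: rterm_ok_eq => [|w wu]; rewrite /upd /= ?(negPf ut) //.
  case: eqP => // wt; move: wu; rewrite wt ltnNge; case/negP.
  exact: tmax.
have low u : (rterm_rank u < rterm_rank t)%N ->
    forall (L : realFieldType) (j : F -> L) v, upd L j v u = j (r u).
  by move=> ut L j v; rewrite /upd; case: eqP => // e; rewrite e ltnn in ut.
have here (L : realFieldType) (j : F -> L) v : upd L j v t = v by rewrite /upd eqxx.
case: t {ts tmax szf okr} @upd low here => [c|u v|u v|u|u|d c a b] upd low here.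
- by exists F, idfun, (i c); split=> //=; rewrite here.
- by exists F, idfun, (r u + r v); split=> //=; rewrite here !low //= ltnS ?leq_addl ?leq_addr.
- by exists F, idfun, (r u * r v); split=> //=; rewrite here !low //= ltnS ?leq_addl ?leq_addr.
- by exists F, idfun, (- r u); split=> //=; rewrite here !low.
- by exists F, idfun, (r u)^-1; split=> //=; rewrite here !low.
have lowp (L : realFieldType) (j : {rmorphism F -> L}) v :
    \poly_(k < d) upd L j v (c k) = map_poly j (\poly_(k < d) r (c k)).
  apply/polyP => k; rewrite coef_map !coef_poly.
  case: ltnP => [kd|_]; last by rewrite raddf0.
  rewrite low //= ltnS -addnA; apply: leq_trans (leq_addr _ _).
  exact: (leq_bigmax (Ordinal kd)).
have lowa : (rterm_rank a < rterm_rank (TRoot d c a b))%N.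
  by rewrite /= ltnS -addnA addnCA leq_addr.
have lowb : (rterm_rank b < rterm_rank (TRoot d c a b))%N.
  by rewrite /= ltnS leq_addl.
set p := \poly_(k < d) r (c k) in lowp.
have [pab|pab] := boolP (p.[r a] * p.[r b] < 0).
  have [L [j [v [hj jp]]]] := adjoin_root (leqnn _) pab.
  by exists L, j, v; split=> //; rewrite /rterm_ok here lowp.
(* Without a sign change the condition on the root is vacuous, and 0 is a default value. *)
exists F, idfun, 0; split=> //; rewrite /rterm_ok here lowp !low //=.
by rewrite map_poly_id // (negPf pab).
Qed.


(** The sets of all lists that include a given finite list are nonempty and stable under finite
    intersection up to refinement, so some ultrafilter contains them all. For it, each single term
    is evaluated correctly at almost every list. *)
Lemma large_filter : exists U : set_system (seq Tm), UltraFilter U /\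
  forall t, U [set s | t \in s].
Proof.
pose F : set_system (seq Tm) :=
  [set A | exists l : seq Tm, forall s : seq Tm, {subset l <= s} -> A s].
have FF : ProperFilter F.
  apply: Build_ProperFilter_ex.
    by move=> A [l lA]; exists l; exact: lA.
  split; first by exists [::].
    move=> A B [l lA] [m mB]; exists (l ++ m) => s lms.
    by split; [apply: lA|apply: mB] => t tl; apply: lms; rewrite mem_cat tl ?orbT.
  by move=> A B AB [l lA]; exists l => s /lA /AB.
have [U [UU FU]] := ultraFilterLemma FF.
exists U; split=> // t; apply: FU; exists [:: t] => s; apply; exact: mem_head.
Qed.

(* The real closed field is made of the values of the terms in the fields F s,
   modulo U: a [TRoot] term has the required value for almost all s. *)
Section TermField.
Variables (U : set_system (seq Tm)) (UU : UltraFilter U).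
Hypothesis U_mem : forall t, U [set s | t \in s].
Variables (F : seq Tm -> realFieldType) (i : forall s, {rmorphism K -> F s}).
Variable r : forall s, Tm -> F s.
Hypothesis hi : forall s, order_morphism (i s).
Hypothesis r_ok : forall s t, t \in s -> rterm_ok (i s) (r s) t.

Let U_ok t : U [set s | rterm_ok (i s) (r s) t].
Proof. by apply: filterS (U_mem t) => s; exact: r_ok. Qed.

Local Notation D := (@prodring (seq Tm) (fun s => F s) [::]).

(** Restricting the product to families that agree almost everywhere with a term makes every element
    of the final field the value of a term. *)
Let term_like : {pred D} := fun f => `[< exists t, U [set s | f s = r s t] >].

Let term_likeP (f : D) : reflect (exists t, U [set s | f s = r s t]) (f \in term_like).
Proof. exact: asboolP. Qed.

Let term_like_subring : subring_closed term_like.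
Proof.
split.
- apply/term_likeP; exists (TConst 1); apply: filterS (U_ok (TConst 1)) => s /= ->.
  by rewrite rmorph1.
- move=> f g /term_likeP[t tP] /term_likeP[u uP]; apply/term_likeP.
  exists (TAdd t (TOpp u)).
  apply: filterS2 _ (filterI tP uP)
    (filterI (U_ok (TAdd t (TOpp u))) (U_ok (TOpp u))).
  by move=> s [/= ft gu] [-> ->]; rewrite -ft -gu.
- move=> f g /term_likeP[t tP] /term_likeP[u uP]; apply/term_likeP.
  exists (TMul t u); apply: filterS2 _ (filterI tP uP) (U_ok (TMul t u)).
  by move=> s [/= ft gu] ->; rewrite -ft -gu.
Qed.

HB.instance Definition _ := GRing.isSubringClosed.Build D term_like term_like_subring.

Let B : Type := {f : D | f \in term_like}.
HB.instance Definition _ := SubChoice.on B.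
HB.instance Definition _ := [SubChoice_isSubComNzRing of B by <:].


Let ev s : B -> F s := fun f => val f s.

Let ev_zmod s : zmod_morphism (@ev s).
Proof. by []. Qed.
Let ev_monoid s : monoid_morphism (@ev s).
Proof. by []. Qed.
HB.instance Definition _ s := GRing.isZmodMorphism.Build B (F s) (@ev s) (@ev_zmod s).
HB.instance Definition _ s := GRing.isMonoidMorphism.Build B (F s) (@ev s) (@ev_monoid s).

Let P : set B := [set f | U [set s | 0 <= ev s f]].

Let P_cone : prime_cone P.
Proof.
split.
- by move=> f g; apply: filterS2 => s /=; rewrite rmorphD; exact: addr_ge0.
- by move=> f g; apply: filterS2 => s /=; rewrite rmorphM; exact: mulr_ge0.
- move=> f; have [|h] := in_ultra_setVsetC [set s | 0 <= ev s f] UU; first by left.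
  right; apply: filterS h => s /= /negP; rewrite rmorphN oppr_ge0 -ltNge.
  exact: ltW.
- by move=> /filter_ex[s] /=; rewrite rmorphN1 oppr_ge0 ler10.
move=> f g fg fgN.
have fg0 : U [set s | ev s f * ev s g = 0].
  apply: filterS2 _ fg fgN => s /=; rewrite rmorphN rmorphM oppr_ge0 => h1 h2.
  by apply/eqP; rewrite eq_le h1 h2.
have zero h : U [set s | ev s h = 0] -> P h /\ P (- h).
  by move=> h0; split; apply: filterS h0 => s /= e; rewrite ?rmorphN /= e ?oppr0.
have [f0|f0] := in_ultra_setVsetC [set s | ev s f = 0] UU; first by left; apply: zero.
right; apply: zero; apply: filterS2 _ fg0 f0 => s /= /eqP; rewrite mulf_eq0.
by move=> /orP[/eqP|/eqP].
Qed.

Let const_term c : (fun s => i s c : F s) \in term_like.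
Proof. by apply/term_likeP; exists (TConst c); apply: filterS (U_ok (TConst c)) => s. Qed.

Let const c : B := exist (fun f : D => f \in term_like) _ (const_term c).

Let const_zmod : zmod_morphism const.
Proof.
move=> c d; apply: val_inj; apply: functional_extensionality_dep => s.
exact: rmorphB.
Qed.
Let const_monoid : monoid_morphism const.
Proof.
split=> [|c d]; apply: val_inj; apply: functional_extensionality_dep => s.
  exact: rmorph1.
exact: rmorphM.
Qed.
HB.instance Definition _ := GRing.isZmodMorphism.Build K B const const_zmod.
HB.instance Definition _ := GRing.isMonoidMorphism.Build K B const const_monoid.

(** [L] is the residue field of the cone of families that are nonnegative almost everywhere. Since
    [TInv] names inverses, fractions are named by terms too. A polynomial over [L] and the ends of a
    sign change are thus given by terms, and a [TRoot] term built from them names a root. *)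
Lemma term_field_exists : exists (L : rcfType) (j : {rmorphism K -> L}), order_morphism j.
Proof.
have [L [pi [piP piS]]] := prime_cone_field P_cone.
have pi_ge0 f : 0 <= pi f <-> U [set s | 0 <= ev s f].
  by rewrite piP; split => [/asboolP|h]; [|apply/asboolP].
have pi_eq0 f : U [set s | ev s f = 0] -> pi f = 0.
  move=> h; apply/eqP; rewrite eq_le -oppr_ge0 -rmorphN; apply/andP; split.
    by apply/pi_ge0; apply: filterS h => s /=; rewrite rmorphN /= => ->; rewrite oppr0.
  by apply/pi_ge0; apply: filterS h => s /= ->.
have pi_eq f g : U [set s | ev s f = ev s g] -> pi f = pi g.
  move=> h; apply/eqP; rewrite -subr_eq0 -rmorphB; apply/eqP/pi_eq0.
  by apply: filterS h => s /=; rewrite rmorphB /= => ->; rewrite subrr.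
have pi_lt0 f : pi f < 0 -> U [set s | ev s f < 0].
  move=> f0; have [h|h] := in_ultra_setVsetC [set s | 0 <= ev s f] UU.
    by move/pi_ge0: h; rewrite leNgt f0.
  by apply: filterS h => s /= /negP; rewrite -ltNge.
have eltP t : (fun s => r s t : F s) \in term_like.
  by apply/term_likeP; exists t; apply: filterS filterT => s.
pose elt t : B := exist (fun f : D => f \in term_like) _ (eltP t).
have evE s t : ev s (elt t) = r s t by [].
have surj x : exists t, x = pi (elt t).
  have [a [b [b0 ->]]] := piS x.
  have /term_likeP[ta tae] := valP a; have /term_likeP[tb tbe] := valP b.
  exists (TMul ta (TInv tb)); apply: (mulIf b0); rewrite divfK // -rmorphM.
  apply: pi_eq; have nb0 : U [set s | ev s b != 0].
    have [h|h] := in_ultra_setVsetC [set s | ev s b = 0] UU.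
      by rewrite (pi_eq0 _ h) eqxx in b0.
    by apply: filterS h => s /= /eqP.
  apply: filterS2 _ (filterI tae (filterI tbe nb0))
    (filterI (U_ok (TMul ta (TInv tb))) (U_ok (TInv tb))) => s /=.
  move=> [ea [eb b0s]] [e1 e2]; rewrite rmorphM /= evE e1 e2 -ea -[r s tb]eb.
  by rewrite divfK.
have signroot (p : {poly L}) a b : p.[a] * p.[b] < 0 -> exists x, root p x.
  have [ta ->] := surj a; have [tb ->] := surj b.
  have [c cP] : exists c : nat -> Tm, forall k, p`_k = pi (elt (c k)).
    exact: (dependent_choice (fun k => surj p`_k)).
  pose q := \poly_(k < size p) elt (c k).
  have -> : p = map_poly pi q.
    apply/polyP => k; rewrite coef_map coef_poly; case: ltnP => kp; first exact: cP.
    by rewrite raddf0 nth_default.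
  rewrite !horner_map -rmorphM => /pi_lt0 qab.
  have evq s x : ev s q.[x] = (\poly_(k < size p) r s (c k)).[ev s x].
    rewrite -horner_map; congr _.[_]; apply/polyP => k.
    by rewrite coef_map !coef_poly; case: ifP; rewrite ?raddf0.
  (* The sign change of p in [L] means a sign change of the s-th polynomial for almost all s, which
     is the premise of the condition on this term. *)
  pose t := TRoot (size p) c ta tb.
  exists (pi (elt t)); apply/rootP; rewrite horner_map; apply: pi_eq0.
  apply: filterS2 _ qab (U_ok t) => s /=; rewrite rmorphM /= !evq !evE => h /(_ h).
  by move=> /rootP.
pose rcfL := Num.RealField_isClosed.Build L (sign_root_ivt signroot).
pose M : rcfType := HB.pack_for rcfType L rcfL.
exists M, (pi \o const); move=> c c0 /=; apply/pi_ge0.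
by apply: filterS filterT => s _ /=; exact: hi.
Qed.

End TermField.

Lemma real_closure_exists :
  exists (L : rcfType) (j : {rmorphism K -> L}), order_morphism j.
Proof.
have [U [UU U_mem]] := large_filter.
have [F FP] := dependent_choice (@rterm_eval).
have {FP}[i FP] := dependent_choice FP.
have {FP}[r FP] := dependent_choice FP.
apply: (@term_field_exists U UU U_mem F i r) => [s|s t]; first exact: (FP s).1.
exact: (FP s).2.
Qed.

End RealClosure.

(** * Transfer and the Artin-Lang theorem *)

(* The elimination procedure of qe_rcf depends on the syntax of the terms only, and
   the constants that it introduces are rational, so it commutes with morphisms. *)
Section EliminationMap.
Variables (F G : realFieldType) (i : {rmorphism F -> G}).
Local Notation tF := (qe_rcf.term F).
Local Notation fF := (qe_rcf.formula F).
Local Notation fG := (qe_rcf.formula G).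

Fixpoint tmap (t : tF) : qe_rcf.term G :=
  match t with
  | qe_rcf.Var n => qe_rcf.Var G n
  | qe_rcf.Const c => qe_rcf.Const (i c)
  | qe_rcf.NatConst n => qe_rcf.NatConst G n
  | qe_rcf.Add t u => qe_rcf.Add (tmap t) (tmap u)
  | qe_rcf.Opp t => qe_rcf.Opp (tmap t)
  | qe_rcf.NatMul t n => qe_rcf.NatMul (tmap t) n
  | qe_rcf.Mul t u => qe_rcf.Mul (tmap t) (tmap u)
  | qe_rcf.Exp t n => qe_rcf.Exp (tmap t) n
  end.

Fixpoint qfmap (f : fF) : fG :=
  match f with
  | qe_rcf.Bool b => qe_rcf.Bool b
  | qe_rcf.Equal t u => qe_rcf.Equal (tmap t) (tmap u)
  | qe_rcf.Lt t u => qe_rcf.Lt (tmap t) (tmap u)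
  | qe_rcf.Le t u => qe_rcf.Le (tmap t) (tmap u)
  | qe_rcf.And f g => qe_rcf.And (qfmap f) (qfmap g)
  | qe_rcf.Or f g => qe_rcf.Or (qfmap f) (qfmap g)
  | qe_rcf.Implies f g => qe_rcf.Implies (qfmap f) (qfmap g)
  | qe_rcf.Not f => qe_rcf.Not (qfmap f)
  end.

Local Notation pmap := (map tmap).
Implicit Types (p q : polyF F) (sp sq : seq (polyF F)).

Lemma qfmap_Size p k k' : (forall n, qfmap (k n) = k' n) ->
  qfmap (Size p k) = Size (pmap p) k'.
Proof.
elim: p k k' => [|c p IH] k k' kk' //=.
by apply: IH => -[|n] //=; rewrite !kk'.
Qed.

Lemma qfmap_Isnull p k k' : (forall b, qfmap (k b) = k' b) ->
  qfmap (Isnull p k) = Isnull (pmap p) k'.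
Proof. by move=> kk'; apply: qfmap_Size. Qed.

Lemma qfmap_LtSize p q k k' : (forall b, qfmap (k b) = k' b) ->
  qfmap (LtSize p q k) = LtSize (pmap p) (pmap q) k'.
Proof. by move=> kk'; apply: qfmap_Size => n; apply: qfmap_Size. Qed.

Lemma qfmap_LeadCoef p k k' : (forall t, qfmap (k t) = k' (tmap t)) ->
  qfmap (LeadCoef p k) = LeadCoef (pmap p) k'.
Proof.
elim: p k k' => [|c p IH] k k' kk' //=; first by rewrite kk' /= rmorph0.
by apply: IH => t /=; rewrite !kk'.
Qed.

Lemma pmap_AmulXn a n : pmap (AmulXn a n) = AmulXn (tmap a) n.
Proof. by elim: n => //= n ->; rewrite rmorph0. Qed.

Lemma pmap_AddPoly p q : pmap (AddPoly p q) = AddPoly (pmap p) (pmap q).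
Proof. by elim: p q => [|a p IH] [|b q] //=; rewrite IH. Qed.

Lemma pmap_ScalPoly c p : pmap (ScalPoly c p) = ScalPoly (tmap c) (pmap p).
Proof. by rewrite /ScalPoly -!map_comp. Qed.

Lemma pmap_MulPoly p q : pmap (MulPoly p q) = MulPoly (pmap p) (pmap q).
Proof. by elim: p => //= a p IH; rewrite pmap_AddPoly pmap_ScalPoly /= IH. Qed.

Lemma pmap_ExpPoly p n : pmap (ExpPoly p n) = ExpPoly (pmap p) n.
Proof.
case: n => // n; rewrite /ExpPoly /iterop; elim: n => //= n IH.
by rewrite pmap_MulPoly IH.
Qed.

Lemma pmap_OppPoly p : pmap (OppPoly p) = OppPoly (pmap p).
Proof. by rewrite /OppPoly pmap_ScalPoly /= rmorphN1. Qed.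

Lemma pmap_Deriv p : pmap (Deriv p) = Deriv (pmap p).
Proof. by elim: p => //= a p IH; rewrite pmap_AddPoly /= IH. Qed.

Lemma qfmap_Rediv_rec_loop q sz cq c qq r n k k' :
  (forall d, qfmap (k d) = k' (d.1.1, pmap d.1.2, pmap d.2)) ->
  qfmap (Rediv_rec_loop q sz cq c qq r n k) =
  Rediv_rec_loop (pmap q) sz (tmap cq) c (pmap qq) (pmap r) n k'.
Proof.
elim: n c qq r k k' => [|n IH] c qq r k k' kk' /=; apply: qfmap_Size => sr;
    case: ifP => _; rewrite ?kk' //=; apply: qfmap_LeadCoef => lr;
    rewrite -/tmap ?kk' ?(IH _ _ _ _ k') //=;
  by rewrite !(pmap_AddPoly, pmap_MulPoly, pmap_OppPoly, pmap_AmulXn).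
Qed.

Lemma qfmap_Rediv p q k k' :
  (forall d, qfmap (k d) = k' (d.1.1, pmap d.1.2, pmap d.2)) ->
  qfmap (Rediv p q k) = Rediv (pmap p) (pmap q) k'.
Proof.
move=> kk'; apply: qfmap_Isnull => -[]; first by rewrite kk' /= rmorph0.
do 2!apply: qfmap_Size => ?; apply: qfmap_LeadCoef => lq.
by rewrite (qfmap_Rediv_rec_loop _ _ _ _ _ _ _ kk') /= rmorph0.
Qed.

Lemma qfmap_Rmod p q k k' : (forall r, qfmap (k r) = k' (pmap r)) ->
  qfmap (Rmod p q k) = Rmod (pmap p) (pmap q) k'.
Proof. by move=> kk'; apply: qfmap_Rediv. Qed.

Lemma qfmap_Rscal p q k k' : (forall n, qfmap (k n) = k' n) ->
  qfmap (Rscal p q k) = Rscal (pmap p) (pmap q) k'.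
Proof. by move=> kk'; apply: qfmap_Rediv. Qed.

Lemma qfmap_Rgcd_loop n p q k k' : (forall r, qfmap (k r) = k' (pmap r)) ->
  qfmap (Rgcd_loop n p q k) = Rgcd_loop n (pmap p) (pmap q) k'.
Proof.
elim: n p q k k' => [|n IH] p q k k' kk' /=; apply: qfmap_Rmod => r;
  by apply: qfmap_Isnull => -[] //; exact: IH.
Qed.

Lemma qfmap_Rgcd p q k k' : (forall r, qfmap (k r) = k' (pmap r)) ->
  qfmap (Rgcd p q k) = Rgcd (pmap p) (pmap q) k'.
Proof.
move=> kk'; apply: qfmap_LtSize => -[]; apply: qfmap_Isnull => -[] //;
  by apply: qfmap_Size => n; exact: qfmap_Rgcd_loop.
Qed.

Lemma qfmap_BigRgcd sp k k' : (forall r, qfmap (k r) = k' (pmap r)) ->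
  qfmap (BigRgcd sp k) = BigRgcd (map pmap sp) k'.
Proof.
elim: sp k k' => [|p sp IH] k k' kk' /=; first by rewrite kk' /= rmorph0.
by apply: IH => r; exact: qfmap_Rgcd.
Qed.

Lemma qfmap_Changes (s : seq tF) k k' : (forall n, qfmap (k n) = k' n) ->
  qfmap (Changes s k) = Changes (pmap s) k'.
Proof.
elim: s k k' => [|a s IH] k k' kk' //=.
apply: IH => v /=; rewrite !kk'; congr (qe_rcf.If (qe_rcf.Lt (qe_rcf.Mul _ _) _) _ _).
by case: s.
Qed.

Lemma qfmap_SeqPInfty sp k k' : (forall s, qfmap (k s) = k' (pmap s)) ->
  qfmap (SeqPInfty sp k) = SeqPInfty (map pmap sp) k'.
Proof.
elim: sp k k' => [|p sp IH] k k' kk' /=; first by rewrite kk'.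
by apply: qfmap_LeadCoef => lp; apply: IH => s; rewrite kk'.
Qed.

Lemma qfmap_SeqMInfty sp k k' : (forall s, qfmap (k s) = k' (pmap s)) ->
  qfmap (SeqMInfty sp k) = SeqMInfty (map pmap sp) k'.
Proof.
elim: sp k k' => [|p sp IH] k k' kk' /=; first by rewrite kk'.
apply: qfmap_LeadCoef => lp; apply: qfmap_Size => n; apply: IH => s.
by rewrite kk' /= rmorphN1.
Qed.

Lemma qfmap_ChangesPoly sp k k' : (forall n, qfmap (k n) = k' n) ->
  qfmap (ChangesPoly sp k) = ChangesPoly (map pmap sp) k'.
Proof.
move=> kk'; apply: qfmap_SeqMInfty => ms; apply: qfmap_SeqPInfty => ps.
by apply: qfmap_Changes => m; apply: qfmap_Changes => n.
Qed.

Lemma qfmap_NextMod p q k k' : (forall r, qfmap (k r) = k' (pmap r)) ->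
  qfmap (NextMod p q k) = NextMod (pmap p) (pmap q) k'.
Proof.
move=> kk'; apply: qfmap_LeadCoef => lq; apply: qfmap_Rscal => n.
by apply: qfmap_Rmod => r; rewrite kk' pmap_ScalPoly.
Qed.

Lemma qfmap_ModsAux p q n k k' : (forall s, qfmap (k s) = k' (map pmap s)) ->
  qfmap (ModsAux p q n k) = ModsAux (pmap p) (pmap q) n k'.
Proof.
elim: n p q k k' => [|n IH] p q k k' kk' /=; first by rewrite kk'.
apply: qfmap_Isnull => -[]; first by rewrite kk'.
by apply: qfmap_NextMod => r; apply: IH => s; rewrite kk'.
Qed.

Lemma qfmap_Mods p q k k' : (forall s, qfmap (k s) = k' (map pmap s)) ->
  qfmap (Mods p q k) = Mods (pmap p) (pmap q) k'.
Proof.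
by move=> kk'; do 2!apply: qfmap_Size => ?; apply: qfmap_ModsAux.
Qed.

Lemma pmap_reducebig (I : Type) (s : seq I) (f : I -> polyF F) :
  pmap (reducebig [:: qe_rcf.NatConst F 1] s
    (fun x => BigBody x (@MulPoly F) true (f x))) =
  reducebig [:: qe_rcf.NatConst G 1] s
    (fun x => BigBody x (@MulPoly G) true (pmap (f x))).
Proof. by elim: s => //= x s IH; rewrite pmap_MulPoly IH. Qed.

Lemma pmap_PolyComb sq sc : pmap (PolyComb sq sc) = PolyComb (map pmap sq) sc.
Proof.
rewrite /PolyComb pmap_reducebig size_map; congr reducebig; apply: funext => n.
rewrite pmap_ExpPoly; congr (BigBody _ _ _ (ExpPoly _ _)).
have [h|h] := ltnP n (size sq); first by rewrite (nth_map [::]).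
by rewrite !nth_default // size_map.
Qed.

Lemma pmap_Pcq sq n : pmap (Pcq sq n) = Pcq (map pmap sq) n.
Proof.
rewrite /Pcq size_map; elim: sg_tab n => [|sc s IH] [|n] //=.
exact: pmap_PolyComb.
Qed.

Lemma qfmap_TaqR p q k k' : (forall n, qfmap (k n) = k' n) ->
  qfmap (TaqR p q k) = TaqR (pmap p) (pmap q) k'.
Proof.
move=> kk'; rewrite /TaqR -pmap_Deriv -pmap_MulPoly.
by apply: qfmap_Mods => s; apply: qfmap_ChangesPoly.
Qed.

Lemma qfmap_TaqsR p sq n k k' : (forall t, qfmap (k t) = k' (tmap t)) ->
  qfmap (TaqsR p sq n k) = TaqsR (pmap p) (map pmap sq) n k'.
Proof.
move=> kk'; rewrite /TaqsR -pmap_Pcq; apply: qfmap_TaqR => m.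
by rewrite kk' /= rmorph_int.
Qed.

(** These constants are entries of the inverse of an integer matrix, hence rational. *)
Lemma rmorph_coefs n m : i (coefs F n m) = coefs G n m.
Proof.
rewrite /coefs; have [h|h] := ltnP m (3 ^ n); last first.
  rewrite !nth_default; first exact: rmorph0.
    by rewrite size_map size_enum_ord.
  by rewrite size_map size_enum_ord.
have x0 : 'I_(3 ^ n) := cast_ord (esym (exp3n _)) ord0.
rewrite !(nth_map x0) -?enumT ?size_enum_ord //.
have -> : map_mx (intr : int -> G) (ctmat n) =
    map_mx i (map_mx (intr : int -> F) (ctmat n)).
  by apply/matrixP => x y; rewrite !mxE rmorph_int.
by rewrite -map_invmx -map_castmx [RHS]mxE.
Qed.

Lemma tmap_Coefs n m : tmap (Coefs F n m) = Coefs G n m.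
Proof.
case: n => [|[|n]] /=; first by rewrite rmorph_nat.
  congr qe_rcf.Const; case: m => [|[|[|m]]] /=.
  - by rewrite fmorphV rmorph_nat.
  - by rewrite fmorphV rmorph_nat.
  - exact: rmorph0.
  - by rewrite !nth_nil; exact: rmorph0.
by rewrite rmorph_coefs.
Qed.

Lemma qfmap_CcountWeak p sq k k' : (forall t, qfmap (k t) = k' (tmap t)) ->
  qfmap (CcountWeak p sq k) = CcountWeak (pmap p) (map pmap sq) k'.
Proof.
move=> kk'; rewrite /CcountWeak size_map.
rewrite -[qe_rcf.NatConst G 0]/(tmap (qe_rcf.NatConst F 0)).
elim: (3 ^ size sq)%N (qe_rcf.NatConst F 0) => [|n IH] t; first exact: kk'.
apply: qfmap_TaqsR => u; rewrite -/tmap.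
by rewrite IH -tmap_Coefs.
Qed.

Lemma pmap_BoundingPoly sq : pmap (BoundingPoly sq) = BoundingPoly (map pmap sq).
Proof.
rewrite /BoundingPoly pmap_Deriv; congr Deriv.
by elim: sq => //= p sq IH; rewrite pmap_MulPoly IH.
Qed.

Lemma qfmap_CcountGt0 sp sq :
  qfmap (CcountGt0 sp sq) = CcountGt0 (map pmap sp) (map pmap sq).
Proof.
rewrite /CcountGt0; apply: qfmap_BigRgcd => r; apply: qfmap_Isnull => -[] /=; last first.
  exact: qfmap_CcountWeak.
rewrite -pmap_BoundingPoly; apply: qfmap_CcountWeak => t /=.
congr (qe_rcf.Or _ (qe_rcf.Or _ _)).
  by elim: (sq) => //= q s ->; congr qe_rcf.And; apply: qfmap_LeadCoef.
elim: (sq) => //= q s ->; congr qe_rcf.And; apply: qfmap_Size => n.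
exact: qfmap_LeadCoef.
Qed.

Lemma pmap_abstrX n t : pmap (abstrX n t) = abstrX n (tmap t).
Proof.
elim: t => //= [m|t IHt u IHu|t IHt|t IHt m|t IHt u IHu|t IHt m].
- by case: eqP.
- by rewrite pmap_AddPoly IHt IHu.
- by rewrite pmap_OppPoly IHt.
- by rewrite /NatMulPoly pmap_ScalPoly IHt.
- by rewrite pmap_MulPoly IHt IHu.
- by rewrite pmap_ExpPoly IHt.
Qed.

End EliminationMap.

HB.instance Definition _ (R : Type) := gen_eqMixin (qe_rcf.term R).

Lemma rcf_order_morphism (R : rcfType) (F : realFieldType) (i : {rmorphism R -> F}) :
  order_morphism i.
Proof. by move=> c c0; rewrite -(sqr_sqrtr c0) rmorphXn sqr_ge0. Qed.

Section Transfer.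
Variables (R L : rcfType) (i : {rmorphism R -> L}).
Local Notation tR := (qe_rcf.term R).

Lemma sgz_rcf_morphism x : sgz (i x) = sgz x.
Proof.
have hi := rcf_order_morphism i.
case: (sgzP x) => [->|x0|x0]; first by rewrite rmorph0 sgz0.
  by apply: gtr0_sgz; rewrite order_morphism_gt0.
by apply: ltr0_sgz; rewrite -oppr_gt0 -rmorphN order_morphism_gt0 // oppr_gt0.
Qed.

Lemma eval_tmap e (t : tR) :
  qe_rcf.eval (map i e) (tmap i t) = i (qe_rcf.eval e t).
Proof.
elim: t => //= [n|n|t -> u ->|t ->|t -> n|t -> u ->|t -> n].
- have [h|h] := ltnP n (size e); first by rewrite (nth_map 0).
  by rewrite !nth_default ?size_map // rmorph0.
- by rewrite rmorph_nat.
- by rewrite rmorphD.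
- by rewrite rmorphN.
- by rewrite rmorphMn.
- by rewrite rmorphM.
- by rewrite rmorphXn.
Qed.

Fixpoint atoms (f : qe_rcf.formula R) : seq tR :=
  match f with
  | qe_rcf.Bool _ => [::]
  | qe_rcf.Equal t u | qe_rcf.Lt t u | qe_rcf.Le t u =>
      [:: qe_rcf.Add t (qe_rcf.Opp u)]
  | qe_rcf.And f g | qe_rcf.Or f g | qe_rcf.Implies f g => atoms f ++ atoms g
  | qe_rcf.Not f => atoms f
  end.

Lemma qf_eval_atoms e e' (f : qe_rcf.formula R) :
  {in atoms f, forall t, sgz (qe_rcf.eval e t) = sgz (qe_rcf.eval e' (tmap i t))} ->
  qe_rcf.qf_eval e f = qe_rcf.qf_eval e' (qfmap i f).
Proof.
elim: f => //= [t u|t u|t u|f IHf g IHg|f IHf g IHg|f IHf g IHg|f IHf] h.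
- have /= /(congr1 (fun z => z == 0)) := h _ (mem_head _ _).
  by rewrite !sgz_eq0 !subr_eq0.
- have /= /(congr1 (fun z => z < 0)) := h _ (mem_head _ _).
  by rewrite !sgz_lt0 !subr_lt0.
- have /= /(congr1 (fun z => z <= 0)) := h _ (mem_head _ _).
  by rewrite !sgz_le0 !subr_le0.
- by rewrite IHf ?IHg // => t tf; apply: h; rewrite mem_cat tf ?orbT.
- by rewrite IHf ?IHg // => t tf; apply: h; rewrite mem_cat tf ?orbT.
- by rewrite IHf ?IHg // => t tf; apply: h; rewrite mem_cat tf ?orbT.
- by rewrite IHf.
Qed.

(** Induction on the number of coordinates. That some last coordinate realizes the prescribed signs
    means that polynomials [sp] have a common root at which the polynomials [sq] are positive;
    elimination turns this into a quantifier-free condition on the other coordinates. The induction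
    hypothesis is applied to the terms whose signs decide that condition. *)
Lemma transfer_signs n (ts : seq tR) (e : seq L) : size e = n ->
  exists2 e' : seq R, size e' = n &
    {in ts, forall t, sgz (qe_rcf.eval e' t) = sgz (qe_rcf.eval e (tmap i t))}.
Proof.
elim: n ts e => [|n IH] ts e.
  move=> /size0nil ->; exists [::] => // t _.
  by rewrite -[[::] in RHS]/(map i [::]) eval_tmap sgz_rcf_morphism.
case/lastP: e => // e x; rewrite size_rcons => -[sze].
pose sg t := sgz (qe_rcf.eval (rcons e x) (tmap i t)).
pose sp := [seq abstrX n t | t <- ts & sg t == 0].
pose sq := [seq abstrX n t | t <- ts & sg t == 1] ++
  [seq OppPoly (abstrX n t) | t <- ts & sg t == -1].
have envE (T : realFieldType) (e' : seq T) y : size e' = n ->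
  set_nth 0 e' n y = rcons e' y.
  by move=> <-; elim: e' => //= a e' ->.
have rootE (T : rcfType) (e' : seq T) y t : size e' = n ->
    (eval_poly e' (abstrX n t)).[y] = qe_rcf.eval (rcons e' y) t.
  by move=> h; rewrite abstrXP envE.
have [e' sze' e'P] := IH (atoms (CcountGt0 sp sq)) e sze.
have : qe_rcf.qf_eval e (qfmap i (CcountGt0 sp sq)).
  rewrite qfmap_CcountGt0 eval_CcountGt0; apply/ccount_gt0P; exists x.
  rewrite !big_all /sp /sq !all_map all_cat !all_map; apply/and3P; split.
  - apply/allP => t; rewrite mem_filter => /andP[st _] /=.
    by rewrite pmap_abstrX rootE // -sgz_eq0.
  - apply/allP => t; rewrite mem_filter => /andP[st _] /=.
    by rewrite pmap_abstrX rootE // -sgz_gt0 -/(sg t) (eqP st).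
  - apply/allP => t; rewrite mem_filter => /andP[st _] /=.
  rewrite pmap_OppPoly pmap_abstrX eval_OppPoly hornerN rootE //.
  by rewrite oppr_gt0 -sgz_lt0 -/(sg t) (eqP st).
rewrite -(qf_eval_atoms e'P) eval_CcountGt0 => /ccount_gt0P[y].
rewrite !big_all /sp /sq !all_map all_cat !all_map => /and3P[/allP h0 /allP h1 /allP h2].
exists (rcons e' y) => [|t tts]; first by rewrite size_rcons sze'.
rewrite -/(sg t); have : [|| sg t == 0, sg t == 1 | sg t == -1].
  by rewrite /sg; case: sgzP.
case/or3P => st; have := st => /eqP ->.
- have /= := h0 t; rewrite mem_filter st tts => /(_ isT).
  by rewrite rootE // => /eqP ->; rewrite sgz0.
- have /= := h1 t; rewrite mem_filter st tts => /(_ isT).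
  by rewrite rootE // => /gtr0_sgz.
- have /= := h2 t; rewrite mem_filter st tts => /(_ isT).
  by rewrite eval_OppPoly hornerN rootE // oppr_gt0 => /ltr0_sgz.
Qed.

End Transfer.

(** * Sign conditions at points of the real spectrum and at points of R^n *)

Section ArtinLang.
Variables (R : rcfType) (n : nat).
Local Notation A := {mpoly R[n]}.
Local Notation tR := (qe_rcf.term R).

Definition mpoly_term (f : A) : tR :=
  foldr (fun m t => qe_rcf.Add (qe_rcf.Mul (qe_rcf.Const f@_m)
      (foldr (fun (k : 'I_n) u => qe_rcf.Mul (qe_rcf.Exp (qe_rcf.Var R k) (m k)) u)
         (qe_rcf.NatConst R 1) (enum 'I_n))) t)
    (qe_rcf.NatConst R 0) (msupp f).

Lemma eval_mpoly_term (e : seq R) f :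
  qe_rcf.eval e (mpoly_term f) = f.@[fun k : 'I_n => e`_k].
Proof.
rewrite mevalE /mpoly_term; elim: (msupp f) => [|m s IH] /=; first by rewrite big_nil.
rewrite big_cons IH; congr (_ * _ + _); rewrite -big_enum /=.
by elim: (enum 'I_n) => [|k ks IHk] /=; rewrite ?big_nil ?big_cons ?IHk.
Qed.

Lemma eval_tmap_mpoly_term (L : rcfType) (phi : {rmorphism A -> L}) f :
  qe_rcf.eval [seq phi 'X_k | k <- enum 'I_n]
    (tmap (phi \o mpolyC n (R := R)) (mpoly_term f)) = phi f.
Proof.
rewrite [in RHS](mpolyE f) rmorph_sum /mpoly_term.
elim: (msupp f) => [|m s IH] /=; first by rewrite big_nil.
rewrite big_cons IH; congr (_ + _); rewrite -mul_mpolyC rmorphM; congr (_ * _).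
rewrite mpolyXE_id rmorph_prod -big_enum /=.
have nthE (k : 'I_n) : [seq phi 'X_k | k <- enum 'I_n]`_k = phi 'X_k.
  by rewrite (nth_map k) ?size_enum_ord // nth_ord_enum.
move: nthE; set e := map _ _ => nthE.
elim: (enum 'I_n) => [|k ks IHk] /=; rewrite ?big_nil ?big_cons //.
by rewrite IHk nthE rmorphXn.
Qed.

(** The images of the variables in a real closed extension of A(beta) form a point with the required
    signs, and [transfer_signs] replaces it by a point of R^n. *)
Theorem artin_lang (beta : sper A) (fs : seq A) :
  exists x : 'rV[R]_n, {in fs, forall f, sgz f.@[x 0] = sgz (sper_ev beta f)}.
Proof.
have [F [pi [piP _]]] := sper_field beta.
have [L [j hj]] := real_closure_exists F.
pose phi := j \o pi : {rmorphism A -> L}.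
have [e sze eP] := transfer_signs (phi \o mpolyC n (R := R))
  (map mpoly_term fs) (e := [seq phi 'X_k | k <- enum 'I_n])
  (etrans (size_map _ _) (size_enum_ord n)).
exists (\row_k e`_k) => f ffs.
have -> : f.@[(\row_(k < n) e`_k) 0] = f.@[fun k : 'I_n => e`_k].
  by apply: meval_eq => k; rewrite mxE.
rewrite -eval_mpoly_term eP ?map_f // eval_tmap_mpoly_term /phi /=.
have pos g : (0 < j (pi g)) = (0 < sper_ev beta g).
  rewrite order_morphism_gt0 // !lt_neqAle piP; congr (~~ _ && _).
  by rewrite !(eq_sym 0) !eq_le -!oppr_ge0 -!rmorphN !piP.
case: (sgzP (sper_ev beta f)) => [f0|f0|f0].
- apply/eqP; rewrite sgz_eq0 eq_le !leNgt pos f0 ltxx /=.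
  by rewrite -oppr_gt0 -!rmorphN pos rmorphN /= f0 oppr0 ltxx.
- by apply: gtr0_sgz; rewrite pos.
- by apply: ltr0_sgz; rewrite -oppr_gt0 -!rmorphN pos rmorphN oppr_gt0.
Qed.

End ArtinLang.

(** * Connected basic open sets *)

Section Compactness.
Variable A : comNzRingType.

(** This is the limit of [U] in the constructible topology: the elements that are nonnegative at
    almost all points form a prime cone. *)
Lemma sper_ultra_limit (U : set_system (sper A)) : UltraFilter U ->
  exists delta : sper A, forall f,
    (0 < sper_ev delta f) <-> U [set alpha | 0 < sper_ev alpha f].
Proof.
move=> UU; pose P := [set f : A | U [set alpha | 0 <= sper_ev alpha f]].
have hP : prime_cone P.
  split.
  - by move=> f g; apply: filterS2 => s /=; rewrite rmorphD; exact: addr_ge0.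
  - by move=> f g; apply: filterS2 => s /=; rewrite rmorphM; exact: mulr_ge0.
  - move=> f; have [|h] := in_ultra_setVsetC [set s | 0 <= sper_ev s f] UU; first by left.
    right; apply: filterS h => s /= /negP; rewrite rmorphN oppr_ge0 -ltNge.
    exact: ltW.
  - by move=> /filter_ex[s] /=; rewrite rmorphN1 oppr_ge0 ler10.
  move=> f g fg fgN.
  have fg0 : U [set s | sper_ev s f * sper_ev s g = 0].
    apply: filterS2 _ fg fgN => s /=; rewrite rmorphN /= !rmorphM /= oppr_ge0 => h1 h2.
    by apply/eqP; rewrite eq_le h1 h2.
  have zero h : U [set s | sper_ev s h = 0] -> P h /\ P (- h).
    by move=> h0; split; apply: filterS h0 => s /= e; rewrite ?rmorphN /= e ?oppr0.
  have [f0|f0] := in_ultra_setVsetC [set s | sper_ev s f = 0] UU.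
    by left; apply: zero.
  right; apply: zero; apply: filterS2 _ fg0 f0 => s /= /eqP; rewrite mulf_eq0.
  by move=> /orP[/eqP|/eqP].
have [delta dP] := prime_cone_sper hP; exists delta => f.
rewrite ltNge -oppr_ge0 -rmorphN dP.
split=> [/asboolPn nf|h].
  have [h|h] := in_ultra_setVsetC [set s | 0 <= sper_ev s (- f)] UU => //.
  by apply: filterS h => s /= /negP; rewrite rmorphN oppr_ge0 -ltNge.
apply/asboolPn => h'; have /filter_ex[s /= []] : U ([set s | 0 < sper_ev s f] `&`
    [set s | 0 <= sper_ev s (- f)]) by exact: filterI.
by rewrite rmorphN oppr_ge0 ltNge => /negP.
Qed.

(** Without a finite subcover, the complements in [basic_open L] of the finite unions generate a
    proper filter. The limit of an ultrafilter above it lies in [basic_open L] but in no member of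
    the cover. *)
Lemma basic_open_compact (L : seq A) (S : set (seq A)) :
  basic_open L `<=` \bigcup_(s in S) @basic_open A s ->
  exists l : seq (seq A), (forall s, s \in l -> S s) /\
    basic_open L `<=` \bigcup_(s in [set s | s \in l]) @basic_open A s.
Proof.
move=> cov; apply: contrapT => nfin.
pose F : set_system (sper A) := [set X | exists l : seq (seq A),
  (forall s, s \in l -> S s) /\
  basic_open L `\` \bigcup_(s in [set s | s \in l]) @basic_open A s `<=` X].
have FF : ProperFilter F.
  apply: Build_ProperFilter_ex.
    move=> X [l [lS lX]]; apply: contrapT => nX; apply: nfin; exists l; split=> //.
    by move=> a La; apply: contrapT => na; apply: nX; exists a; apply: lX.
  split; first by exists [::].
    move=> X Y [l [lS lX]] [m [mS mY]]; exists (l ++ m); split.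
      by move=> s; rewrite mem_cat => /orP[/lS|/mS].
    move=> a [La na]; split; [apply: lX|apply: mY]; split=> //;
      apply: contra_not na => -[s sl sa]; exists s => //=;
      by rewrite mem_cat sl ?orbT.
  by move=> X Y XY [l [lS lX]]; exists l; split=> // a /lX /XY.
have [U [UU FU]] := ultraFilterLemma FF.
have [delta dP] := sper_ultra_limit UU.
have open s : basic_open s delta <-> U (basic_open s).
  split=> [ds|Us f fs]; last first.
    by apply/dP; apply: filterS Us => a; exact.
  elim: s ds => [|f s IH] ds; first by apply: filterS filterT.
  have Us : U (basic_open s) by apply: IH => g gs; apply: ds; rewrite in_cons gs orbT.
  have /dP Uf := ds f (mem_head _ _).
  by apply: filterS2 _ Uf Us => a /= fa sa g /predU1P[->//|/sa].
have dL : basic_open L delta.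
  by apply/open/FU; exists [::]; split=> // a [].
have [s Ss ds] := cov _ dL.
have Us : U (~` basic_open s).
  apply: FU; exists [:: s]; split; first by move=> t; rewrite mem_seq1 => /eqP ->.
  by move=> a [_ na] sa; apply: na; exists s => //=; rewrite mem_seq1.
have /filter_ex[a [h1 h2]] : U (~` basic_open s `&` basic_open s).
  by apply: filterI Us _; apply/open.
exact: h1.
Qed.

End Compactness.

Section PointEvaluation.
Variables (R : rcfType) (n : nat).
Local Notation A := {mpoly R[n]}.

Lemma sper_point (x : 'rV[R]_n) :
  exists delta : sper A, forall f, sgz f.@[x 0] = sgz (sper_ev delta f).
Proof.
have hP : prime_cone [set f : A | 0 <= f.@[x 0]].
  split=> /=.
  - by move=> f g; rewrite mevalD; exact: addr_ge0.
  - by move=> f g; rewrite mevalM; exact: mulr_ge0.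
  - by move=> f; rewrite mevalN oppr_ge0; apply/orP; exact: le_total.
  - by rewrite rmorphN1 oppr_ge0 ler10.
  move=> f g; rewrite !mevalN !oppr_ge0 mevalM => h1 h2.
  have : f.@[x 0] * g.@[x 0] == 0 by rewrite eq_le h1 h2.
  by rewrite mulf_eq0 => /orP[/eqP ->|/eqP ->]; [left|right]; rewrite lexx.
have [delta dP] := prime_cone_sper hP; exists delta => f.
have pos g : (0 < sper_ev delta g) = (0 < g.@[x 0]).
  by rewrite ltNge -oppr_ge0 -rmorphN dP asboolb mevalN oppr_ge0 -ltNge.
case: (sgzP (sper_ev delta f)) => [f0|f0|f0].
- apply/eqP; rewrite sgz_eq0 eq_le !leNgt -pos f0 ltxx /=.
  by rewrite -oppr_gt0 -mevalN -pos rmorphN /= f0 oppr0 ltxx.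
- by apply: gtr0_sgz; rewrite -pos.
- by apply: ltr0_sgz; rewrite -oppr_gt0 -mevalN -pos rmorphN oppr_gt0.
Qed.

Fixpoint sc_polys (P : sign_condition R n) : seq A :=
  match P with
  | SGt0 g | SEq0 g => [:: g]
  | SNot P => sc_polys P
  | SAnd P Q | SOr P Q => sc_polys P ++ sc_polys Q
  end.

Lemma sc_set_sper (P : sign_condition R n) (x : 'rV[R]_n) (beta : sper A) :
  {in sc_polys P, forall f, sgz f.@[x 0] = sgz (sper_ev beta f)} ->
  sc_set P x <-> sc_sper P beta.
Proof.
elim: P => /= [g|g|P IH|P IHP Q IHQ|P IHP Q IHQ] h.
- by rewrite -sgz_gt0 h ?mem_head // sgz_gt0.
- have e : (g.@[x 0] == 0) = (sper_ev beta g == 0).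
    by rewrite -[LHS]sgz_eq0 -[RHS]sgz_eq0 h ?mem_head.
  by split=> /eqP h0; apply/eqP; [rewrite -e|rewrite e].
- by split; apply: contra_not => /(IH h).
- have hP : {in sc_polys P, forall f, sgz f.@[x 0] = sgz (sper_ev beta f)}.
    by move=> f fP; apply: h; rewrite mem_cat fP.
  have hQ : {in sc_polys Q, forall f, sgz f.@[x 0] = sgz (sper_ev beta f)}.
    by move=> f fP; apply: h; rewrite mem_cat fP orbT.
  by split=> -[/(IHP hP) ? /(IHQ hQ) ?].
have hP : {in sc_polys P, forall f, sgz f.@[x 0] = sgz (sper_ev beta f)}.
  by move=> f fP; apply: h; rewrite mem_cat fP.
have hQ : {in sc_polys Q, forall f, sgz f.@[x 0] = sgz (sper_ev beta f)}.
  by move=> f fP; apply: h; rewrite mem_cat fP orbT.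
by split=> -[/(IHP hP)|/(IHQ hQ)]; [left|right|left|right].
Qed.

Definition pos_set (L : seq A) : set 'rV[R]_n :=
  [set x | forall f, f \in L -> 0 < f.@[x 0]].

Lemma constructible_point (L : seq A) (P : sign_condition R n) (beta : sper A) :
  basic_open L beta -> sc_sper P beta -> exists2 x, pos_set L x & sc_set P x.
Proof.
move=> Lb Pb; have [x xP] := artin_lang beta (L ++ sc_polys P).
exists x; last first.
  by apply/(sc_set_sper (beta := beta)) => // f fP; apply: xP; rewrite mem_cat fP orbT.
by move=> f fL; rewrite -sgz_gt0 xP ?mem_cat ?fL // sgz_gt0; exact: Lb.
Qed.

(** [SGt0 0] serves as the false condition. *)
Definition sc_any (I : eqType) (F : I -> sign_condition R n) (s : seq I) :=
  foldr (fun k P => SOr (F k) P) (SGt0 0) s.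

Lemma sc_anyP (I : eqType) (F : I -> sign_condition R n) s (x : 'rV[R]_n) :
  sc_set (sc_any F s) x <-> exists2 k, k \in s & sc_set (F k) x.
Proof.
elim: s => [|k s IH] /=; first by rewrite meval0 ltxx; split=> // -[].
split=> [[h|/IH[k' k's h]]|[k' /predU1P[->|k's] h]].
- by exists k; rewrite ?mem_head.
- by exists k'; rewrite // in_cons k's orbT.
- by left.
- by right; apply/IH; exists k'.
Qed.

Lemma sc_any_sperP (I : eqType) (F : I -> sign_condition R n) s (x : sper A) :
  sc_sper (sc_any F s) x <-> exists2 k, k \in s & sc_sper (F k) x.
Proof.
elim: s => [|k s IH] /=; first by rewrite rmorph0 ltxx; split=> // -[].
split=> [[h|/IH[k' k's h]]|[k' /predU1P[->|k's] h]].
- by exists k; rewrite ?mem_head.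
- by exists k'; rewrite // in_cons k's orbT.
- by left.
- by right; apply/IH; exists k'.
Qed.

(** [SEq0 0] serves as the true condition. *)
Definition sc_pos (s : seq A) : sign_condition R n :=
  foldr (fun f P => SAnd (SGt0 f) P) (SEq0 0) s.

Lemma sc_posP s x : sc_set (sc_pos s) x <-> pos_set s x.
Proof.
elim: s => [|f s IH] /=; first by rewrite meval0; split.
split=> [[h /IH hs] g /predU1P[->//|/hs //]|h].
split; first by apply: h; rewrite mem_head.
by apply/IH => g gs; apply: h; rewrite in_cons gs orbT.
Qed.

Lemma sc_pos_sperP s x : sc_sper (sc_pos s) x <-> basic_open s x.
Proof.
elim: s => [|f s IH] /=; first by rewrite rmorph0; split.
split=> [[h /IH hs] g /predU1P[->//|/hs //]|h].
split; first by apply: h; rewrite mem_head.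
by apply/IH => g gs; apply: h; rewrite in_cons gs orbT.
Qed.

End PointEvaluation.

(** * Polynomial paths in R^n and connectedness along them *)

Section Paths.
Variables (R : rcfType) (n : nat).
Local Notation A := {mpoly R[n]}.
Local Notation path := ('I_n -> {poly R}).
Implicit Types (gamma : path) (a b t : R).

Definition path_at gamma t : 'rV[R]_n := \row_j (gamma j).[t].

Definition path_comp gamma (f : A) : {poly R} := mmap (@polyC R) gamma f.

Lemma horner_path_comp gamma f t : (path_comp gamma f).[t] = f.@[path_at gamma t 0].
Proof.
rewrite mevalE /path_comp /mmap horner_sum; apply: eq_bigr => m _.
rewrite hornerM hornerC /mmap1 horner_prod; congr (_ * _); apply: eq_bigr => k _.
by rewrite horner_exp mxE.
Qed.

Definition path_closed (E : set 'rV[R]_n) : Prop := forall gamma a b, a < b ->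
  (forall t, a < t < b -> E (path_at gamma t)) ->
  E (path_at gamma a) /\ E (path_at gamma b).

(** An impredicative way to say that any two points of [E] are joined by a finite chain of
    polynomial paths inside [E]: take for [Q] the points that can be reached from x. *)
Definition path_connected (E : set 'rV[R]_n) : Prop := forall Q : set 'rV[R]_n,
  (forall gamma a b, a <= b -> (forall t, a <= t <= b -> E (path_at gamma t)) ->
     Q (path_at gamma a) <-> Q (path_at gamma b)) ->
  forall x y, E x -> E y -> Q x -> Q y.

Lemma poly_sign_constant (p : {poly R}) a b t t' :
  (forall r, root p r -> ~ (a < r < b)) ->
  a < t < b -> a < t' < b -> sgz p.[t] = sgz p.[t'].
Proof.
move=> nr.
suff h u v : u <= v -> a < u < b -> a < v < b -> sgz p.[u] = sgz p.[v].
  by move=> tab t'ab; have [tt'|t't] := leP t t'; [|apply/esym]; apply: h => //; exact: ltW.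
move=> uv /andP[au ub] /andP[av vb].
have nr0 c : a < c < b -> p.[c] != 0 by move=> cab; apply/eqP => /rootP /nr.
have pu : p.[u] != 0 by apply: nr0; rewrite au ub.
have pv : p.[v] != 0 by apply: nr0; rewrite av vb.
have [h|h|h] := ltgtP (p.[u] * p.[v]) 0; last first.
- by move/eqP: h; rewrite mulf_eq0 (negPf pu) (negPf pv).
- case: (sgzP p.[u]) pu h => [->|u0|u0] _; rewrite ?mul0r ?ltxx //.
    by rewrite pmulr_rgt0 // => v0; rewrite gtr0_sgz.
  by rewrite nmulr_rgt0 // => v0; rewrite ltr0_sgz.
have [c cuv /nr []] := poly_ivtoo uv h; move: cuv; rewrite in_itv /= => /andP[uc cv].
by rewrite (lt_trans au) // (lt_trans cv).
Qed.

(** The break parameters are the roots of the polynomials of [P] composed with [gamma]; those that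
    vanish identically along [gamma] contribute none. *)
Lemma sc_constant (P : sign_condition R n) gamma : exists s : seq R,
  forall a b, (forall r, r \in s -> ~ (a < r < b)) ->
  forall t t', a < t < b -> a < t' < b ->
  sc_set P (path_at gamma t) -> sc_set P (path_at gamma t').
Proof.
have atom (g : A) : exists s : seq R,
    forall a b, (forall r, r \in s -> ~ (a < r < b)) ->
    forall t t', a < t < b -> a < t' < b ->
    sgz g.@[path_at gamma t 0] = sgz g.@[path_at gamma t' 0].
  have [p0|p0] := eqVneq (path_comp gamma g) 0.
    by exists [::] => a b _ t t' _ _; rewrite -!horner_path_comp p0 !horner0.
  exists (rootsR (path_comp gamma g)) => a b nr t t' tab t'ab.
  rewrite -!horner_path_comp; apply: (poly_sign_constant _ tab t'ab) => r pr.
  by apply: nr; have := roots_on_rootsR p0 r; rewrite in_itv /= pr.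
elim: P => /= [g|g|P [s sP]|P [s sP] Q [s' sQ]|P [s sP] Q [s' sQ]].
- by have [s sP] := atom g; exists s => a b /sP h t t' /h /[apply] e;
    rewrite -sgz_gt0 e sgz_gt0.
- have [s sP] := atom g; exists s => a b /sP h t t' /h /[apply] e /eqP.
  by rewrite -sgz_eq0 e sgz_eq0 => /eqP.
- by exists s => a b /sP h t t' tab t'ab; apply: contra_not; apply: h.
- exists (s ++ s') => a b nr t t' tab t'ab [hP hQ]; split.
    by apply: (sP a b _ t t' tab t'ab hP) => r rs; apply: nr; rewrite mem_cat rs.
  by apply: (sQ a b _ t t' tab t'ab hQ) => r rs; apply: nr; rewrite mem_cat rs orbT.
exists (s ++ s') => a b nr t t' tab t'ab [hP|hQ]; [left|right].
  by apply: (sP a b _ t t' tab t'ab hP) => r rs; apply: nr; rewrite mem_cat rs.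
by apply: (sQ a b _ t t' tab t'ab hQ) => r rs; apply: nr; rewrite mem_cat rs orbT.
Qed.

Lemma path_split (P Q : sign_condition R n) gamma a b :
  path_closed (sc_set P) -> path_closed (sc_set Q) -> a <= b ->
  (forall t, a <= t <= b -> sc_set P (path_at gamma t) \/ sc_set Q (path_at gamma t)) ->
  (forall t, a <= t <= b -> ~ (sc_set P (path_at gamma t) /\ sc_set Q (path_at gamma t))) ->
  sc_set P (path_at gamma a) <-> sc_set P (path_at gamma b).
Proof.
move=> clP clQ.
have [s1 h1] := sc_constant P gamma; have [s2 h2] := sc_constant Q gamma.
(* Induction on a list of the break parameters inside the interval, which is cut at each of them.
   With none left, the condition that holds at the midpoint holds on the whole open interval, hence
   at both ends by closedness, and disjointness excludes the other one there. *)
suff main (s : seq R) : a <= b ->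
    (forall r, r \in s1 ++ s2 -> a < r < b -> r \in s) ->
    (forall t, a <= t <= b -> sc_set P (path_at gamma t) \/ sc_set Q (path_at gamma t)) ->
    (forall t, a <= t <= b ->
       ~ (sc_set P (path_at gamma t) /\ sc_set Q (path_at gamma t))) ->
    sc_set P (path_at gamma a) <-> sc_set P (path_at gamma b).
  by move=> ab cov dis; apply: (main (s1 ++ s2) ab _ cov dis) => r rs _.
elim: s a b => [|r s IH] a b ab sub cov dis.
  move: ab; rewrite le_eqVlt => /predU1P[->//|ab].
  pose m := (a + b) / 2; have mab : a < m < b by rewrite /m; lra.
  have leab t : a < t < b -> a <= t <= b by move=> /andP[? ?]; rewrite !ltW.
  have [Pm|Qm] := cov m (leab _ mab).
    have [] // := clP gamma a b ab => t tab.
    apply: (h1 a b _ m t mab tab Pm) => r rs /[dup] rab.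
    by move/(sub r); rewrite mem_cat rs => /(_ isT).
  have [|Qa Qb] := clQ gamma a b ab => [t tab|].
    apply: (h2 a b _ m t mab tab Qm) => r rs /[dup] rab.
    by move/(sub r); rewrite mem_cat rs orbT => /(_ isT).
  by split=> [Pa|Pb]; [case: (dis a)|case: (dis b)]; rewrite ?lexx ?(ltW ab).
have [/andP[ar rb]|nrab] := boolP (a < r < b); last first.
  apply: IH => // r' r's r'ab; have := sub r' r's r'ab.
  by rewrite in_cons => /predU1P[e|//]; rewrite -e r'ab in nrab.
transitivity (sc_set P (path_at gamma r)); apply: IH; rewrite ?ltW //.
- move=> r' r's /andP[ar' r'r]; have := sub r' r's.
  by rewrite ar' (lt_trans r'r) // in_cons (lt_eqF r'r) => /(_ isT).
- by move=> t /andP[h h']; apply: cov; rewrite h (le_trans h') // ltW.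
- by move=> t /andP[h h']; apply: dis; rewrite h (le_trans h') // ltW.
- move=> r' r's /andP[ar' r'r]; have := sub r' r's.
  by rewrite r'r (lt_trans ar) // in_cons (gt_eqF ar') => /(_ isT).
- by move=> t /andP[h h']; apply: cov; rewrite h' (le_trans _ h) // ltW.
- by move=> t /andP[h h']; apply: dis; rewrite h' (le_trans _ h) // ltW.
Qed.

Lemma path_connected_split (E : set 'rV[R]_n) (P Q : sign_condition R n) :
  path_connected E -> path_closed (sc_set P) -> path_closed (sc_set Q) ->
  E `<=` sc_set P `|` sc_set Q -> E `&` (sc_set P `&` sc_set Q) = set0 ->
  forall x y, E x -> E y -> sc_set P x -> ~ sc_set Q y.
Proof.
move=> cE clP clQ cov dis x y Ex Ey Px Qy.
have dis' z : E z -> ~ (sc_set P z /\ sc_set Q z).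
  by move=> Ez PQz; have : set0 z by rewrite -dis.
apply: (dis' y Ey); split=> //; apply: cE Ex Ey Px => gamma a b ab Eg.
by apply: (path_split clP clQ) => // t /Eg; [exact: cov|exact: dis'].
Qed.

Lemma near_all (I : eqType) (s : seq I) (Q : I -> R -> Prop) b :
  (forall k, k \in s -> exists2 d, 0 < d & forall t, `|t - b| < d -> Q k t) ->
  exists2 d, 0 < d & forall t, `|t - b| < d -> forall k, k \in s -> Q k t.
Proof.
elim: s => [|k s IH] h; first by exists 1.
have [|d d0 dP] := IH; first by move=> k' k's; apply: h; rewrite in_cons k's orbT.
have [e e0 eP] := h k (mem_head _ _); exists (Num.min d e); first by rewrite lt_min d0.
move=> t; rewrite lt_min => /andP[td te] k' /predU1P[->|]; first exact: eP.
exact: dP.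
Qed.

Lemma approach_ends a b d : a < b -> 0 < d ->
  (exists2 t, a < t < b & `|t - b| < d) /\ (exists2 t, a < t < b & `|t - a| < d).
Proof.
move=> ab d0; pose m := Num.min d (b - a) / 2.
have m0 : 0 < m by rewrite divr_gt0 // lt_min d0 subr_gt0.
have md : m < d.
  have : Num.min d (b - a) <= d by rewrite ge_min lexx.
  by rewrite /m in m0 *; lra.
have mba : m < b - a.
  have : Num.min d (b - a) <= b - a by rewrite ge_min lexx orbT.
  by rewrite /m in m0 *; lra.
split; [exists (b - m)|exists (a + m)].
- by apply/andP; split; lra.
- by rewrite addrAC subrr add0r normrN gtr0_norm.
- by apply/andP; split; lra.
- by rewrite addrAC subrr add0r gtr0_norm.
Qed.

Lemma closed_path_closed (E : set 'rV[R]_n) : closed E -> path_closed E.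
Proof.
move=> /closure_id clE gamma a b ab Eg.
have near c B : nbhs (path_at gamma c) B ->
    exists2 d, 0 < d & forall t, `|t - c| < d -> B (path_at gamma t).
  move=> /nbhs_ballP[e /= e0 eB].
  have [j _|d d0 dP] := @near_all _ (enum 'I_n)
      (fun j t => `|(gamma j).[c] - (gamma j).[t]| < e) c.
    have [d d0 dP] := poly_cont c (gamma j) e0.
    by exists d => // t /dP; rewrite distrC.
  exists d => // t /dP h; apply: eB; split=> // i j.
  by rewrite !mxE; apply: h; rewrite mem_enum.
split; rewrite clE => B /near[d d0 dB].
  have [_ [t tab /dB Bt]] := approach_ends ab d0; exists (path_at gamma t).
  by split=> //; exact: Eg.
have [[t tab /dB Bt] _] := approach_ends ab d0; exists (path_at gamma t).
by split=> //; exact: Eg.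
Qed.

Lemma sc_not_any_pos_path_closed (l : seq (seq A)) :
  path_closed (sc_set (SNot (sc_any (@sc_pos R n) l))).
Proof.
move=> gamma a b ab Eg.
have near c : sc_set (sc_any (@sc_pos R n) l) (path_at gamma c) ->
    exists2 d, 0 < d & forall t, `|t - c| < d ->
      sc_set (sc_any (@sc_pos R n) l) (path_at gamma t).
  move=> /sc_anyP[s sl /sc_posP sc].
  have [f fs|d d0 dP] := @near_all _ s (fun f t => 0 < f.@[path_at gamma t 0]) c.
    have f0 : 0 < (path_comp gamma f).[c] by rewrite horner_path_comp sc.
    have [d d0 dP] := poly_cont c (path_comp gamma f) f0.
    exists d => // t /dP; rewrite horner_path_comp ltr_distl => /andP[+ _].
    by rewrite subrr.
  exists d => // t /dP h; apply/sc_anyP; exists s => //; exact/sc_posP.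
split=> /= /near[d d0 dB].
  by have [_ [t tab /dB Bt]] := approach_ends ab d0; exact: (Eg t tab Bt).
by have [[t tab /dB Bt] _] := approach_ends ab d0; exact: (Eg t tab Bt).
Qed.

(** Compactness shrinks the two pieces of a splitting to finite unions of basic open sets, that is,
    to sign conditions [P] and [Q]. Each of them has a point in R^n, while covering and disjointness
    hold on R^n because a point of R^n defines a point of the spectrum. *)
Lemma basic_open_connected (L : seq A) :
  path_connected (pos_set L) -> connected (basic_open L : set (sper A)).
Proof.
move=> pcL; apply: contrapT => ncL.
have [U [V [oU oV [cov dis [a La Ua] [b Lb Vb]]]]] : exists U V : set (sper A), [/\ open U, open V &
    [/\ basic_open L `<=` U `|` V, basic_open L `&` (U `&` V) = set0,
        exists2 a, basic_open L a & U a & exists2 b, basic_open L b & V b]].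
  apply: contrapT => nUV; apply: ncL => B [a Ba] [U oU BU] [D cD BD].
  apply/seteqP; split=> [d|b Lb]; first by rewrite BU => -[].
  apply: contrapT => nBb; apply: nUV; exists U, (~` D); split; first exact: oU.
    exact: closed_openC.
  split.
  - move=> d Ld; have [Dd|Dd] := pselect (D d); last by right.
    have : B d by rewrite BD.
    by rewrite BU => -[_ Ud]; left.
  - apply/seteqP; split=> // d [Ld [Ud nDd]]; apply: nDd.
    have : B d by rewrite BU.
    by rewrite BD => -[].
  - by exists a; move: Ba; rewrite BU => -[].
  - by exists b => // Db; apply: nBb; rewrite BD.
have opn (W : set (sper A)) : open W ->
    exists S : set (seq A), W = \bigcup_(s in S) @basic_open A s.
  by move=> [S _ SE]; exists S; rewrite -SE.
have [SU UE] := opn U oU; have [SV VE] := opn V oV.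
have [l [lS lcov]] : exists l : seq (seq A), (forall s, s \in l -> (SU `|` SV) s) /\
    basic_open L `<=` \bigcup_(s in [set s | s \in l]) @basic_open A s.
  apply: basic_open_compact => d Ld; have := cov d Ld; rewrite UE VE.
  by move=> [[s Ss sd]|[s Ss sd]]; exists s => //; [left|right].
pose lU := [seq s <- l | `[< SU s >]]; pose lV := [seq s <- l | `[< SV s >]].
pose P := sc_any (@sc_pos R n) lU; pose Q := sc_any (@sc_pos R n) lV.
have PU d : sc_sper P d -> U d.
  move=> /sc_any_sperP[s]; rewrite mem_filter => /andP[/asboolP Ss _] /sc_pos_sperP sd.
  by rewrite UE; exists s.
have QV d : sc_sper Q d -> V d.
  move=> /sc_any_sperP[s]; rewrite mem_filter => /andP[/asboolP Ss _] /sc_pos_sperP sd.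
  by rewrite VE; exists s.
have covPQ d : basic_open L d -> sc_sper P d \/ sc_sper Q d.
  move=> /lcov[s /= sl sd]; have [Ss|Ss] := lS s sl; [left|right];
    apply/sc_any_sperP; exists s; rewrite ?mem_filter ?sl ?andbT;
    by [apply/asboolP|apply/sc_pos_sperP].
have disPQ d : basic_open L d -> ~ (sc_sper P d /\ sc_sper Q d).
  by move=> Ld [/PU Ud /QV Vd]; have : set0 d by rewrite -dis.
have point x : exists d : sper A, (pos_set L x <-> basic_open L d) /\
    forall W : sign_condition R n, sc_set W x <-> sc_sper W d.
  have [d dP] := sper_point x; exists d.
  split; last by move=> W; apply: sc_set_sper => f _; exact: dP.
  have e f : (0 < f.@[x 0]) = (0 < sper_ev d f) by rewrite -sgz_gt0 dP sgz_gt0.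
  by split=> h f fL; [rewrite -e|rewrite e]; exact: h.
have Qb : sc_sper Q b.
  by have [/PU Ub|//] := covPQ b Lb; have : set0 b by rewrite -dis.
have Pa : sc_sper P a.
  by have [//|/QV Va] := covPQ a La; have : set0 a by rewrite -dis.
have [x Lx Px] := constructible_point La Pa.
have [y Ly Qy] := constructible_point Lb Qb.
have disR z : pos_set L z -> ~ (sc_set P z /\ sc_set Q z).
  have [d [dL dW]] := point z => /dL Ld [/dW h1 /dW h2].
  exact: disPQ Ld (conj h1 h2).
(* [P] and [Q] are complementary on [L], so each is there the negation of the other, and the
   negations are closed along paths. *)
apply: (@path_connected_split (pos_set L) (SNot Q) (SNot P) pcL _ _ _ _ x y) => //.
- exact: sc_not_any_pos_path_closed.
- exact: sc_not_any_pos_path_closed.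
- move=> z Lz; have [hP|hP] := pselect (sc_set P z); last by right.
  by left=> hQ; exact: (disR z Lz).
- apply/seteqP; split=> // z [Lz [nQ nP]].
  have [d [dL dW]] := point z.
  by have [/dW|/dW] := covPQ d (dL.1 Lz).
- by move=> hQ; exact: (disR x Lx).
by move=> hP; exact: (disR y Ly).
Qed.

End Paths.

(** * The separating ideal *)

Section SeparatingIdealTheory.
Variables (A : comNzRingType) (alpha beta : sper A).
Local Notation I := (separating_ideal alpha beta).
Implicit Types f g h z : A.

Lemma separating_ideal_gen f :
  0 <= sper_ev alpha f -> sper_ev beta f <= 0 -> I f.
Proof.
move=> fa fb; exists 1%N, (fun=> 1), (fun=> f); split=> //.
by rewrite big_ord1 mul1r.
Qed.

Lemma separating_ideal0 : I 0.
Proof. by apply: separating_ideal_gen; rewrite rmorph0. Qed.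

Lemma separating_idealD f g : I f -> I g -> I (f + g).
Proof.
move=> [k [u [a [aS ->]]]] [l [v [b [bS ->]]]].
exists (k + l)%N, (fun i => match split i with inl j => u j | inr j => v j end),
  (fun i => match split i with inl j => a j | inr j => b j end).
split; first by move=> i; case: split.
rewrite big_split_ord /=; congr (_ + _); apply: eq_bigr => i _.
  by rewrite (unsplitK (inl i : 'I_k + 'I_l)).
by rewrite (unsplitK (inr i : 'I_k + 'I_l)).
Qed.

Lemma separating_idealN f : I f -> I (- f).
Proof.
move=> [k [u [a [aS ->]]]]; exists k, (fun i => - u i), a; split=> //.
by rewrite -sumrN; apply: eq_bigr => i _; rewrite mulNr.
Qed.

Lemma separating_idealB f g : I f -> I g -> I (f - g).
Proof. by move=> hf hg; apply: separating_idealD => //; exact: separating_idealN. Qed.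

(* The separating ideal is a valuation ideal: with w = z^2 + 1 >= |z|, both w f
   and w f - g (or g itself) are generators. *)
Lemma separating_ideal_convex f g z :
  0 <= sper_ev alpha f -> sper_ev beta f <= 0 ->
  `|sper_ev alpha g| <= sper_ev alpha z * sper_ev alpha f -> I g.
Proof.
move=> fa fb.
suff pos h : 0 <= sper_ev alpha h ->
    sper_ev alpha h <= sper_ev alpha z * sper_ev alpha f -> I h.
  move=> gz; have [ga|ga] := leP 0 (sper_ev alpha g).
    by apply: pos => //; rewrite -(ger0_norm ga).
  rewrite -[g]opprK; apply: separating_idealN; apply: pos.
    by rewrite rmorphN oppr_ge0 ltW.
  by rewrite rmorphN -(ltr0_norm ga).
move=> ha hz; have [hb|hb] := leP (sper_ev beta h) 0; first exact: separating_ideal_gen.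
pose F := (z ^+ 2 + 1) * f.
have wz (d : sper A) : sper_ev d z <= sper_ev d (z ^+ 2 + 1).
  rewrite rmorphD rmorphXn rmorph1 /=; set y := sper_ev d z.
  have [y1|y1] := leP y 1; first by rewrite (le_trans y1) // lerDr sqr_ge0.
  by rewrite ler_wpDr // expr2 ler_peMl ?ltW // (lt_trans ltr01).
have w0 (d : sper A) : 0 <= sper_ev d (z ^+ 2 + 1).
  by rewrite rmorphD rmorphXn rmorph1 addr_ge0 ?sqr_ge0.
have Fa : 0 <= sper_ev alpha F by rewrite rmorphM /= mulr_ge0 //; exact: w0.
have Fb : sper_ev beta F <= 0 by rewrite rmorphM /= mulr_ge0_le0 //; exact: w0.
rewrite -(subKr F h); apply: separating_idealB; first exact: separating_ideal_gen.
apply: separating_ideal_gen; rewrite rmorphB.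
  by rewrite subr_ge0 (le_trans hz) // rmorphM /= ler_wpM2r //; exact: wz.
by rewrite subr_le0 (le_trans Fb) // ltW.
Qed.

End SeparatingIdealTheory.

Lemma separating_ideal_sym (A : comNzRingType) (alpha beta : sper A) f :
  separating_ideal alpha beta f -> separating_ideal beta alpha f.
Proof.
move=> [k [u [a [aS ->]]]]; exists k, (fun i => - u i), (fun i => - a i).
split; last by apply: eq_bigr => i _; rewrite mulrNN.
by move=> i; have [h1 h2] := aS i; rewrite /= !rmorphN oppr_ge0 oppr_le0.
Qed.

(** * From a separating region to the two conclusions *)

Section Separation.
Variables (R : rcfType) (n : nat) (alpha beta : sper {mpoly R[n]}).
Local Notation A := {mpoly R[n]}.

(** The common source of both conclusions: [basic_open L] is the connected set of the first, and the
    paths between the R-points of [L] give the second. *)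
Definition separated_by_paths : Prop := forall gs : seq A,
  {in gs, forall g, ~ separating_ideal alpha beta g} ->
  exists L : seq A, [/\ basic_open L alpha, basic_open L beta,
    path_connected (pos_set L) &
    forall delta, basic_open L delta -> {in gs, forall g, sper_ev delta g != 0}].

Hypothesis sep : separated_by_paths.

Lemma separated_connected (s : nat) (g : 'I_s -> A) :
  (forall i, ~ separating_ideal alpha beta (g i)) ->
  exists C : set (sper A), [/\ connected C, C alpha, C beta &
    forall i, C `&` sper_zeros (g i) = set0].
Proof.
move=> gI; have [|L [La Lb pc Lg]] := sep (gs := map g (enum 'I_s)).
  by move=> _ /mapP[i _ ->].
exists (basic_open L); split=> //; first exact: basic_open_connected.
move=> i; apply/seteqP; split=> // d [Ld /eqP]; apply/negP; apply: Lg Ld _ _.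
by apply: map_f; rewrite mem_enum.
Qed.

Lemma sc_any_closed (I : eqType) (F : I -> sign_condition R n) (s : seq I) :
  (forall k, closed (sc_set (F k))) -> closed (sc_set (sc_any F s)).
Proof.
move=> h; elim: s => [|k s IH]; last exact: closedU.
rewrite (_ : sc_set _ = set0); first exact: closed0.
by apply/seteqP; split=> // x /=; rewrite meval0 ltxx.
Qed.

(** The argument takes place in R^n, where the pieces are known to be closed. Pieces of both
    presentations are sorted by whether their polynomial is congruent to [fa] modulo the ideal.
    Differences across the two classes lie outside the ideal, so a region where none of them
    vanishes is split by the two unions: at a common point both polynomials would equal f. If
    [fa - fb] were outside the ideal, the region would meet both unions. *)
Lemma separated_pierce_birkhoff (f : 'rV[R]_n -> R) (fa fb : A) :
  local_representative f alpha fa -> local_representative f beta fb ->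
  separating_ideal alpha beta (fa - fb).
Proof.
move=> [k [P [p [[clP covP fP] [i [Pi ->]]]]]] [k' [P' [p' [[clP' covP' fP'] [i' [Pi' ->]]]]]].
pose J : eqType := ('I_k + 'I_k')%type.
pose F (j : J) := match j with inl u => P u | inr u => P' u end.
pose q (j : J) := match j with inl u => p u | inr u => p' u end.
have clF j : closed (sc_set (F j)) by case: j.
have fF j x : sc_set (F j) x -> f x = (q j).@[x 0] by case: j => u; [exact: fP|exact: fP'].
pose js : seq J := enum {: 'I_k + 'I_k'}.
have jsT j : j \in js by rewrite mem_enum.
pose near (j : J) := `[< separating_ideal alpha beta (q j - p i) >].
pose js1 := [seq j <- js | near j]; pose js2 := [seq j <- js | ~~ near j].
apply: contrapT => nab.
have n1 : inl i \in js1.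
  rewrite mem_filter jsT andbT; apply/asboolP; rewrite /= subrr.
  exact: separating_ideal0.
have n2 : inr i' \in js2.
  rewrite mem_filter jsT andbT; apply/asboolPn => /= h; apply: nab.
  by rewrite -opprB; exact: separating_idealN.
have [|L [La Lb pc Lg]] := sep (gs := [seq q j1 - q j2 | j1 <- js1, j2 <- js2]).
  move=> _ /allpairsP[[j1 j2] [/= h1 h2 ->]] h; move: h1 h2.
  rewrite !mem_filter => /andP[/asboolP h1 _] /andP[/asboolPn h2 _]; apply: h2.
  have -> : q j2 - p i = (q j1 - p i) - (q j1 - q j2).
    by rewrite opprB [RHS]addrC subrKA.
  exact: separating_idealB.
have [x Lx Px] : exists2 x, pos_set L x & sc_set (sc_any F js1) x.
  by apply: constructible_point La _; apply/sc_any_sperP; exists (inl i).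
have [y Ly Py] : exists2 x, pos_set L x & sc_set (sc_any F js2) x.
  by apply: constructible_point Lb _; apply/sc_any_sperP; exists (inr i').
apply: (path_connected_split pc _ _ _ _ Lx Ly Px Py).
- apply: closed_path_closed; apply: sc_any_closed; exact: clF.
- apply: closed_path_closed; apply: sc_any_closed; exact: clF.
- move=> z _; have [u _ Pz] : (\bigcup_u sc_set (P u)) z by rewrite covP.
  have [h|h] := boolP (near (inl u)); [left|right]; apply/sc_anyP;
    by exists (inl u); rewrite // mem_filter h jsT.
apply/seteqP; split=> // z [Lz [/sc_anyP[j1 h1 Fz1] /sc_anyP[j2 h2 Fz2]]].
have [d dP] := sper_point z.
have Ld : basic_open L d by move=> g gL; rewrite -sgz_gt0 -dP sgz_gt0 Lz.
have := Lg d Ld _ (allpairs_f (fun j1 j2 => q j1 - q j2) h1 h2).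
rewrite -sgz_eq0 -dP sgz_eq0 => /eqP[].
by rewrite mevalB -(fF _ _ Fz1) -(fF _ _ Fz2) subrr.
Qed.

End Separation.

(** * Regions defined by monomial inequalities *)

Section Weights.

Lemma exists_lt_all (F : realFieldType) (us : seq F) (l : F) :
  {in us, forall u, l < u} -> exists2 z, l < z & {in us, forall u, z < u}.
Proof.
elim: us => [|u us IH] h; first by exists (l + 1) => //; rewrite ltrDl.
have [|z lz zus] := IH; first by move=> v vus; apply: h; rewrite in_cons vus orbT.
have lu := h u (mem_head _ _).
exists (Num.min z ((l + u) / 2)); first by rewrite lt_min lz; lra.
move=> v /predU1P[->|vus]; rewrite gt_min; last by rewrite zus.
by apply/orP; right; lra.
Qed.

Lemma exists_between (F : realFieldType) (ls us : seq F) :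
  {in ls & us, forall l u, l < u} ->
  exists z, {in ls, forall l, l < z} /\ {in us, forall u, z < u}.
Proof.
elim: ls => [|l ls IH] h.
  elim: us {h} => [|u us [z [_ zP]]]; first by exists 0.
  exists (Num.min z (u - 1)); split=> // v /predU1P[->|vus]; rewrite gt_min.
    by rewrite ltrBlDr ltrDl ltr01 orbT.
  by rewrite zP.
have [|z [zl zu]] := IH; first by move=> l' u l'ls uus; apply: h; rewrite ?in_cons ?l'ls ?orbT.
have [zl'|zl'] := ltP l z.
  by exists z; split=> // l' /predU1P[->|/zl].
have [|z' lz' zu'] := @exists_lt_all _ us l; first by move=> u uus; apply: h; rewrite ?mem_head.
exists z'; split=> // l' /predU1P[->//|/zl h']; exact: lt_trans (lt_le_trans h' zl') lz'.
Qed.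

(* Fourier-Motzkin elimination of the last coordinate. *)
Lemma positive_functional n (P : (nat -> int) -> Prop) (J : eqType) (s : seq J)
    (D : J -> nat -> int) :
  (forall d e, P d -> P e -> P (fun k => d k + e k)) ->
  (forall d, P d -> exists2 k, (k < n)%N & d k != 0) ->
  {in s, forall j, P (D j)} ->
  exists w : nat -> rat, {in s, forall j, 0 < \sum_(k < n) w k * (D j k)%:~R}.
Proof.
elim: n P J s D => [|n IH] P J s D PD Pn0 sP.
  by exists (fun=> 0) => j /sP /Pn0[].
have PZ (c : nat) d : P d -> P (fun k => c.+1%:Z * d k).
  move=> Pd; elim: c => [|c IHc].
    by rewrite (_ : (fun k => _) = d) //; apply: funext => k; rewrite mul1r.
  have := PD _ _ Pd IHc; congr P; apply: funext => k.
  by rewrite -{1}[d k]mul1r -mulrDl -PoszD.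
have PZ' (c : int) d : 0 < c -> P d -> P (fun k => c * d k).
  by case: c => // -[//|c] _; exact: PZ.
(* For [D p n > 0 > D q n] this is a positive combination of the two vectors whose n-th coordinate
   cancels. *)
pose comb p q : nat -> int := fun k => - D q n * D p k + D p n * D q k.
pose D' (j : J + J * J) := match j with inl j => D j | inr pq => comb pq.1 pq.2 end.
pose sp := [seq j <- s | 0 < D j n]; pose sm := [seq j <- s | D j n < 0].
pose s' : seq (J + J * J) := [seq inl j | j <- s & D j n == 0] ++
  [seq inr (p, q) | p <- sp, q <- sm].
have [||j|w' w'P] := IH (fun d => P d /\ d n = 0) _ s' D'.
- by move=> d e [Pd d0] [Pe e0]; split; [exact: PD|rewrite d0 e0].
- move=> d [Pd d0]; have [k kn dk] := Pn0 d Pd; exists k => //.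
  by move: kn; rewrite ltnS leq_eqVlt => /predU1P[e|//]; rewrite e d0 eqxx in dk.
- rewrite mem_cat => /orP[/mapP[i + ->]|/allpairsP[[p q] [/= + + ->]]] /=.
    by rewrite mem_filter => /andP[/eqP i0 /sP].
  rewrite !mem_filter => /andP[p0 /sP Pp] /andP[q0 /sP Pq]; split.
    by apply: PD; apply: PZ' => //; rewrite oppr_gt0.
  by rewrite /comb mulrC mulrN addNr.
pose S (d : nat -> int) := \sum_(k < n) w' k * (d k)%:~R.
have Scomb p q :
    S (comb p q) = - (D q n)%:~R * S (D p) + (D p n)%:~R * S (D q).
  rewrite /S !mulr_sumr -big_split /=; apply: eq_bigr => k _.
  by rewrite /comb rmorphD /= !rmorphM rmorphN /= mulrDr !(mulrCA (w' k)).
(* Vectors with positive n-th coordinate bound the new weight from below, those with negative one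
   from above. The bounds are compatible exactly because [S] is positive on the combinations. *)
have [|z [zl zu]] := @exists_between _ [seq - S (D p) / (D p n)%:~R | p <- sp]
    [seq S (D q) / (- (D q n)%:~R) | q <- sm].
  move=> _ _ /mapP[p psp ->] /mapP[q qsm ->].
  have p0 : 0 < (D p n)%:~R :> rat by move: psp; rewrite mem_filter ltr0z => /andP[].
  have q0 : (D q n)%:~R < 0 :> rat by move: qsm; rewrite mem_filter ltrz0 => /andP[].
  have : 0 < S (comb p q).
    apply: (w'P (inr (p, q))); rewrite mem_cat; apply/orP; right.
    by apply/allpairsP; exists (p, q).
  rewrite Scomb ltr_pdivrMr // mulrAC ltr_pdivlMr ?oppr_gt0 //; lra.
exists (fun k => if (k < n)%N then w' k else z) => j js.
rewrite big_ord_recr /= ltnn (eq_bigr (fun k : 'I_n => w' k * (D j k)%:~R)); last first.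
  by move=> k _; rewrite ltn_ord.
rewrite -/(S (D j)); have [jn|jn|jn] := ltgtP (D j n) 0.
- have /zu : S (D j) / (- (D j n)%:~R) \in [seq S (D q) / (- (D q n)%:~R) | q <- sm].
    by apply: map_f; rewrite mem_filter jn js.
  have jn' : (D j n)%:~R < 0 :> rat by rewrite ltrz0.
  by rewrite ltr_pdivlMr ?oppr_gt0 //; lra.
- have /zl : - S (D j) / (D j n)%:~R \in [seq - S (D p) / (D p n)%:~R | p <- sp].
    by apply: map_f; rewrite mem_filter jn js.
  have jn' : 0 < (D j n)%:~R :> rat by rewrite ltr0z.
  by rewrite ltr_pdivrMr //; lra.
rewrite jn mulr0 addr0; apply: (w'P (inl j)).
by rewrite mem_cat map_f // mem_filter jn eqxx.
Qed.

Lemma common_denominator n (w : nat -> rat) : exists2 c : int, 0 < c &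
  forall k, (k < n)%N -> exists z : int, w k * c%:~R = z%:~R.
Proof.
elim: n => [|n [c c0 cP]]; first by exists 1.
exists (c * denq (w n)); first by rewrite mulr_gt0.
move=> k; rewrite ltnS leq_eqVlt => /predU1P[->|/cP[z zP]].
  exists (numq (w n) * c); rewrite !rmorphM /= mulrCA mulrC numqE; lra.
by exists (z * denq (w n)); rewrite !rmorphM /= mulrA zP.
Qed.

Lemma monomial_weights n (P : ('I_n -> int) -> Prop)
    (s : seq ('X_{1..n} * 'X_{1..n})) :
  (forall d e, P d -> P e -> P (fun k => d k + e k)) -> ~ P (fun=> 0) ->
  (forall j, P (fun k => (k == j)%:Z)) ->
  (forall mm, mm \in s -> P (fun k => (mm.2 k)%:Z - (mm.1 k)%:Z)) ->
  exists wt : 'I_n -> nat,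
    forall mm, mm \in s -> (\sum_k wt k * mm.1 k < \sum_k wt k * mm.2 k)%N.
Proof.
move=> PD P0 Pdelta sP.
(* The pairs (1, x_j) force every weight to be positive, so after clearing denominators the weights
   are natural numbers. *)
pose s' := [seq (0%MM, U_(j)%MM) | j <- enum 'I_n] ++ s.
pose D (mm : 'X_{1..n} * 'X_{1..n}) (k : nat) : int :=
  if insub k is Some j then (mm.2 j)%:Z - (mm.1 j)%:Z else 0.
have DE mm (k : 'I_n) : D mm k = (mm.2 k)%:Z - (mm.1 k)%:Z by rewrite /D valK.
have s'P mm : mm \in s' -> P (fun k : 'I_n => D mm k).
  rewrite mem_cat => /orP[/mapP[j _ ->]|/sP].
    have := Pdelta j; congr P; apply: funext => k.
    by rewrite DE mnm0E mnmE subr0 eq_sym.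
  by congr P; apply: funext => k; rewrite DE.
have [|| w wP] := @positive_functional n (fun d => P (fun k : 'I_n => d k)) _ s' D _ _ s'P.
- by move=> d e; exact: PD.
- move=> d Pd; apply: contrapT => h; apply: P0; move: Pd; congr P.
  apply: funext => k; apply: contrapT => /eqP dk; apply: h; exists k => //.
have [c c0 cP] := common_denominator n w.
have wZ (k : 'I_n) : {z : int | w k * c%:~R = z%:~R}.
  exact: cid (cP k (ltn_ord k)).
have pos mm : mm \in s' -> 0 < \sum_(k < n) sval (wZ k) * ((mm.2 k)%:Z - (mm.1 k)%:Z).
  move=> /wP h; rewrite -(ltr0z rat) rmorph_sum /=.
  have : 0 < (\sum_(k < n) w k * (D mm k)%:~R) * c%:~R by rewrite mulr_gt0 // ltr0z.
  congr (_ < _); rewrite mulr_suml; apply: eq_bigr => k _.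
  by rewrite rmorphM /= -(svalP (wZ k)) DE mulrAC.
have zpos k : 0 < sval (wZ k).
  have : (0%MM, U_(k)%MM) \in s' by rewrite mem_cat map_f ?mem_enum.
  move=> /pos; rewrite (bigD1 k) //= big1 => [|i ik].
    by rewrite mnm0E mnm1E eqxx subr0 addr0 mulr1.
  by rewrite mnm0E mnm1E eq_sym (negPf ik) subr0 mulr0.
have absE k : `|sval (wZ k)|%N%:Z = sval (wZ k) by rewrite gtz0_abs.
exists (fun k => `|sval (wZ k)|%N) => mm mms.
have : mm \in s' by rewrite mem_cat mms orbT.
move=> /pos; rewrite (eq_bigr (fun k => sval (wZ k) * (mm.2 k)%:Z -
  sval (wZ k) * (mm.1 k)%:Z)) => [|k _]; last by rewrite mulrBr.
rewrite sumrB subr_gt0 -ltz_nat => h.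
have sumE (m : 'X_{1..n}) : (\sum_k `|sval (wZ k)| * m k)%N%:Z =
    \sum_k sval (wZ k) * (m k)%:Z.
  rewrite (big_morph Posz PoszD (erefl _)); apply: eq_bigr => k _.
  by rewrite PoszM absE.
by rewrite !sumE.
Qed.

End Weights.

(** * Regions that are joined by paths through the weighted flow *)

Section MonomialRegion.
Variables (R : rcfType) (n : nat) (good : pred 'I_n) (sigma : 'I_n -> R).
Variable qs : seq ((R * R) * ('X_{1..n} * 'X_{1..n})).
Variable wt : 'I_n -> nat.
Hypothesis wt_lt : forall q, q \in qs ->
  (\sum_k wt k * q.2.1 k < \sum_k wt k * q.2.2 k)%N.
Hypothesis q_neq0 : forall q, q \in qs -> q.1.1 != 0.
Hypothesis q_good : forall q, q \in qs -> forall k, (0 < q.2.1 k)%N -> good k.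

Definition monomial_at (m : 'X_{1..n}) (x : 'I_n -> R) : R := \prod_k x k ^+ m k.

(** An entry ((r0, r), (m0, m)) of [qs] stands for |r x^m| < |r0 x^m0|; squares make this a
    polynomial condition. *)
Definition monomial_region : set 'rV[R]_n := [set x |
  (forall k, good k -> 0 < sigma k * x 0 k) /\
  forall q, q \in qs ->
    (q.1.2 * monomial_at q.2.2 (x 0)) ^+ 2 < (q.1.1 * monomial_at q.2.1 (x 0)) ^+ 2].

Definition weighted_scale (l : R) (x : 'rV[R]_n) : 'rV[R]_n :=
  \row_k (l ^+ wt k * x 0 k).

Lemma monomial_at_scale m (l : R) (x : 'rV[R]_n) : monomial_at m (weighted_scale l x 0) =
  l ^+ (\sum_k wt k * m k) * monomial_at m (x 0).
Proof.
rewrite /monomial_at expr_sum -big_split /=; apply: eq_bigr => k _.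
by rewrite mxE exprMn exprM.
Qed.

(* A factor l^(2 w.m) with w.m > w.m0 can be traded for l * l^(2 w.m0). *)
Lemma region_scale (l : R) (x : 'rV[R]_n) : 0 < l <= 1 ->
  (forall k, good k -> 0 < sigma k * x 0 k) ->
  (forall q, q \in qs -> l * (q.1.2 * monomial_at q.2.2 (x 0)) ^+ 2 <
    (q.1.1 * monomial_at q.2.1 (x 0)) ^+ 2) ->
  monomial_region (weighted_scale l x).
Proof.
move=> /andP[l0 l1] xg xq; split=> [k gk|q qqs].
  by rewrite mxE mulrCA mulr_gt0 ?exprn_gt0 ?xg.
rewrite !monomial_at_scale !(mulrCA _ (l ^+ _)) !(exprMn _ (l ^+ _)) -!exprM.
set e := (\sum_k _ * q.2.2 k)%N; set e0 := (\sum_k _)%N.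
have e0e : ((e0 * 2).+1 <= e * 2)%N by have := wt_lt qqs; rewrite -/e -/e0; lia.
have le : l ^+ (e * 2) <= l * l ^+ (e0 * 2) by rewrite -exprS ler_wiXn2l // ltW.
apply: le_lt_trans (_ : l * l ^+ (e0 * 2) * (q.1.2 * monomial_at q.2.2 (x 0)) ^+ 2 < _).
  by rewrite ler_wpM2r // sqr_ge0.
by rewrite (mulrC l) -mulrA ltr_pM2l ?exprn_gt0 ?xq.
Qed.

Lemma small_factor (J : eqType) (s : seq J) (a b : J -> R) :
  (forall j, j \in s -> 0 <= a j /\ 0 < b j) ->
  exists2 l, 0 < l <= 1 & forall j, j \in s -> l * a j < b j.
Proof.
elim: s => [|j s IH] h; first by exists 1; rewrite ?ltr01 ?lexx.
have [|l /andP[l0 l1] lP] := IH; first by move=> i si; apply: h; rewrite in_cons si orbT.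
have [a0 b0] := h j (mem_head _ _).
(* The summand b j in the denominator covers the case a j = 0 and makes the inequality strict. *)
pose c := b j / (a j + b j).
have ab0 : 0 < a j + b j by rewrite ltr_wpDl.
have c0 : 0 < c by rewrite divr_gt0.
exists (Num.min l c); first by rewrite lt_min l0 c0 ge_min l1.
move=> i si; have ca : c * a j < b j.
  by rewrite /c mulrAC ltr_pdivrMr // ltr_pM2l // ltrDl.
case/predU1P: si => [->|si].
  by apply: le_lt_trans ca; rewrite ler_wpM2r // ge_min lexx orbT.
have [ai _] : 0 <= a i /\ 0 < b i by apply: h; rewrite in_cons; apply/orP; right.
by apply: le_lt_trans (lP i si); rewrite ler_wpM2r // ge_min lexx.
Qed.

Lemma monomial_region_path_connected : path_connected monomial_region.
Proof.
move=> Q inv x y Ex Ey Qx.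
pose z t : 'rV[R]_n := \row_k ((1 - t) * x 0 k + t * y 0 k).
(* [M] bounds the squared coordinates along the segment from above. For good k the ends have the
   same sign, so [mu] is a positive lower bound. Leading monomials involve good variables only, so
   one l works for the whole segment. *)
pose M k := (`|x 0 k| + `|y 0 k|) ^+ 2.
pose mu k := Num.min (`|x 0 k|) (`|y 0 k|) ^+ 2.
have zM t k : 0 <= t <= 1 -> z t 0 k ^+ 2 <= M k.
  move=> /andP[t0 t1]; rewrite -real_normK ?num_real // /M ler_pXn2r ?nnegrE ?addr_ge0 //.
  rewrite mxE (le_trans (ler_normD _ _)) // !normrM (ger0_norm t0) ger0_norm ?subr_ge0 //.
  by rewrite lerD // ler_piMl //; lra.
have Eg k : good k -> (0 < x 0 k /\ 0 < y 0 k) \/ (x 0 k < 0 /\ y 0 k < 0).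
  move=> gk; have sx := Ex.1 k gk; have sy := Ey.1 k gk.
  have [s0|s0|s0] := ltgtP (sigma k) 0; last by move: sx; rewrite s0 mul0r ltxx.
    by right; rewrite -(nmulr_rgt0 (x 0 k) s0) -(nmulr_rgt0 (y 0 k) s0).
  by left; rewrite -(pmulr_rgt0 (x 0 k) s0) -(pmulr_rgt0 (y 0 k) s0).
have zmu t k : 0 <= t <= 1 -> good k -> mu k <= z t 0 k ^+ 2.
  move=> /andP[t0 t1] gk; rewrite -[leRHS]real_normK ?num_real //.
  rewrite /mu ler_pXn2r ?nnegrE ?le_min ?normr_ge0 //.
  set u := Num.min _ _; have ux : u <= `|x 0 k| by rewrite ge_min lexx.
  have uy : u <= `|y 0 k| by rewrite ge_min lexx orbT.
  have s0 : 0 <= 1 - t by rewrite subr_ge0.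
  apply: le_trans (_ : (1 - t) * `|x 0 k| + t * `|y 0 k| <= _).
    rewrite -[u]mul1r -{1}(subrK t 1) mulrDl.
    by apply: lerD; exact: ler_wpM2l.
  rewrite mxE; have [[x0 y0]|[x0 y0]] := Eg k gk.
    rewrite (gtr0_norm x0) (gtr0_norm y0); exact: ler_norm.
  by rewrite (ltr0_norm x0) (ltr0_norm y0) !mulrN -opprD -normrN ler_norm.
have sqE (c : R) m (v : 'I_n -> R) :
    (c * monomial_at m v) ^+ 2 = c ^+ 2 * \prod_k (v k ^+ 2) ^+ m k.
  rewrite exprMn -prodrXl; congr (_ * _); apply: eq_bigr => k _.
  by rewrite -!exprM mulnC.
have [q qqs|l /andP[l0 l1] lP] := @small_factor _ qs
    (fun q => q.1.2 ^+ 2 * \prod_k M k ^+ q.2.2 k)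
    (fun q => q.1.1 ^+ 2 * \prod_k mu k ^+ q.2.1 k).
  split; first by rewrite mulr_ge0 ?sqr_ge0 // prodr_ge0 // => k _; rewrite exprn_ge0 ?sqr_ge0.
  rewrite mulr_gt0 ?exprn_even_gt0 ?q_neq0 // prodr_gt0 // => k _.
  have [->|mk] := posnP (q.2.1 k); first by rewrite expr0.
  rewrite exprn_gt0 // exprn_even_gt0 //= gt_eqF // lt_min !normr_gt0.
  by have [[x0 y0]|[x0 y0]] := Eg k (q_good qqs mk);
    rewrite ?(gt_eqF x0) ?(gt_eqF y0) ?(lt_eqF x0) ?(lt_eqF y0).
(* The flow itself, with parameter running from l to 1, is a polynomial path because the weights are
   natural numbers. *)
have shrink v : monomial_region v -> Q (weighted_scale l v) <-> Q v.
  move=> [vg vq]; pose gamma k : {poly R} := (v 0 k)%:P * 'X^(wt k).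
  have gE t : path_at gamma t = weighted_scale t v.
    by apply/rowP => k; rewrite !mxE /gamma hornerM hornerC hornerXn mulrC.
  have g1 : weighted_scale 1 v = v.
    by apply/rowP => k; rewrite mxE expr1n mul1r.
  rewrite -{2}g1 -!gE; apply: inv => // t /andP[lt t1]; rewrite gE.
  have t0 : 0 < t by exact: lt_le_trans lt.
  apply: region_scale => //; first by rewrite t0.
  by move=> q qqs; apply: le_lt_trans (vq q qqs); rewrite ler_piMl ?sqr_ge0.
apply/(shrink y Ey); move/(shrink x Ex): Qx.
pose gamma k : {poly R} := (l ^+ wt k)%:P * ((x 0 k)%:P + (y 0 k - x 0 k)%:P * 'X).
have gE t : path_at gamma t = weighted_scale l (z t).
  apply/rowP => k; rewrite !mxE /gamma !hornerE; congr (_ * _).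
  by rewrite mulrBl mulrBl mul1r mulrC; lra.
have z0 : z 0 = x by apply/rowP => k; rewrite mxE subr0 mul1r mul0r addr0.
have z1 : z 1 = y by apply/rowP => k; rewrite mxE subrr mul1r mul0r add0r.
rewrite -{1}z0 -z1 -!gE; apply: (inv _ _ _ _ _).1 => // t t01; rewrite gE.
apply: region_scale; first by rewrite l0.
  move=> k gk; have sx := Ex.1 k gk; have sy := Ey.1 k gk.
  rewrite mxE mulrDr !(mulrCA (sigma k)); have /andP[t0 t1] := t01.
  have [->|tn1] := eqVneq t 1; first by rewrite subrr mul0r add0r mul1r.
  have : 0 < 1 - t by rewrite subr_gt0 lt_neqAle tn1.
  move=> h; apply: ltr_pwDl; first exact: mulr_gt0.
  by rewrite mulr_ge0 // ltW.
move=> q qqs; apply: le_lt_trans (_ : _ <= l * (q.1.2 ^+ 2 * \prod_k M k ^+ q.2.2 k)) _.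
  rewrite ler_wpM2l ?(ltW l0) // sqE ler_wpM2l ?sqr_ge0 //.
  apply: ler_prod => k _; rewrite exprn_ge0 ?sqr_ge0 //=.
  by rewrite lerXn2r ?nnegrE ?sqr_ge0 ?zM.
apply: lt_le_trans (lP q qqs) _; rewrite sqE ler_wpM2l ?sqr_ge0 //.
apply: ler_prod => k _; rewrite exprn_ge0 ?sqr_ge0 //=.
have [->|mk] := posnP (q.2.1 k); first by rewrite !expr0.
by rewrite lerXn2r ?nnegrE ?sqr_ge0 ?zmu // (q_good qqs mk).
Qed.

End MonomialRegion.

(** * Monomial points *)

Section OrderedGroup.
Variable G : oagType.
Implicit Types x y : G.

Lemma oag_addr_gt0 x y : 0 < x -> 0 < y -> 0 < x + y.
Proof.
move=> x0 y0; apply: lt_le_trans x0 _.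
by have := oag_leD2r x _ _ (ltW y0); rewrite add0r addrC.
Qed.

Lemma oag_subr_gt0 x y : (0 < y - x) = (x < y).
Proof.
rewrite !oag_ltNge; congr (~~ _); apply/idP/idP => h.
  by have := oag_leD2r x _ _ h; rewrite subrK add0r.
by have := oag_leD2r (- x) _ _ h; rewrite subrr.
Qed.

End OrderedGroup.

Section HahnMonomials.
Variables (R : comNzRingType) (G : oagType).

Lemma hmonoE (c : R) (x y : G) : hmono c x y = if y == x then c else 0.
Proof. by []. Qed.

Lemma hmono0 (x : G) : hmono (0 : R) x = 0.
Proof. by apply: hahnP => y; rewrite hmonoE -[RHS]/(hmono (0 : R) (0 : G) y) hmonoE !if_same. Qed.

Lemma hmonoM (c d : R) (x y : G) : hmono c x * hmono d y = hmono (c * d) (x + y).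
Proof.
apply: hahnP => z; rewrite -[LHS]/(hmul_fun (hmono c x) (hmono d y) z).
rewrite (@hmul_funE _ _ _ _ _ [:: x]) //; last first.
  by move=> b + _; rewrite hmonoE mem_seq1; case: (b =P x) => //; rewrite eqxx.
rewrite big_seq1 !hmonoE eqxx (can2_eq (subrK _) (addrK _)) addrC.
by case: eqP => // _; rewrite mulr0.
Qed.

Lemma hmonoX (c : R) (x : G) k : hmono c x ^+ k = hmono (c ^+ k) (x *+ k).
Proof. by elim: k => [|k IH] //; rewrite !exprS IH hmonoM -mulrS. Qed.

Lemma hmonoZ (r c : R) (x : G) : r *: hmono c x = hmono (r * c) x.
Proof.
apply: hahnP => y; rewrite -[LHS]/(r * hmono c x y) !hmonoE.
by case: eqP => // _; rewrite mulr0.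
Qed.

Lemma hmono_prod (I : Type) (s : seq I) (c : I -> R) (x : I -> G) :
  \prod_(k <- s) hmono (c k) (x k) = hmono (\prod_(k <- s) c k) (\sum_(k <- s) x k).
Proof.
elim: s => [|k s IH]; first by rewrite !big_nil.
by rewrite !big_cons IH hmonoM.
Qed.

Lemma hval_unique (f : hahn R G) x :
  f x != 0 -> (forall y, f y != 0 -> x <= y) -> hval f = x.
Proof.
move=> fx xP; have f0 : f != 0.
  apply: contraNneq fx => ->.
  by rewrite -[(0 : hahn R G) x]/(hmono (0 : R) (0 : G) x) hmonoE if_same.
have [h1 h2] := hvalP f0; apply/eqP; rewrite eq_le h2 //.
exact: xP.
Qed.

End HahnMonomials.

Lemma ler_double_sub (D : realDomainType) (u v t : D) :
  v *+ 2 <= u -> t <= v -> u <= (u - t) *+ 2.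
Proof. by move=> vu tv; lra. Qed.

(** * Domination between monomials at a monomial point *)

Section MonomialPoint.
Variables (R : rcfType) (n : nat) (alpha beta : sper {mpoly R[n]}) (G : oagType).
Local Notation A := {mpoly R[n]}.
Variables (s : G -> int) (phi : {lrmorphism A -> hahn R G}).
Variables (c : 'I_n -> R) (a : 'I_n -> G).
Hypothesis sP : sign_choice s.
Hypothesis a_gt0 : forall j, 0 < a j.
Hypothesis a_free : Q_independent a.
Hypothesis phiX : forall j, phi 'X_j = hmono (c j) (a j).
Hypothesis alphaP : semi_curvette_point s phi alpha.
Implicit Types (m : 'X_{1..n}) (f g : A) (r : R).

Let cm m : R := \prod_k c k ^+ m k.
Let am m : G := \sum_k a k *+ m k.

Let phiM r m : phi (r *: 'X_[m]) = hmono (r * cm m) (am m).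
Proof.
rewrite linearZ /= mpolyXE_id rmorph_prod -hmonoZ; congr (_ *: _).
rewrite -hmono_prod; apply: eq_bigr => k _.
by rewrite rmorphXn /= phiX hmonoX.
Qed.

Let ev_eq0 f : phi f = 0 -> sper_ev alpha f = 0.
Proof.
move=> f0; have e : phi f = phi 0 by rewrite f0 rmorph0.
rewrite -(rmorph0 (sper_ev alpha)); apply/eqP; rewrite eq_le /=.
by rewrite !alphaP.2 e -!alphaP.2 lexx.
Qed.

(** The image of x^m is [cm m] t^([am m]), so [cm m = 0] means that x^m vanishes at alpha and has
    infinite value. *)
Let dominates m0 m := cm m0 != 0 /\ (cm m = 0 \/ am m0 < am m).

(** The coefficients are arbitrary, since the sign is decided by the term of least exponent.
    Squaring makes that exponent twice an element of the group, so its chosen sign is 1. *)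
Let dominates_sqr m0 m r r' : dominates m0 m -> r != 0 ->
  sper_ev alpha (r' *: 'X_[m]) ^+ 2 < sper_ev alpha (r *: 'X_[m0]) ^+ 2.
Proof.
move=> [c0 dom] r0; rewrite -!rmorphXn ltNge alphaP.2 /hle.
set A2 := (r * cm m0) ^+ 2; set B2 := (r' * cm m) ^+ 2.
set u := am m0 *+ 2; set v := am m *+ 2.
have A0 : 0 < A2 by rewrite exprn_even_gt0 //= mulf_neq0.
have su : s u = 1.
  by rewrite /u mulr2n sP.2; have [->|->] := sP.1 (am m0).
pose g := hmono B2 v - hmono A2 u.
have -> : phi ((r' *: 'X_[m]) ^+ 2) - phi ((r *: 'X_[m0]) ^+ 2) = g.
  by rewrite !rmorphXn /= !phiM !hmonoX.
rewrite /hsgn.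
have gE y : g y = (if y == v then B2 else 0) - (if y == u then A2 else 0) by [].
have [uv|vB] : u < v \/ B2 = 0.
  case: dom => [cm0|h]; first by right; rewrite /B2 cm0 mulr0 expr0n.
  left; rewrite -oag_subr_gt0 /u /v -mulrnBl mulr2n; apply: oag_addr_gt0;
  by rewrite oag_subr_gt0.
- have gu : g u = - A2 by rewrite gE eqxx (lt_eqF uv) sub0r.
  rewrite (@hval_unique _ _ g u) ?gu ?oppr_eq0 ?gt_eqF //; last first.
    move=> y; rewrite gE; case: (y =P v) => [-> _|_]; first exact: ltW.
    by case: (y =P u) => [->//|_]; rewrite subr0 eqxx.
  by rewrite su mulr1 ltr0_sgz // oppr_lt0.
- have gu : g u = - A2 by rewrite gE eqxx vB if_same sub0r.
  rewrite (@hval_unique _ _ g u) ?gu ?oppr_eq0 ?gt_eqF //; last first.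
    move=> y; rewrite gE vB if_same; case: (y =P u) => [->//|_].
    by rewrite subr0 eqxx.
  by rewrite su mulr1 ltr0_sgz // oppr_lt0.
Qed.

Let dominates_norm m0 m r r' : dominates m0 m -> r != 0 ->
  `|sper_ev alpha (r' *: 'X_[m])| < `|sper_ev alpha (r *: 'X_[m0])|.
Proof.
move=> dom r0; have := dominates_sqr r' dom r0.
by rewrite -(real_normK (num_real _)) -[ltRHS]real_normK ?num_real // ltr_pXn2r ?nnegrE.
Qed.

Lemma seq_min (T : eqType) (le : rel T) (x : T) (ts : seq T) :
  total le -> transitive le ->
  exists2 t, t \in x :: ts & forall u, u \in x :: ts -> le t u.
Proof.
move=> le_tot le_trans; have le_refl y : le y y by case/orP: (le_tot y y).
elim: ts x => [|y ts IHs] x.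
  by exists x => [|u]; rewrite mem_seq1 // => /eqP ->.
have [t tts tP] := IHs y.
case/orP: (le_tot x t) => h.
  exists x; first exact: mem_head.
  by move=> u /predU1P[->//|/tP]; exact: le_trans.
by exists t => [|u]; rewrite in_cons ?tts ?orbT // => /predU1P[->|/tP].
Qed.

(** Among the monomials of g that do not vanish at alpha, of which there is one because g does not,
    the least [am] is taken; by independence it is attained only once. *)
Let dominant_monomial g : sper_ev alpha g != 0 ->
  exists2 m0, m0 \in msupp g & forall m, m \in msupp g -> m != m0 -> dominates m0 m.
Proof.
move=> g0.
have [s0 s0E] : exists s0, s0 = [seq m <- msupp g | cm m != 0].
  by exists [seq m <- msupp g | cm m != 0].
case: s0 s0E => [|m1 s1] s0E.
  case/eqP: g0; apply: ev_eq0; rewrite [g]mpolyE rmorph_sum big_seq big1 // => m mg.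
  rewrite /= phiM; have : m \notin [seq m <- msupp g | cm m != 0] by rewrite -s0E.
  by rewrite mem_filter mg andbT negbK => /eqP ->; rewrite mulr0 hmono0.
have [m0 m0s m0min] : exists2 t, t \in m1 :: s1 & forall u, u \in m1 :: s1 -> am t <= am u.
  apply: (@seq_min _ (fun m m' => am m <= am m')) => [m m'|m m' m'']; first exact: oag_le_total.
  exact: le_trans.
move: m0s; rewrite s0E mem_filter => /andP[cm0 m0g].
exists m0 => // m mg mm0; split=> //.
have [cm_0|cmn] := eqVneq (cm m) 0; [by left|right].
have : am m0 <= am m by apply: m0min; rewrite s0E mem_filter cmn.
rewrite le_eqVlt => /predU1P[e|//]; case/eqP: mm0; apply/mnmP => k.
have /(_ k)/eqP : forall k, (m k)%:Z - (m0 k)%:Z = 0.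
  apply: a_free; under eq_bigr do rewrite mulrzBr.
  by rewrite sumrB -[X in X - _]/(am m) -[X in _ - X]/(am m0) e subrr.
by rewrite subr_eq0 => /eqP [].
Qed.


(** Exponent vectors of positive value, a variable with c_j = 0 counting as infinite: a positive
    exponent of such a variable outweighs the finite part. Requiring nonnegative exponents at all
    these variables keeps the set closed under addition. *)
Let lex_pos (d : 'I_n -> int) := (forall j, c j = 0 -> 0 <= d j) /\
  ((exists2 j, c j = 0 & 0 < d j) \/ 0 < \sum_j a j *~ d j).

Let lex_posD d e : lex_pos d -> lex_pos e -> lex_pos (fun k => d k + e k).
Proof.
move=> [d0 d1] [e0 e1]; split; first by move=> j cj; rewrite addr_ge0 ?d0 ?e0.
case: d1 => [[j cj dj]|d1]; first by left; exists j; rewrite // ltr_pwDl ?e0.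
case: e1 => [[j cj ej]|e1]; first by left; exists j; rewrite // ltr_wpDl ?d0.
right; under eq_bigr do rewrite mulrzDr.
by rewrite big_split; exact: oag_addr_gt0.
Qed.

Let lex_pos_neq0 : ~ lex_pos (fun=> 0).
Proof. by case=> _ [[j _]|]; rewrite ?ltxx // big1 ?ltxx. Qed.

Let lex_pos_delta j : lex_pos (fun k => (k == j)%:Z).
Proof.
split; first by [].
right; rewrite (bigD1 j) //= eqxx mulr1z big1 ?addr0 // => k kj.
by rewrite (negPf kj) mulr0z.
Qed.

Let dominates_lex_pos m0 m : dominates m0 m -> lex_pos (fun k => (m k)%:Z - (m0 k)%:Z).
Proof.
move=> [c0 dom]; have z0 j : c j = 0 -> m0 j = 0%N.
  move=> cj; apply/eqP; rewrite -leqn0 leqNgt; apply/negP => m0j.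
  by case/eqP: c0; rewrite /cm (bigD1 j) //= cj expr0n gtn_eqF // mul0r.
split; first by move=> j /z0 ->; rewrite subr0.
case: dom => [/eqP/prodf_eq0[j _]|h].
  rewrite expf_eq0 => /andP[mj /eqP cj]; left; exists j => //.
  by rewrite (z0 j cj) subr0 ltz_nat.
right; under eq_bigr do rewrite mulrzBr.
by rewrite sumrB oag_subr_gt0.
Qed.

Let good k := (0 < sper_ev alpha 'X_k) && (0 < sper_ev beta 'X_k) ||
  (sper_ev alpha 'X_k < 0) && (sper_ev beta 'X_k < 0).

Let sigma k : R := if 0 < sper_ev alpha 'X_k then 1 else -1.

Let good_sigma k : good k ->
  0 < sper_ev alpha (sigma k *: 'X_k) /\ 0 < sper_ev beta (sigma k *: 'X_k).
Proof.
move=> /orP[/andP[h1 h2]|/andP[h1 h2]].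
  have -> : sigma k = 1 by rewrite /sigma h1.
  by rewrite scale1r.
have -> : sigma k = -1 by rewrite /sigma ltNge (ltW h1).
by rewrite scaleN1r; split; rewrite rmorphN oppr_gt0.
Qed.

Let term_norm_le g m0 : m0 \in msupp g ->
  (forall m, m \in msupp g -> m != m0 -> dominates m0 m) ->
  `|sper_ev alpha g| <= (size (msupp g))%:R * `|sper_ev alpha (g@_m0 *: 'X_[m0])|.
Proof.
move=> m0g dom; rewrite {1}[g]mpolyE rmorph_sum /=.
apply: le_trans (ler_norm_sum _ _ _) _.
rewrite mulr_natl -sum1_size -sumrMnr; rewrite !big_seq; apply: ler_sum => m mg.
rewrite mulr1n; have [->//|mm0] := eqVneq m m0.
apply: ltW; apply: dominates_norm; first exact: dom.
by rewrite -mcoeff_msupp.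
Qed.

(** If x_k has no common strict sign at alpha and beta, then x_k or - x_k is a generator of the
    ideal. The leading term is a multiple of x_k and bounds g at alpha up to the number of terms, so
    g would lie in the ideal by convexity. *)
Let lead_good g m0 k : ~ separating_ideal alpha beta g -> m0 \in msupp g ->
  (forall m, m \in msupp g -> m != m0 -> dominates m0 m) ->
  (0 < m0 k)%N -> good k.
Proof.
move=> gI m0g dom m0k; apply: contrapT => /negP ngood; apply: gI.
have [f [fa fb fX]] : exists f, [/\ 0 <= sper_ev alpha f, sper_ev beta f <= 0 &
    f = 'X_k \/ f = - 'X_k].
  have tri (d : sper A) (x : residue d) : [\/ x < 0, 0 < x | x = 0].
    by have [h|h|h] := ltgtP x 0; [constructor 1|constructor 2|constructor 3].
  have oppX (d : sper A) : sper_ev d (- 'X_k) = - sper_ev d 'X_k := rmorphN _ _.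
  have [x0|x0|x0] := tri _ (sper_ev alpha 'X_k);
      have [y0|y0|y0] := tri _ (sper_ev beta 'X_k).
  - by case/negP: ngood; apply/orP; right; apply/andP.
  - by exists (- 'X_k); split; [rewrite oppX oppr_ge0 ltW|rewrite oppX oppr_le0 ltW|right].
  - by exists (- 'X_k); split; [rewrite oppX oppr_ge0 ltW|rewrite oppX y0 oppr0|right].
  - by exists 'X_k; split; [exact: ltW|exact: ltW|left].
  - by case/negP: ngood; apply/orP; left; apply/andP.
  - by exists 'X_k; split; [exact: ltW|rewrite y0|left].
  - by exists 'X_k; split; [rewrite x0|exact: ltW|left].
  - by exists (- 'X_k); split; [rewrite oppX x0 oppr0|rewrite oppX oppr_le0 ltW|right].
  - by exists 'X_k; split; [rewrite x0|rewrite y0|left].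
pose z0 := ((size (msupp g))%:R * g@_m0) *: 'X_[(m0 - U_(k))%MM] : A.
have zX : `|sper_ev alpha z0| * `|sper_ev alpha f| =
    (size (msupp g))%:R * `|sper_ev alpha (g@_m0 *: 'X_[m0])|.
  have -> : `|sper_ev alpha f| = `|sper_ev alpha 'X_k|.
    by case: fX => ->; rewrite // rmorphN normrN.
  rewrite -normrM -rmorphM /z0 -scalerAl -mpolyXD submK; last by rewrite lep1mP -lt0n.
  by rewrite -scalerA scaler_nat rmorphMn /= normrMn mulr_natl.
have [z zE] : exists z, sper_ev alpha z = `|sper_ev alpha z0|.
  have [h|h] := leP 0 (sper_ev alpha z0); first by exists z0; rewrite ger0_norm.
  by exists (- z0); rewrite rmorphN ltr0_norm.
apply: (separating_ideal_convex (z := z) fa fb).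
by rewrite zE -{1}(ger0_norm fa) zX term_norm_le.
Qed.

Lemma monomial_point_separated : separated_by_paths alpha beta.
Proof.
move=> gs gsI.
have ev_gs g : g \in gs -> sper_ev alpha g != 0.
  move=> /gsI gI; apply/eqP => g0; apply: gI.
  by apply: (@separating_ideal_convex _ _ _ 0 g 0); rewrite ?rmorph0 ?g0 ?normr0 ?mulr0.
have [lead leadP] : exists lead : A -> 'X_{1..n}, forall g, g \in gs ->
    lead g \in msupp g /\
    forall m, m \in msupp g -> m != lead g -> dominates (lead g) m.
  apply: (dependent_choice (Q := fun g m0 => g \in gs -> m0 \in msupp g /\
    forall m, m \in msupp g -> m != m0 -> dominates m0 m)) => g.
  have [ggs|ngs] := boolP (g \in gs); last by exists 0%MM.
  by have [m0 h1 h2] := dominant_monomial (ev_gs g ggs); exists m0.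
pose N (g : A) : R := (size (msupp g))%:R.
(* The factor [N g] makes each other term smaller than the leading one divided by the number of
   terms. It costs nothing at alpha, where domination absorbs constants. *)
pose qs := [seq ((g@_(lead g), N g * g@_m), (lead g, m)) | g <- gs,
  m <- [seq m <- msupp g | m != lead g]].
have qsP q : q \in qs -> exists g m, [/\ g \in gs, m \in msupp g, m != lead g &
    q = ((g@_(lead g), N g * g@_m), (lead g, m))].
  move=> /allpairsPdep[g [m [ggs]]]; rewrite mem_filter => /andP[ml mg] ->.
  by exists g, m.
have [|wt wtP] := monomial_weights (s := map snd qs) lex_posD lex_pos_neq0 lex_pos_delta.
  move=> _ /mapP[q /qsP[g [m [ggs mg ml ->]]] ->] /=.
  by apply: dominates_lex_pos; apply: (leadP g ggs).2.
pose L : seq A := [seq sigma k *: 'X_k | k <- enum 'I_n & good k] ++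
  [seq (q.1.1 *: 'X_[q.2.1]) ^+ 2 - (q.1.2 *: 'X_[q.2.2]) ^+ 2 | q <- qs].
have LP (d : sper A) : (forall k, good k -> 0 < sper_ev d (sigma k *: 'X_k)) ->
    (forall q, q \in qs -> sper_ev d (q.1.2 *: 'X_[q.2.2]) ^+ 2 <
       sper_ev d (q.1.1 *: 'X_[q.2.1]) ^+ 2) -> basic_open L d.
  move=> h1 h2 f; rewrite mem_cat => /orP[/mapP[k + ->]|/mapP[q qqs ->]].
    by rewrite mem_filter => /andP[gk _]; exact: h1.
  by rewrite rmorphB !rmorphXn /= subr_gt0 h2.
have lead_neq0 g : g \in gs -> g@_(lead g) != 0.
  by move=> ggs; rewrite -mcoeff_msupp; case: (leadP g ggs).
have posE : pos_set L = monomial_region good sigma qs.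
  have h1 k (x : 'rV[R]_n) : (sigma k *: 'X_k : A).@[x 0] = sigma k * x 0 k.
    by rewrite mevalZ mevalXU.
  have h2 r m (x : 'rV[R]_n) : (r *: 'X_[m] : A).@[x 0] = r * monomial_at m (x 0).
    by rewrite mevalZ mevalX.
  apply/seteqP; split=> x Lx.
    split=> [k gk|q qqs].
      rewrite -h1; apply: Lx; rewrite mem_cat; apply/orP; left.
      by apply/mapP; exists k; rewrite // mem_filter gk mem_enum.
    rewrite -!h2 -!rmorphXn -subr_gt0 -mevalB; apply: Lx; rewrite mem_cat; apply/orP; right.
    by apply/mapP; exists q.
  move=> f; rewrite mem_cat => /orP[/mapP[k + ->]|/mapP[q qqs ->]].
    by rewrite mem_filter h1 => /andP[gk _]; exact: Lx.1.
  by rewrite mevalB !rmorphXn /= !h2 subr_gt0; exact: Lx.2.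
exists L; split.
- apply: LP => [k /good_sigma[]//|q /qsP[g [m [ggs mg ml ->]]]] /=.
  apply: dominates_sqr; last exact: lead_neq0.
  exact: (leadP g ggs).2.
- apply: LP => [k /good_sigma[]//|q /qsP[g [m [ggs mg ml ->]]]] /=.
  set T0 := _ *: 'X_[lead g]; set Tm := _ *: 'X_[m].
  apply: contrapT => /negP; rewrite -leNgt => le_b; apply: (gsI g ggs).
  have abs (e : sper A) (f : A) : exists f', sper_ev e f' = `|sper_ev e f| /\
      forall d, `|sper_ev d f'| = `|sper_ev d f|.
    have [h|h] := leP 0 (sper_ev e f); first by exists f; rewrite ger0_norm.
    exists (- f); split; first by rewrite rmorphN ltr0_norm.
    by move=> d; rewrite rmorphN normrN.
  (* [S] is [T0] up to sign, nonnegative at alpha; [T] is [Tm] up to sign, nonnegative at beta. If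
     the inequality failed at beta, S - T would be <= 0 there, and at alpha it is at least |T0| / 2
     because 2 |Tm| <= |T0|. As |g| <= N |T0| at alpha, with N the number of terms, convexity with
     constant 2 N would put g in the ideal. *)
  have [S [Sa Sd]] := abs alpha T0; have [T [Tb Td]] := abs beta Tm.
  have Tm_a : `|sper_ev alpha Tm| *+ 2 <= `|sper_ev alpha T0|.
    apply: ltW; rewrite -normrMn -rmorphMn /= /Tm scalerMnl.
    by apply: dominates_norm; [exact: (leadP g ggs).2|exact: lead_neq0].
  have Tm_b : `|sper_ev beta T0| <= `|sper_ev beta Tm|.
    move: le_b; rewrite -(real_normK (num_real _)) -[leRHS]real_normK ?num_real //.
    by rewrite ler_pXn2r ?nnegrE.
  have ha : `|sper_ev alpha T0| <= sper_ev alpha (S - T) *+ 2.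
    rewrite rmorphB /= Sa; apply: (ler_double_sub Tm_a).
    by rewrite -Td; exact: ler_norm.
  have hb : sper_ev beta (S - T) <= 0.
    rewrite rmorphB /= Tb subr_le0; apply: le_trans (ler_norm _) _.
    by rewrite Sd.
  have h0 : 0 <= sper_ev alpha (S - T).
    by rewrite -(pmulrn_lge0 _ (isT : (0 < 2)%N)) (le_trans _ ha).
  apply: (separating_ideal_convex (z := (size (msupp g) * 2)%:R) h0 hb).
  apply: le_trans (term_norm_le (leadP g ggs).1 (leadP g ggs).2) _.
  by rewrite rmorph_nat natrM -mulrA (mulr_natl _ 2) ler_wpM2l // ler0n.
- rewrite posE; apply: (@monomial_region_path_connected _ _ _ _ _ wt).
  + by move=> q qqs; apply: wtP; exact: map_f.
  + by move=> q /qsP[g [m [ggs _ _ ->]]]; exact: lead_neq0.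
  move=> q /qsP[g [m [ggs _ _ ->]]] k /=.
  exact: (lead_good (gsI g ggs) (leadP g ggs).1 (leadP g ggs).2).
move=> d Ld g ggs; set T0 := sper_ev d (g@_(lead g) *: 'X_[lead g]).
have unit r : r != 0 -> sper_ev d r%:MP != 0.
  move=> r0; apply/eqP => e; have : sper_ev d (r%:MP * r^-1%:MP) = 1.
    by rewrite -mpolyCM mulfV // rmorph1.
  by move/eqP; rewrite rmorphM /= e mul0r eq_sym oner_eq0.
have T0_neq0 : T0 != 0.
  rewrite /T0 -mul_mpolyC rmorphM mulf_neq0 ?unit ?lead_neq0 //.
  rewrite mpolyXE_id rmorph_prod; apply/prodf_neq0 => k _; rewrite rmorphXn.
  have [->|lk] := posnP (lead g k); first by rewrite expr0 oner_eq0.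
  rewrite expf_neq0 //; apply/eqP => /= Xk.
  have gk : good k by apply: (lead_good (gsI g ggs) _ _ lk); case: (leadP g ggs).
  have : 0 < sper_ev d (sigma k *: 'X_k).
    apply: Ld; rewrite mem_cat; apply/orP; left.
    by apply/mapP; exists k; rewrite // mem_filter gk mem_enum.
  by rewrite -mul_mpolyC rmorphM /= Xk mulr0 ltxx.
(* If g vanished at d, its leading term would be minus the sum of the N - 1 others, and the
   inequalities would give N |T0| <= (N - 1) |T0|, hence T0 = 0. *)
apply: contraNneq T0_neq0 => g0.
have small m : m \in msupp g -> m != lead g ->
    (size (msupp g))%:R * `|sper_ev d (g@_m *: 'X_[m])| <= `|T0|.
  move=> mg ml; have : 0 < sper_ev d ((g@_(lead g) *: 'X_[lead g]) ^+ 2 -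
      ((N g * g@_m) *: 'X_[m]) ^+ 2).
    apply: Ld; rewrite mem_cat; apply/orP; right.
    apply/mapP; exists ((g@_(lead g), N g * g@_m), (lead g, m)) => //.
    by apply/allpairsPdep; exists g, m; rewrite mem_filter ml mg.
  rewrite rmorphB !rmorphXn /= subr_gt0 -/T0.
  rewrite -(real_normK (num_real _)) -[ltRHS]real_normK ?num_real // ltr_pXn2r ?nnegrE //.
  by rewrite -scalerA /N scaler_nat rmorphMn /= normrMn mulr_natl => /ltW.
have sum0 : T0 = - \sum_(m <- msupp g | m != lead g) sper_ev d (g@_m *: 'X_[m]).
  apply/eqP; rewrite -addr_eq0; apply/eqP; rewrite -[RHS]g0 [in RHS](mpolyE g) rmorph_sum.
  by rewrite (bigD1_seq (lead g)) ?msupp_uniq //=; case: (leadP g ggs).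
have le1 : (size (msupp g))%:R * `|T0| <= \sum_(m <- msupp g | m != lead g) `|T0|.
  rewrite {1}sum0 normrN; apply: le_trans (_ : (size (msupp g))%:R *
      \sum_(m <- msupp g | m != lead g) `|sper_ev d (g@_m *: 'X_[m])| <= _).
    by rewrite ler_wpM2l // ler_norm_sum.
  rewrite mulr_sumr big_seq_cond [leRHS]big_seq_cond; apply: ler_sum => m /andP[mg ml].
  exact: small.
have le2 : (size (msupp g))%:R * `|T0| =
    `|T0| + \sum_(m <- msupp g | m != lead g) `|T0|.
  rewrite mulr_natl -sum1_size -sumrMnr.
  by rewrite (bigD1_seq (lead g)) ?msupp_uniq //=; case: (leadP g ggs).
rewrite -normr_eq0 eq_le normr_ge0 andbT; move: le1; rewrite le2.
by rewrite -lerBrDr subrr.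
Qed.

End MonomialPoint.

Theorem corollary4p1 (R : rcfType) (n : nat) (alpha beta : sper {mpoly R[n]}) :
  monomial_point alpha \/ monomial_point beta ->
  (forall (s : nat) (g : 'I_s -> {mpoly R[n]}),
     (forall i, ~ separating_ideal alpha beta (g i)) ->
     exists C : set (sper {mpoly R[n]}),
       [/\ connected C, C alpha, C beta &
           forall i, C `&` sper_zeros (g i) = set0]) /\
  (forall f : 'rV[R]_n -> R, piecewise_polynomial f ->
     forall f_alpha f_beta : {mpoly R[n]},
       local_representative f alpha f_alpha ->
       local_representative f beta f_beta ->
       separating_ideal alpha beta (f_alpha - f_beta)).
Proof.
have sep (a b : sper {mpoly R[n]}) : monomial_point a -> separated_by_paths a b.
  move=> [s [phi [c [e [hs e0 free phiX aP]]]]].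
  exact: (@monomial_point_separated R n a b _ s phi c e hs e0 free phiX aP).
(* The separating ideal is symmetric in the two points, so it suffices to treat a monomial first
   point. *)
have sym (a b : sper {mpoly R[n]}) : separated_by_paths a b -> separated_by_paths b a.
  move=> h gs gsI; have [|L [La Lb pc Lg]] := h gs; last by exists L.
  by move=> g /gsI gI /separating_ideal_sym.
move=> ab; have {ab}h : separated_by_paths alpha beta by case: ab => /sep // /(_ alpha)/sym.
split; first exact: separated_connected h.
by move=> f _ fa fb; exact: separated_pierce_birkhoff.
Qed.
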